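(* Let $a\in\mathbb{R}$ and suppose that $\{\lambda_i,\varphi_i(a)\}_{i=1}^N$ is the interior spectral data at $a$ of some pair $(\omega,v)$. Assume that $\alpha\neq0$ and $\varphi_i(a)\neq0$ for all $i=1,\dots,N$. (i) If $\lambda_1>0$ or $\lambda_N<0$, then exactly two pairs $(\omega,v)$ yield the given interior spectral data $\{\lambda_i,\varphi_i(a)\}_{i=1}^N$ at $a$. (ii) If $\lambda_{j_0}<0<\lambda_{j_0+1}$ for some $j_0\in\{1,\dots,N-1\}$, then exactly four pairs $(\omega,v)$ yield the given interior spectral data $\{\lambda_i,\varphi_i(a)\}_{i=1}^N$ at $a$.
   Context: A pair $(\omega,v)$ means: for some $n\in\mathbb{N}$, $n\ge 1$, and real points $x_1<\dots<x_n$, $\omega=\sum_{i=1}^n\omega_i\delta_{x_i}$ and $v=\sum_{i=1}^n v_i\delta_{x_i}$ with $\omega_i\in\mathbb{R}$, $v_i\ge 0$ and $|\omega_i|+v_i>0$ ($\delta_x$ is the Dirac measure at $x$). The number $n$, the points and the weights may differ from pair to pair. For $z\in\mathbb{C}$ consider $-f''+\frac14 f=z\omega f+z^2vf$ on $\mathbb{R}$, meaning: $f$ is continuous, $-f''+\frac14 f=0$ on $\mathbb{R}\setminus\{x_1,\dots,x_n\}$, and $f'(x_i-)=f'(x_i+)+z\omega_if(x_i)+z^2v_if(x_i)$ for every $i$. An eigenvalue is a $z$ for which there is a nontrivial bounded solution. The eigenvalues form a finite set of nonzero real numbers $\lambda_1<\dots<\lambda_N$. For $z\in\mathbb{C}$,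 $\phi_\pm(z,\cdot)$ are the solutions with $\phi_\pm(z,x)=e^{\mp x/2}$ for all $x$ near $\pm\infty$. For an eigenvalue $\lambda$ put $\gamma_\lambda^2:=\int_{\mathbb{R}}|\phi_+(\lambda,x)|^2d\omega(x)+2\lambda\int_{\mathbb{R}}|\phi_+(\lambda,x)|^2dv(x)$; one has $\lambda\gamma_\lambda^2>0$. The normalized eigenfunctions are $\varphi_i(x)=\phi_+(\lambda_i,x)/\sqrt{\lambda_i\gamma_{\lambda_i}^2}$. For $a\in\mathbb{R}$, the family $\{\lambda_i,\varphi_i(a)\}_{i=1}^N$ is called the interior spectral data of $(\omega,v)$ at $a$. Put $\alpha:=1-\sum_{i=1}^N|\varphi_i(a)|^2$. *)

(* Defs.v *)
From Stdlib Require Import Reals Lra List Sorted.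
From Coquelicot Require Import Coquelicot.
Import ListNotations.
Open Scope R_scope.

Record atom := Atom { pos : R; w_omega : R; w_v : R }.

(* The list of atoms (x_i, omega_i, v_i), in increasing order of x_i, encodes
   omega = sum omega_i delta_(x_i) and v = sum v_i delta_(x_i).  For lists
   satisfying [is_pair] the encoding is one-to-one: see [is_pair_ext]. *)
Definition config := list atom.

Definition is_pair (p : config) : Prop :=
  (1 <= length p)%nat /\
  StronglySorted (fun s t => pos s < pos t) p /\
  forall s, In s p -> 0 <= w_v s /\ 0 < Rabs (w_omega s) + w_v s.

Definition integral (weight : atom -> R) (p : config) (g : R -> R) : R :=
  fold_right Rplus 0 (map (fun s => weight s * g (pos s)) p).

Definition int_omega : config -> (R -> R) -> R := integral w_omega.
Definition int_v : config -> (R -> R) -> R := integral w_v.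

(* [f1 x] is f'(x) and [f2 x] is f''(x) off the points x_i; their values at the
   points x_i are not used.  Derivatives are those of functions R -> C, with C
   as a normed space over R. *)
Definition is_solution (p : config) (z : C) (f : R -> C) : Prop :=
  (forall x : R, continuous f x) /\
  exists f1 f2 : R -> C,
    (forall x : R, ~ In x (map pos p) ->
       @is_derive R_AbsRing C_R_NormedModule f x (f1 x) /\
       @is_derive R_AbsRing C_R_NormedModule f1 x (f2 x) /\
       (- f2 x + RtoC (1 / 4) * f x = 0)%C) /\
    (forall s, In s p ->
       exists dl dr : C,
         filterlim f1 (at_left (pos s)) (locally dl) /\
         filterlim f1 (at_right (pos s)) (locally dr) /\
         (dl = dr + z * RtoC (w_omega s) * f (pos s)
                  + z * z * RtoC (w_v s) * f (pos s))%C).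

Definition is_eigenvalue (p : config) (z : C) : Prop :=
  exists f : R -> C,
    is_solution p z f /\
    (exists x : R, f x <> RtoC 0) /\
    (exists M : R, forall x : R, Cmod (f x) <= M).

Definition is_phi_plus (p : config) (z : C) (f : R -> C) : Prop :=
  is_solution p z f /\
  exists M : R, forall x : R, M < x -> f x = RtoC (exp (- x / 2)).

(* gamma_lambda^2, where f stands for phi_+(lambda, .). *)
Definition gamma2 (p : config) (lambda : R) (f : R -> C) : R :=
  int_omega p (fun x => Cmod (f x) ^ 2)
  + 2 * lambda * int_v p (fun x => Cmod (f x) ^ 2).

(* The family {lam i, c i} is indexed by 1 <= i <= N; the values of lam and c
   at other indices are irrelevant. *)
Definition interior_spectral_data
    (p : config) (a : R) (N : nat) (lam c : nat -> R) : Prop :=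
  (forall i j : nat, (1 <= i)%nat -> (i < j)%nat -> (j <= N)%nat ->
     lam i < lam j) /\
  (forall z : C, is_eigenvalue p z <->
     exists i : nat, (1 <= i <= N)%nat /\ z = RtoC (lam i)) /\
  (forall i : nat, (1 <= i <= N)%nat ->
     exists f : R -> C,
       is_phi_plus p (RtoC (lam i)) f /\
       RtoC (c i) = (f a / RtoC (sqrt (lam i * gamma2 p (lam i) f)))%C).

Definition alpha (N : nat) (c : nat -> R) : R :=
  1 - sum_n_m (fun i => Rabs (c i) ^ 2) 1 N.

Definition exactly (n : nat) (P : config -> Prop) : Prop :=
  exists l : list config,
    NoDup l /\ length l = n /\ forall p : config, In p l <-> P p.

Lemma integral_point_left (weight : atom -> R) (p : config) (x : R) :
  List.Forall (fun t => x < pos t) p ->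
  integral weight p (fun y => if Req_EM_T y x then 1 else 0) = 0.
Proof.
  induction 1 as [|t p Ht _ IH]; [reflexivity|].
  unfold integral in *; simpl; rewrite IH.
  destruct (Req_EM_T (pos t) x); lra.
Qed.

Lemma integral_point_head (weight : atom -> R) (s : atom) (p : config) :
  List.Forall (fun t => pos s < pos t) p ->
  integral weight (s :: p) (fun y => if Req_EM_T y (pos s) then 1 else 0)
  = weight s.
Proof.
  intros H; pose proof (integral_point_left weight p (pos s) H) as E.
  unfold integral in *; simpl; rewrite E.
  destruct (Req_EM_T (pos s) (pos s)); [lra|congruence].
Qed.

(* Two encodings of the same measures omega and v are equal. *)
Lemma is_pair_ext (p q : config) :
  is_pair p -> is_pair q ->
  (forall g, int_omega p g = int_omega q g) ->
  (forall g, int_v p g = int_v q g) ->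
  p = q.
Proof.
  unfold int_omega, int_v.
  intros [_ [Sp Wp]] [_ [Sq Wq]]; revert q Sq Wq Wp.
  assert (Z : forall s : atom, 0 <= w_v s /\ 0 < Rabs (w_omega s) + w_v s ->
              w_omega s = 0 -> w_v s = 0 -> False).
  { intros s [_ H] E1 E2; rewrite E1, E2, Rabs_R0 in H; lra. }
  induction Sp as [|s p Sp IH Fp]; intros q Sq Wq Wp Ho Hv.
  - destruct Sq as [|t q Sq Fq]; [reflexivity|exfalso].
    apply (Z t (Wq t (or_introl eq_refl))).
    + rewrite <- (integral_point_head w_omega t q Fq), <- Ho; reflexivity.
    + rewrite <- (integral_point_head w_v t q Fq), <- Hv; reflexivity.
  - assert (Fs : forall q, List.Forall (fun t => pos s < pos t) q ->
      (forall g, integral w_omega (s :: p) g = integral w_omega q g) ->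
      (forall g, integral w_v (s :: p) g = integral w_v q g) -> False).
    { intros q' F Ho' Hv'; apply (Z s (Wp s (or_introl eq_refl))).
      - rewrite <- (integral_point_head w_omega s p Fp), Ho'.
        apply integral_point_left, F.
      - rewrite <- (integral_point_head w_v s p Fp), Hv'.
        apply integral_point_left, F. }
    destruct Sq as [|t q Sq Fq]; [destruct (Fs []); auto|].
    destruct (Rtotal_order (pos s) (pos t)) as [L|[E|G]].
    + destruct (Fs (t :: q)); auto; constructor; auto.
      eapply Forall_impl; [|exact Fq]; simpl; intros; lra.
    + assert (Eo : w_omega s = w_omega t).
      { rewrite <- (integral_point_head w_omega s p Fp), Ho, E.
        apply integral_point_head, Fq. }
      assert (Ev : w_v s = w_v t).
      { rewrite <- (integral_point_head w_v s p Fp), Hv, E.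
        apply integral_point_head, Fq. }
      assert (Est : s = t) by (destruct s, t; simpl in *; congruence).
      subst t; f_equal; apply IH; auto.
      * intros u Hu; apply Wq; right; exact Hu.
      * intros u Hu; apply Wp; right; exact Hu.
      * intros g; specialize (Ho g); unfold integral in *; simpl in Ho; lra.
      * intros g; specialize (Hv g); unfold integral in *; simpl in Hv; lra.
    + exfalso.
      assert (F : List.Forall (fun u => pos t < pos u) (s :: p)).
      { constructor; auto.
        eapply Forall_impl; [|exact Fp]; simpl; intros; lra. }
      apply (Z t (Wq t (or_introl eq_refl))).
      * rewrite <- (integral_point_head w_omega t q Fq), <- Ho.
        apply integral_point_left, F.
      * rewrite <- (integral_point_head w_v t q Fq), <- Hv.
        apply integral_point_left, F.
Qed.

(* Main.v *)
Require Import Defs.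
From Stdlib Require Import Reals.
From Coquelicot Require Import Coquelicot.
From Stdlib Require Lra List Sorted.
From mathcomp Require all_boot all_order all_algebra.
From mathcomp Require complex ring lra zify Rstruct.
Open Scope R_scope.

(** Off the atoms a solution is [A e^(-x/2) + B e^(x/2)], and crossing an atom acts on [(A, B)] by a
    matrix that is polynomial in the spectral parameter.  So phi_+ is described by two real
    polynomials, [coef p], and the eigenvalues are the roots of the first one, [W], which is
    [prod (1 - X / lambda_i)] since [W] is 1 at 0 and its roots are real and simple ([full_spectrum]).

    Cut a configuration at [a] into a left part [l] and a right part [r].  Let [UR] be [e^(a/2)]
    times the value at [a] of phi_+ and [AR] its coefficient at [e^(-x/2)] there, and let [UL], [AL]
    be the same for the mirror image of [l]; then [W = AL UR + AR UL - UL UR].  The quotient [- A / (X U)] of each side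
    is a rational Herglotz function, and every such function with the right behaviour at 0 and at
    infinity comes from exactly one half-line of atoms ([coef_inj], [coef_surj]): expanding it
    in a continued fraction produces distances and weights one after the other ([admissible_peel]),
    and the Herglotz property persists because zeros and poles of such functions play symmetric
    roles ([herglotz_zeros]).

    The data determine [W].  Lagrange's identity for gamma_lambda^2 turns the numbers [c_i^2] into
    the values of [P = UL UR] at the eigenvalues, so [P] is determined by interpolation, and [c_i]
    and [UR] have the same sign at [lambda_i] ([data_criterion]).  Moreover
    [X P / W = alpha X + const + sum (lambda_i c_i)^2 / (lambda_i - X)], and [alpha] is the quotient
    of the leading coefficients of [P] and [W]; if it is nonzero there is no atom at [a] and it is
    positive ([good_factored]).  This function increases between its poles, hence has exactly
    one zero in each of the [N + 1] gaps defined by the [lambda_i]: the zero 0 and the [N] roots of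
    [P].

    A pair with the given data is now a choice of the roots of [P] that go to [UR], the others going
    to [UL]; every choice is realized ([factor_choice]), with the same [P] and [W].  A root between
    two eigenvalues is alone in its gap, so the signs of [c_i] at both ends tell whether it belongs to
    [UR]; a root beyond all eigenvalues does not influence any sign and is free ([sign_agree]).  If all
    eigenvalues have the same sign, one of the two unbounded gaps contains the zero 0 and there
    remains one free root, hence two pairs; otherwise both contain a free root, hence four. *)

(** * Rational Herglotz functions and half-lines of atoms *)

Module Herglotz.
Import all_boot all_order all_algebra complex ring lra zify.
Import Order.TTheory GRing.Theory Num.Theory.
Local Open Scope ring_scope.
Set Implicit Arguments.
Unset Strict Implicit.

Section RealClosed.
Variable F : rcfType.
Implicit Types (s t : seq F) (P Q U A : {poly F}).

Definition roots_prod s : {poly F} := \prod_(x <- s) ('X - x%:P).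

Lemma roots_prod_rem s x : x \in s ->
  roots_prod s = ('X - x%:P) * roots_prod (rem x s).
Proof.
by move=> xs; rewrite /roots_prod (perm_big _ (perm_to_rem xs)) big_cons.
Qed.

Lemma roots_prod_cons x s : roots_prod (x :: s) = ('X - x%:P) * roots_prod s.
Proof. exact: big_cons. Qed.

Lemma root_roots_prod s x : root (roots_prod s) x = (x \in s).
Proof. exact: root_prod_XsubC. Qed.

Lemma horner_roots_prod_neq0 s x : ((roots_prod s).[x] != 0) = (x \notin s).
Proof. by rewrite -root_roots_prod. Qed.

Lemma horner_rem_neq0 s x : uniq s -> (roots_prod (rem x s)).[x] != 0.
Proof.
by move=> us; rewrite horner_roots_prod_neq0 mem_rem_uniq // inE eqxx.
Qed.

Lemma horner_rem_eq0 s x y : uniq s -> y \in s -> y != x ->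
  (roots_prod (rem x s)).[y] = 0.
Proof.
move=> us ys yx; apply/eqP; rewrite -[_ == 0]/(root _ y) root_roots_prod.
by rewrite mem_rem_uniq // inE yx.
Qed.

Lemma roots_prod_monic s : roots_prod s \is monic.
Proof. exact: monic_prod_XsubC. Qed.

Lemma size_roots_prod s : size (roots_prod s) = (size s).+1.
Proof. exact: size_prod_XsubC. Qed.

Lemma roots_prod_neq0 s : roots_prod s != 0.
Proof. exact: monic_neq0 (roots_prod_monic s). Qed.

Lemma eq_poly_of_nodes P Q s : uniq s ->
  (size P <= size s)%N -> (size Q <= size s)%N ->
  {in s, forall x, P.[x] = Q.[x]} -> P = Q.
Proof.
move=> us sP sQ eqPQ; apply/eqP; rewrite -subr_eq0; apply/eqP.
apply: (roots_geq_poly_eq0 _ us).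
  by apply/allP=> x xs; rewrite /root !hornerE eqPQ // subrr.
by apply: leq_trans (size_polyD _ _) _; rewrite size_polyN geq_max sP.
Qed.

Lemma interpolation (g : F -> F) s : uniq s ->
  exists P, (size P <= size s)%N /\ {in s, forall x, P.[x] = g x}.
Proof.
elim: s => [|y s IH] /=; first by exists 0; rewrite size_poly0.
case/andP=> ys /IH[P [sP eP]].
pose c := (g y - P.[y]) / (roots_prod s).[y].
exists (P + c *: roots_prod s); split.
  apply: leq_trans (size_polyD _ _) _; rewrite geq_max (leqW sP) /=.
  by apply: leq_trans (size_scale_leq _ _) _; rewrite size_roots_prod.
move=> x; rewrite inE => /orP[/eqP->|xs]; rewrite !hornerE.
  by rewrite /c divfK ?horner_roots_prod_neq0 // addrCA subrr addr0.
have /rootP-> : root (roots_prod s) x by rewrite root_roots_prod.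
by rewrite mulr0 addr0 eP.
Qed.

Lemma deriv_double_root P x : root (('X - x%:P) ^+ 2 * P)^`() x.
Proof. rewrite /root expr2 !derivM derivXsubC !hornerE /=; apply/eqP; ring. Qed.

(** The fundamental theorem of algebra over [F[i]] splits [Q]; the hypotheses make the roots real
and pairwise distinct, so the factorization descends to [F]. *)
Lemma splits_of_simple_real_roots Q : Q != 0 ->
  (forall x, root Q x -> ~~ root Q^`() x) ->
  (forall z : F[i], root (map_poly (real_complex F) Q) z -> z^* = z) ->
  exists t, uniq t /\ Q = lead_coef Q *: roots_prod t.
Proof.
move=> Q0 simple real.
have [r Qr] := closed_field_poly_normal (map_poly (real_complex F) Q).
have lc0 : lead_coef (map_poly (real_complex F) Q) != 0.
  by rewrite lead_coef_eq0 map_poly_eq0.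
have er : r = map (real_complex F) (map (@complex.Re F) r).
  rewrite -map_comp -[LHS]map_id; apply/eq_in_map=> z zr /=.
  have /real: root (map_poly (real_complex F) Q) z.
    by rewrite Qr rootZ // root_prod_XsubC.
  by case: z {zr} => a b /= [] /eqP; rewrite eqNr => /eqP->.
have QE : Q = lead_coef Q *: roots_prod (map (@complex.Re F) r).
  apply: (map_poly_inj (real_complex F)); rewrite [LHS]Qr.
  rewrite linearZ /= lead_coef_map; congr (_ *: _).
  rewrite {1}er /roots_prod rmorph_prod /= big_map.
  by apply: eq_bigr => z _; rewrite rmorphB /= map_polyX map_polyC.
exists (map (@complex.Re F) r); split=> //; move: QE; set t := map _ _ => QE.
apply: contraTT isT => nu.
have [x [t' pt]] : exists x t', perm_eq t [:: x, x & t'].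
  elim: t nu {QE} => //= y t IH; rewrite negb_and negbK => /orP[yt|/IH].
    by exists y, (rem y t); rewrite perm_cons; apply: perm_to_rem.
  move=> [x [t' pt]]; exists x, (y :: t').
  rewrite -(perm_cons y) in pt; apply: (perm_trans pt).
  by apply/permP => a /=; lia.
have QE2 : Q = lead_coef Q *: (('X - x%:P) ^+ 2 * roots_prod t').
  by rewrite {1}QE; congr (_ *: _); rewrite /roots_prod (perm_big _ pt) /= !big_cons mulrA -expr2.
have := simple x; rewrite QE2 derivZ /root !hornerZ.
rewrite (eqP (deriv_double_root _ _)) !hornerE subrr /= !(mul0r, mulr0) eqxx.
by move/(_ isT).
Qed.

(** Numerator of the rational function
[h(z) = b z + c + sum over x in s of (r x) / (x - z)]: it is [h * roots_prod s].  With [r > 0] and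
[b >= 0] these [h] are the rational Herglotz functions. *)
Definition pf_num (b c : F) (r : F -> F) s : {poly F} :=
  (b *: 'X + c%:P) * roots_prod s - \sum_(x <- s) r x *: roots_prod (rem x s).

Lemma pf_num_at_pole b c r s x : uniq s -> x \in s ->
  (pf_num b c r s).[x] = - (r x * (roots_prod (rem x s)).[x]).
Proof.
move=> us xs; rewrite /pf_num !hornerE.
have /rootP-> : root (roots_prod s) x by rewrite root_roots_prod.
rewrite mulr0 add0r horner_sum (bigD1_seq x) //= hornerZ big1 ?addr0 //.
by move=> y yx; rewrite hornerZ horner_rem_eq0 ?mulr0 // eq_sym.
Qed.

End RealClosed.

Section Eval.
Variables (F : rcfType) (K : numFieldType) (f : {rmorphism F -> K}).
Implicit Types (s : seq F).

Lemma map_rem_horner s x z : x \in s -> z != f x ->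
  (map_poly f (roots_prod (rem x s))).[z] =
  (map_poly f (roots_prod s)).[z] / (z - f x).
Proof.
move=> xs zx; rewrite (roots_prod_rem xs) rmorphM /= rmorphB /= map_polyX.
by rewrite map_polyC !hornerE mulrC mulKf // subr_eq0.
Qed.

Lemma map_roots_prod_neq0 s z : z \notin map f s ->
  (map_poly f (roots_prod s)).[z] != 0.
Proof.
have -> : map_poly f (roots_prod s) = \prod_(y <- map f s) ('X - y%:P).
  rewrite /roots_prod rmorph_prod /= big_map; apply: eq_bigr => y _.
  by rewrite rmorphB /= map_polyX map_polyC.
by rewrite -[_ == 0]/(root _ z) root_prod_XsubC.
Qed.

Lemma pf_num_horner b c r s z : z \notin map f s ->
  (map_poly f (pf_num b c r s)).[z] =
  (map_poly f (roots_prod s)).[z] *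
    (f b * z + f c + \sum_(x <- s) f (r x) / (f x - z)).
Proof.
move=> zs; rewrite /pf_num rmorphB rmorphM rmorphD /= linearZ /= map_polyX.
rewrite map_polyC rmorph_sum /= !hornerE mulrDr mulrC; congr (_ + _).
rewrite horner_sum mulr_sumr -sumrN; apply: eq_big_seq => x xs.
have zx : z != f x by apply: contraNneq zs => ->; rewrite map_f.
rewrite linearZ /= hornerZ map_rem_horner // -(opprB (f x)) invrN.
ring.
Qed.

(** The divided difference of [h].  At [y] the conjugate of [z] it says that [h] preserves the upper
half plane, at two real points without pole between them that [h] increases. *)
Lemma pf_diff (b c : F) r s (y z : K) : y \notin map f s -> z \notin map f s ->
  f b * z + f c + \sum_(x <- s) f (r x) / (f x - z)
  - (f b * y + f c + \sum_(x <- s) f (r x) / (f x - y))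
  = (z - y) * (f b + \sum_(x <- s) f (r x) / ((f x - z) * (f x - y))).
Proof.
move=> ys zs.
rewrite (mulrDr (z - y)) mulr_sumr.
suff E : \sum_(x <- s) f (r x) / (f x - z) - \sum_(x <- s) f (r x) / (f x - y)
   = \sum_(x <- s) (z - y) * (f (r x) / ((f x - z) * (f x - y))).
  rewrite -E; ring.
rewrite -sumrB; apply: eq_big_seq => x xs.
have zx : f x - z != 0 by rewrite subr_eq0; apply: contraNneq zs => <-; rewrite map_f.
have yx : f x - y != 0 by rewrite subr_eq0; apply: contraNneq ys => <-; rewrite map_f.
field; by rewrite zx yx.
Qed.

End Eval.

Section HerglotzZeros.
Variable F : rcfType.
Implicit Types (s t : seq F) (P Q U A : {poly F}).

Lemma root_map_conj Q (z : F[i]) :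
  root (map_poly (real_complex F) Q) z -> root (map_poly (real_complex F) Q) z^*.
Proof.
rewrite -(complex_root_conj (map_poly (real_complex F) Q) z).
rewrite -map_poly_comp (_ : map_poly _ Q = map_poly (real_complex F) Q) //.
by apply: eq_map_poly => x /=; rewrite oppr0.
Qed.

Lemma pf_num_neq0 b c (r : F -> F) s : uniq s -> {in s, forall x, 0 < r x} ->
  0 < b \/ s != [::] -> pf_num b c r s != 0.
Proof.
move=> us r0; case: s us r0 => [|x s] us r0 H.
  rewrite /pf_num big_nil subr0 /roots_prod big_nil mulr1.
  case: H => // b0; apply/eqP => /(congr1 (fun P : {poly F} => P`_1)).
  by rewrite !coefE /= mulr1 addr0 => E; rewrite E ltxx in b0.
apply/eqP => /(congr1 (fun P : {poly F} => P.[x])) /eqP.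
rewrite pf_num_at_pole ?mem_head // horner0 oppr_eq0 mulf_eq0.
rewrite (negPf (horner_rem_neq0 _ us)) orbF => /eqP r00.
by have := r0 x (mem_head _ _); rewrite r00 ltxx.
Qed.

Lemma pf_num_root_notin b c (r : F -> F) s y : uniq s -> {in s, forall x, 0 < r x} ->
  root (pf_num b c r s) y -> y \notin s.
Proof.
move=> us r0 /rootP; apply: contra_eqN => ys; rewrite pf_num_at_pole //.
by rewrite oppr_eq0 mulf_neq0 ?horner_rem_neq0 // lt0r_neq0 // r0.
Qed.

Lemma pf_slope_gt0 (K : numFieldType) (f : {rmorphism F -> K}) b (r : F -> F) s
    (g : F -> K) :
  (forall x, 0 <= x -> 0 <= f x) ->
  {in s, forall x, 0 < r x} -> 0 <= b -> 0 < b \/ s != [::] ->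
  {in s, forall x, 0 < g x} ->
  0 < f b + \sum_(x <- s) f (r x) / g x.
Proof.
move=> f0 r0 b0 H g0.
have fp x : 0 < x -> 0 < f x.
  by move=> x0; rewrite lt_def fmorph_eq0 lt0r_neq0 // f0 // ltW.
have S0 s' : {subset s' <= s} -> 0 <= \sum_(x <- s') f (r x) / g x.
  move=> ss; rewrite big_seq sumr_ge0 // => x /ss xs.
  by rewrite divr_ge0 ?f0 // ltW // (r0, g0).
have [b1|/negbTE b1] := boolP (0 < b).
  by rewrite ltr_pwDl ?fp ?S0.
case: H => [|]; first by rewrite b1.
case: s r0 g0 S0 => // x s r0 g0 S0 _.
rewrite big_cons ltr_wpDl ?f0 // ltr_pwDl ?divr_gt0 ?fp ?r0 ?g0 ?mem_head //.
by apply: S0 => y ys; rewrite inE ys orbT.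
Qed.

(** The class of Herglotz functions is stable under [h -> -1/h].  At a non-real zero [z] of [h] the
conjugate of [z] would be a zero too, but the divided difference of [h] at these two points is a
sum of positive terms; at a real zero [h' > 0] for the same reason, so zeros are real and
simple.  The last clause is [h' > 0] multiplied by the square of the denominator. *)
Lemma herglotz_zeros (b c : F) (r : F -> F) s : uniq s ->
  {in s, forall x, 0 < r x} -> 0 <= b -> 0 < b \/ s != [::] ->
  exists t, [/\ uniq t, pf_num b c r s = lead_coef (pf_num b c r s) *: roots_prod t
    & {in t, forall y, 0 < (roots_prod s).[y] * (pf_num b c r s)^`().[y]}].
Proof.
move=> us r0 b0 H; set Q := pf_num b c r s.
have Q0 : Q != 0 by exact: pf_num_neq0.
have slope y : root Q y -> 0 < (roots_prod s).[y] * Q^`().[y].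
  move=> Qy; have ys := pf_num_root_notin us r0 Qy.
  have My : (roots_prod s).[y] != 0 by rewrite horner_roots_prod_neq0.
  have yx x : x \in s -> y - x != 0.
    by move=> xs; rewrite subr_eq0; apply: contraNneq ys => ->.
  have rem_y x : x \in s ->
      (roots_prod (rem x s)).[y] = (roots_prod s).[y] / (y - x).
    by move=> xs; rewrite (roots_prod_rem xs) !hornerE mulrC mulKf ?yx.
  have drem x : x \in s -> (roots_prod (rem x s))^`().[y] =
      ((roots_prod s)^`().[y] - (roots_prod s).[y] / (y - x)) / (y - x).
    move=> xs; rewrite {1 2}(roots_prod_rem xs) derivM derivXsubC !hornerE.
    field; exact: yx.
  have h0 : b * y + c - \sum_(x <- s) r x / (y - x) = 0.
    move/rootP: Qy; rewrite /Q /pf_num !hornerE horner_sum.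
    rewrite (eq_big_seq (fun x => (roots_prod s).[y] * (r x / (y - x)))).
      by rewrite -mulr_sumr mulrC -mulrBr => /eqP; rewrite mulf_eq0 (negPf My) => /eqP.
    by move=> x xs; rewrite hornerZ rem_y //; ring.
  have -> : Q^`().[y] = (roots_prod s).[y] *
      (b + \sum_(x <- s) r x / ((y - x) * (y - x))).
    rewrite /Q /pf_num derivB derivM derivD derivZ derivX derivC !hornerE /=.
    rewrite raddf_sum /= horner_sum.
    rewrite (eq_big_seq (fun x => (roots_prod s)^`().[y] * (r x / (y - x)) -
       (roots_prod s).[y] * (r x / ((y - x) * (y - x))))); last first.
      move=> x xs; rewrite derivZ hornerZ drem //; field; exact: yx.
    rewrite sumrB -!mulr_sumr.
    have -> : b * y + c = \sum_(x <- s) r x / (y - x) by apply/eqP; rewrite -subr_eq0 h0.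
    ring.
  rewrite mulrA -expr2 mulr_gt0 //; first by rewrite exprn_even_gt0.
  apply: (@pf_slope_gt0 F idfun) => // x xs; rewrite -expr2.
  by rewrite exprn_even_gt0 ?yx.
have [|z Qz|t [ut Qt]] := splits_of_simple_real_roots Q0.
- move=> x /slope; apply: contraTN => /rootP->.
  by rewrite mulr0 ltxx.
- have real_in : z \in map (real_complex F) s -> z^* = z.
    by case/mapP => x _ ->; apply/eqP; rewrite eq_complex /= oppr0 !eqxx.
  have [/real_in//|zs] := boolP (z \in map (real_complex F) s).
  have czs : z^* \notin map (real_complex F) s.
    apply: contra zs => /mapP[x xs E]; apply/mapP; exists x => //.
    by rewrite -[z]conjcK -[conjc z]/(z^*) E; apply/eqP; rewrite eq_complex /= oppr0 !eqxx.
  have /rootP := root_map_conj Qz; have /rootP := Qz.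
  rewrite /Q !pf_num_horner // => /eqP; rewrite mulf_eq0.
  rewrite (negPf (map_roots_prod_neq0 zs)) => /eqP hz /eqP; rewrite mulf_eq0.
  rewrite (negPf (map_roots_prod_neq0 czs)) => /eqP hcz.
  have := pf_diff b c r czs zs; rewrite hz hcz subr0 => /esym/eqP.
  rewrite mulf_eq0 subr_eq0 => /orP[/eqP//|/eqP E].
  suff: 0 < real_complex F b + \sum_(x <- s) real_complex F (r x) /
     ((real_complex F x - z) * (real_complex F x - z^*)) by rewrite E ltxx.
  apply: pf_slope_gt0 => //.
    by move=> x x0; rewrite lecR.
  move=> x xs; have -> : real_complex F x - z^* = (real_complex F x - z)^*.
    by rewrite rmorphB /=; congr (_ - _); apply/eqP; rewrite eq_complex /= oppr0 !eqxx.
  rewrite mul_conjC_gt0 subr_eq0; apply: contraNneq zs => <-.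
  by rewrite map_f.
exists t; split=> // y yt; apply: slope.
by rewrite Qt rootZ ?lead_coef_eq0 // root_roots_prod.
Qed.


(** The pairs (value, coefficient) carried by a half-line of atoms: [- A / (X U)] is a Herglotz
function with weight 1 at the pole 0, its other poles are the roots of [U], and the last clause
is the positivity of their weights.  The inequality of sizes says that the function vanishes at
infinity, which is the case as long as the base point carries no atom. *)
Definition admissible U A :=
  [/\ U.[0] = 1, A.[0] = 1, (size A <= size U)%N &
    exists s, [/\ uniq s, U = lead_coef U *: roots_prod s &
                  {in s, forall x, 0 < x * A.[x] * U^`().[x]}]].

Lemma deriv_roots_prod s x : x \in s ->
  (roots_prod s)^`().[x] = (roots_prod (rem x s)).[x].
Proof.
by move=> xs; rewrite (roots_prod_rem xs) derivM derivXsubC !hornerE subrr mul0r addr0.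
Qed.

Lemma size_rem_roots s x : x \in s -> size (roots_prod (rem x s)) = size s.
Proof.
by move=> xs; rewrite size_roots_prod size_rem // prednK //; case: s xs.
Qed.

Lemma size_rem_sum (f : F -> {poly F}) s n :
  {in s, forall x, (size (f x) <= n)%N} -> (size (\sum_(x <- s) f x)%R <= n)%N.
Proof.
move=> H; rewrite big_seq; elim/big_rec: _; first by rewrite size_poly0.
move=> x P xs sP; apply: leq_trans (size_polyD _ _) _.
by rewrite geq_max sP H.
Qed.

Lemma admissible_neq0 U A : admissible U A -> U != 0.
Proof. by case=> U0 _ _ _; apply: contra_eq_neq U0 => ->; rewrite horner0 eq_sym oner_eq0. Qed.

(** Both sides have at most [size U] coefficients and agree at 0 and at the roots of [U]. *)
Lemma admissible_pf U A : admissible U A -> exists s (r : F -> F),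
  [/\ uniq s, 0 \notin s, U = lead_coef U *: roots_prod s, {in s, forall x, 0 < r x} &
   A = U + lead_coef U *: \sum_(x <- s) r x *: ('X * roots_prod (rem x s))].
Proof.
move=> aUA; have UN := admissible_neq0 aUA.
case: aUA => U0 A0 sAU [s [us US pos]].
set k := lead_coef U in US *; have k0 : k != 0 by rewrite lead_coef_eq0.
have s0 : 0 \notin s.
  apply/negP => s0; move: U0; rewrite US hornerZ.
  have /rootP-> : root (roots_prod s) 0 by rewrite root_roots_prod.
  by rewrite mulr0 => /eqP; rewrite eq_sym oner_eq0.
have dU x : x \in s -> U^`().[x] = k * (roots_prod (rem x s)).[x].
  by move=> xs; rewrite {1}US derivZ hornerZ deriv_roots_prod.
have nz x : x \in s -> x != 0 by apply: contraTneq => ->.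
pose r x := A.[x] / (x * U^`().[x]).
exists s, r; split=> //.
  move=> x xs; have := pos x xs; rewrite /r => H.
  have d0 : x * U^`().[x] != 0.
    apply: mulf_neq0; first exact: nz.
    by rewrite dU //; apply: mulf_neq0; rewrite ?horner_rem_neq0.
  have -> : A.[x] / (x * U^`().[x]) = (x * A.[x] * U^`().[x]) / (x * U^`().[x]) ^+ 2.
    field; by move: d0; rewrite mulf_eq0 negb_or andbC.
  by rewrite divr_gt0 // exprn_even_gt0.
have sU : size U = (size s).+1 by rewrite US size_scale // size_roots_prod.
apply: (@eq_poly_of_nodes _ _ _ (0 :: s)).
- by rewrite /= s0.
- by rewrite /= -sU.
- apply: leq_trans (size_polyD _ _) _; rewrite sU geq_max /= leqnn /=.
  apply: leq_trans (size_scale_leq _ _) _; apply: size_rem_sum => x xs.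
  apply: leq_trans (size_scale_leq _ _) _.
  by rewrite mulrC size_mulX ?roots_prod_neq0 // size_rem_roots.
move=> x; rewrite inE => /orP[/eqP->|xs].
  rewrite A0 hornerD U0 hornerZ horner_sum big1 ?mulr0 ?addr0 // => y _.
  by rewrite !hornerE /= ?(mul0r, mulr0).
rewrite hornerD {1}US !hornerZ.
have /rootP-> : root (roots_prod s) x by rewrite root_roots_prod.
rewrite mulr0 add0r horner_sum (bigD1_seq x) //= big1 ?addr0; last first.
  by move=> y yx; rewrite hornerZ hornerM horner_rem_eq0 ?mulr0 ?mulr0 // eq_sym.
rewrite !hornerE /r dU // /=; field.
by rewrite (nz x xs) k0 horner_rem_neq0.
Qed.

(** Crossing an atom subtracts [w + v z] from [A / (z U)], and adding [sigma U] accounts for a move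
along the line; the Herglotz property survives both, so the new polynomial has simple real roots.
The case [sigma = 0] is the characteristic function of a complete configuration. *)
Lemma admissible_cross U A (sigma w v : F) : admissible U A -> 0 <= sigma -> 0 <= v ->
  let Q := sigma *: U + A - (w *: 'X + v *: 'X^2) * U in
  exists t, [/\ uniq t, Q = lead_coef Q *: roots_prod t &
     {in t, forall y, y * U.[y] * Q^`().[y] < 0}].
Proof.
move=> aUA s0 v0 Q.
have kn0 : lead_coef U != 0 by rewrite lead_coef_eq0 (admissible_neq0 aUA).
have [s [r [us s0n US r0 AE]]] := admissible_pf aUA.
set k := lead_coef U in kn0 US AE.
pose r' x := if x == 0 then 1 + sigma else r x.
have QE : Q = - k *: pf_num v w r' (0 :: s).
  rewrite /Q AE US /pf_num big_cons /= eqxx roots_prod_cons.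
  rewrite /r' eqxx subr0.
  rewrite [\sum_(x <- s) (if _ then _ else _) *: _](eq_big_seq (fun x => r x *: ('X * roots_prod (rem x s)))); last first.
    move=> x xs; have x0 : x != 0 by apply: contraNneq s0n => <-.
    rewrite /= (negPf x0) [0 == x]eq_sym (negPf x0) roots_prod_cons subr0.
    by [].
  set S := \sum_(x <- s) _.
  rewrite -!mul_polyC !rmorphN rmorphD rmorph1 /=; ring.
have H : {in 0 :: s, forall x, 0 < r' x}.
  move=> x; rewrite inE /r'; case: eqP => _ /=; first by rewrite ltr_pwDl.
  exact: r0.
have [|t [ut Qt Pt]] := @herglotz_zeros v w r' (0 :: s) _ H v0 (or_intror isT).
  by rewrite /= s0n.
exists t; split=> //.
  by rewrite {1}QE Qt scalerA QE lead_coefZ.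
move=> y yt; rewrite QE derivZ hornerZ US hornerZ.
have := Pt y yt; rewrite roots_prod_cons subr0 hornerM hornerX.
set a := _.[y]; set b := _.[y] => H1.
rewrite (_ : _ * _ = - (k ^+ 2 * (y * a * b))); last by ring.
have k2 : 0 < k ^+ 2 by rewrite exprn_even_gt0.
by rewrite oppr_lt0; apply: mulr_gt0 k2 _; rewrite mulrAC.
Qed.

Lemma size_cross U A (w v : F) : U != 0 -> (size A <= size U)%N ->
  w != 0 \/ v != 0 ->
  (size U < size (A - (w *: 'X + v *: 'X^2) * U)%R)%N.
Proof.
move=> U0 sA wv; pose q := w *: 'X + v *: 'X^2 : {poly F}.
have sq : (1 < size q)%N.
  case: (eqVneq v 0) => [v0|v0].
    case: wv => [w0|]; last by rewrite v0 eqxx.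
    by rewrite /q v0 scale0r addr0 size_scale // size_polyX.
  rewrite /q addrC size_polyDl (size_scale _ v0) size_polyXn //.
  by apply: leq_ltn_trans (size_scale_leq _ _) _; rewrite size_polyX.
have q0 : q != 0 by rewrite -size_poly_gt0 ltnW.
have sqU : (size U < size (q * U)%R)%N.
  by rewrite size_mul //; case: (size q) sq => [|[|m]] //= _; rewrite !addSn /= ltnS leq_addl.
by rewrite -/q addrC size_polyDl size_polyN //; apply: leq_ltn_trans sqU.
Qed.

(** One step away from an atom: the coefficient jumps by [(w X + v X^2) U], after which the value is a
convex combination of the old value and the new coefficient, with weight [rho = exp (- distance)]. *)
Lemma admissible_step U A (rho w v : F) : admissible U A ->
  0 < rho < 1 -> 0 <= v -> w != 0 \/ v != 0 ->
  let A1 := A - (w *: 'X + v *: 'X^2) * U in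
  admissible (rho *: U + (1 - rho) *: A1) A1.
Proof.
move=> aUA /andP[rho0 rho1] v0 wv A1; have U0n := admissible_neq0 aUA.
have rho1' : 0 < 1 - rho by rewrite subr_gt0.
have [U0 A0 sAU _] := aUA.
have A10 : A1.[0] = 1 by rewrite /A1 !hornerE A0 /= ?expr0n /= ?(mulr0,addr0,mul0r,subr0).
pose sigma := rho / (1 - rho).
have [|t [ut Qt Pt]] := @admissible_cross U A sigma w v aUA _ v0.
  by rewrite divr_ge0 // ltW.
set Q := _ - _ in Qt Pt.
have U1E : rho *: U + (1 - rho) *: A1 = (1 - rho) *: Q.
  have -> : Q = sigma *: U + A1 by rewrite /Q /A1 addrA.
  by rewrite [in RHS]scalerDr scalerA /sigma mulrC divfK ?lt0r_neq0.
split=> //.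
- by rewrite hornerD !hornerZ U0 A10; ring.
- have sA1 : (size U < size A1)%N by exact: size_cross.
  have n0 : 1 - rho != 0 by rewrite lt0r_neq0.
  have sl : (size (rho *: U)%R < size ((1 - rho) *: A1)%R)%N.
    by rewrite (size_scale A1 n0) (size_scale U (lt0r_neq0 rho0)).
  by rewrite (addrC (rho *: U)) (size_polyDl sl) (size_scale A1 n0).
exists t; split=> //; first by rewrite U1E lead_coefZ -scalerA -Qt.
move=> y yt; rewrite U1E derivZ hornerZ.
have Qy : A1.[y] = - sigma * U.[y].
  have /rootP : root Q y by rewrite Qt /root hornerZ (eqP (_ : root _ y)) ?root_roots_prod // mulr0.
  by rewrite /Q -addrA -/A1 hornerD hornerZ => /eqP; rewrite addrC addr_eq0 mulNr => /eqP.
rewrite Qy (_ : _ * _ = sigma * (1 - rho) * - (y * U.[y] * Q^`().[y])); last by ring.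
by rewrite mulr_gt0 ?oppr_gt0 ?Pt // mulr_gt0 // divr_gt0.
Qed.

Lemma coef_rem_roots s x n : x \in s -> size s = n.+1 ->
  (roots_prod (rem x s))`_n = 1.
Proof.
move=> xs sn; have /monicP := roots_prod_monic (rem x s).
by rewrite /lead_coef size_rem_roots // sn.
Qed.

(** One step of the continued fraction algorithm, inverse to [admissible_step].  The ratio [T] of the
leading coefficients of [A] and [U] is larger than 1 and gives [rho = 1 - 1/T], the only choice for
which [U1] drops in degree; then [w] and [v] are chosen to bring [A] down to the degree of [U1].
The roots of [U1] are the nonzero zeros of a Herglotz function with the roots of [U] as poles. *)
Lemma admissible_peel U A : admissible U A -> (1 < size U)%N ->
  exists (rho w v : F) U1,
  [/\ [/\ 0 < rho < 1, 0 <= v & w != 0 \/ v != 0], (size U1 < size U)%N,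
      U = rho *: U1 + (1 - rho) *: A &
      admissible U1 (A + (w *: 'X + v *: 'X^2) * U1)].
Proof.
move=> aUA sU1; have U0n := admissible_neq0 aUA.
have kn0 : lead_coef U != 0 by rewrite lead_coef_eq0.
have [s [r [us s0n US r0 AE]]] := admissible_pf aUA.
have [U0 A0 sAU _] := aUA.
set k := lead_coef U in kn0 US AE.
have sU : size U = (size s).+1 by rewrite US size_scale // size_roots_prod.
have [n sn] : exists n, size s = n.+1.
  by exists (size s).-1; rewrite prednK //; move: sU1; rewrite sU.
have nz x : x \in s -> x != 0 by apply: contraTneq => ->.
pose S := \sum_(x <- s) r x.
have S0 : 0 < S.
  move: (@pf_slope_gt0 F idfun 0 r s (fun=> 1) (fun _ => id) r0 (lexx 0)).
  rewrite /= add0r => H; rewrite /S (eq_bigr (fun x => r x / 1)); last by move=> x; rewrite divr1.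
  by apply: H; [right; case: (s) sn | ].
pose T := 1 + S; have T1 : 1 < T by rewrite ltrDl.
have T0 : 0 < T by apply: lt_trans T1.
have Tn0 : T != 0 by rewrite lt0r_neq0.
pose rho := 1 - T^-1; have rho0 : 0 < rho by rewrite subr_gt0 invf_lt1.
have rhon0 : rho != 0 by rewrite lt0r_neq0.
have rho1 : rho < 1 by rewrite ltrBlDr ltrDl invr_gt0.
(* [X U1 = kap Q], with [Q] the numerator of a Herglotz function with weights [r x * x^2] *)
pose kap := k / (T * rho); have kap0 : kap != 0 by rewrite !(mulf_neq0, invr_neq0).
pose N := \sum_(x <- s) (r x * x) *: roots_prod (rem x s).
pose U1 := - kap *: N.
have UE : U = rho *: U1 + (1 - rho) *: A.
  have E : \sum_(x <- s) r x *: ('X * roots_prod (rem x s)) = S *: roots_prod s + N.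
    rewrite /S scaler_suml -big_split /=; apply: eq_big_seq => x xs.
    rewrite [in RHS](roots_prod_rem xs) -!mul_polyC rmorphM /=; ring.
  have -> : rho *: U1 + (1 - rho) *: A = ((1 - rho) * (k * T)) *: roots_prod s
      + ((1 - rho) * k - rho * kap) *: N.
    rewrite AE E US /U1 /T -!mul_polyC !(rmorphM, rmorphD, rmorphB, rmorphN, rmorph1) /=; ring.
  rewrite /kap {1 2}/rho subKr (mulrC k) mulKf // -US.
  rewrite (_ : _ - _ = 0) ?scale0r ?addr0 //; field; by rewrite Tn0 rhon0.
have U10 : U1.[0] = 1.
  move: (congr1 (fun P : {poly F} => P.[0]) UE).
  rewrite hornerD !hornerZ U0 A0 mulr1 => E; apply: (mulfI rhon0).
  by apply: (addIr (1 - rho)); rewrite -E; ring.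
have sU1n : (size U1 <= n.+1)%N.
  apply: leq_trans (size_scale_leq _ _) _; apply: size_rem_sum => x xs.
  by apply: leq_trans (size_scale_leq _ _) _; rewrite size_rem_roots // sn.
pose c1 := \sum_(x <- s) r x * x.
pose S2 := \sum_(x <- s) r x * (x * x).
have S20 : 0 < S2.
  move: (@pf_slope_gt0 F idfun 0 (fun x => r x * (x * x)) s (fun=> 1) (fun _ => id)).
  rewrite /= add0r => H; rewrite /S2 (eq_bigr (fun x => r x * (x * x) / 1)); last by move=> x; rewrite divr1.
  apply: H => //; last by right; case: (s) sn.
  by move=> x xs; rewrite mulr_gt0 ?r0 // -expr2 exprn_even_gt0 ?nz.
pose Q := pf_num 0 (- c1) (fun x => r x * (x * x)) s.
have QE : Q = - ('X * N).
  rewrite /Q /pf_num scale0r add0r /N mulr_sumr polyCN mulNr -opprD; congr (- _).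
  rewrite mul_polyC /c1 scaler_suml -big_split /=; apply: eq_big_seq => x xs.
  rewrite {1}(roots_prod_rem xs) -!mul_polyC !rmorphM /=; ring.
have XU1 : 'X * U1 = kap *: Q by rewrite QE /U1 -!mul_polyC rmorphN /=; ring.
have coefU1 : U1`_n = - kap * c1.
  rewrite /U1 coefZ; congr (_ * _); rewrite /N coef_sum; apply: eq_big_seq => x xs.
  by rewrite coefZ coef_rem_roots // mulr1.
clearbody U1.
have coefA : A`_n.+1 = k * T.
  have M1 : (roots_prod s)`_n.+1 = 1.
    by have /monicP := roots_prod_monic s; rewrite /lead_coef size_roots_prod sn.
  rewrite AE coefD {1}US !coefZ M1 coef_sum /T mulrDr; congr (_ + _ * _).
  by apply: eq_big_seq => x xs; rewrite coefZ coefXM coef_rem_roots // mulr1.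
have coefAhi j : (n.+1 < j)%N -> A`_j = 0.
  by move=> nj; apply: nth_default; apply: leq_trans sAU _; rewrite sU sn.
have coefUhi j : (n < j)%N -> U1`_j = 0.
  by move=> nj; apply: nth_default; apply: leq_trans sU1n _.
have sUU : (size U1 < size U)%N by rewrite sU sn.
suff [w [v [v0 wv sA1]]] : exists w v : F, [/\ 0 <= v, w != 0 \/ v != 0 &
   (size (A + (w *: 'X + v *: 'X^2) * U1)%R <= size U1)%N].
  exists rho, w, v, U1; split=> //; first by split=> //; rewrite rho0.
  split=> //; first by rewrite !hornerE A0 /= ?expr0n /= ?(mulr0, mul0r, addr0).
  have [||t' [ut' Qt' Pt']] := @herglotz_zeros 0 (- c1) (fun x => r x * (x * x)) s us _ (lexx 0).
  - by move=> x xs; rewrite mulr_gt0 ?r0 // -expr2 exprn_even_gt0 ?nz.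
  - by right; case: (s) sn.
  rewrite -/Q in Qt' Pt'; set l := lead_coef Q in Qt'.
  have l0 : l != 0.
    rewrite lead_coef_eq0; apply: contra_eq_neq U10 => Q0; move: XU1.
    by rewrite Q0 scaler0 => /eqP; rewrite mulf_eq0 polyX_eq0 /= => /eqP->;
       rewrite horner0 eq_sym oner_eq0.
  have t0 : 0 \in t'.
    rewrite -root_roots_prod -(rootZ _ _ l0) -Qt' QE /root !hornerE /=.
    by rewrite ?mul0r ?oppr0.
  have U1t : U1 = (kap * l) *: roots_prod (rem 0 t').
    apply: (@mulfI _ 'X); first by rewrite polyX_eq0.
    rewrite XU1 Qt' (roots_prod_rem t0) subr0 scalerA -!scalerAr.
    by [].
  exists (rem 0 t'); split; first exact: rem_uniq.
    by rewrite {1}U1t U1t lead_coefZ (monicP (roots_prod_monic _)) mulr1.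
  move=> y; rewrite mem_rem_uniq // inE => /andP[y0 yt'].
  have /rootP U1y : root U1 y.
    rewrite U1t rootZ; last exact: mulf_neq0.
    rewrite root_roots_prod mem_rem_uniq // inE.
    exact/andP.
  have A1y : (A + (w *: 'X + v *: 'X^2) * U1).[y] = T * (k * (roots_prod s).[y]).
    rewrite hornerD hornerM U1y mulr0 addr0 -hornerZ -US UE !hornerE U1y.
    by rewrite mulr0 add0r /rho subKr mulVKf.
  have dQ : y * U1^`().[y] = kap * Q^`().[y].
    have := congr1 (fun P : {poly F} => P^`().[y]) XU1.
    by rewrite derivM derivX derivZ !hornerE U1y add0r.
  rewrite A1y mulrAC dQ.
  rewrite [X in 0 < X](_ : _ = k ^+ 2 / rho * ((roots_prod s).[y] * Q^`().[y])).
    have k2 : 0 < k ^+ 2 by rewrite exprn_even_gt0.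
    by apply: mulr_gt0 (divr_gt0 k2 rho0) (Pt' y yt').
  by rewrite /kap; field; rewrite ?Tn0 ?rhon0.
(* [c1] is up to a factor the leading coefficient expected for [U1]: if it is nonzero one factor
   [w X] suffices, otherwise [U1] drops by two degrees and the sum [S2 > 0] makes [v] positive. *)
have [c10|c10] := eqVneq c1 0; last first.
  have u0 : U1`_n != 0 by rewrite coefU1 mulf_neq0 // oppr_eq0.
  have sU1' : size U1 = n.+1.
    by apply/eqP; rewrite eqn_leq sU1n ltnNge; apply: contra u0 => /leq_sizeP->.
  exists (- (k * T) / U1`_n), 0; split=> //.
    by left; rewrite mulf_neq0 ?invr_neq0 // oppr_eq0 mulf_neq0.
  rewrite sU1' scale0r addr0; apply/leq_sizeP => j nj.
  rewrite coefD -scalerAl coefZ coefXM; case: j nj => // j; rewrite ltnS /=.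
  rewrite leq_eqVlt => /orP[/eqP<-|nj]; last first.
    by rewrite coefAhi // (coefUhi j) // mulr0 addr0.
  by rewrite coefA divfK // addrN.
have Un0 : U1`_n = 0 by rewrite coefU1 c10 mulr0.
have coefXU : ('X * U1)`_n = - kap * S2.
  rewrite XU1 coefZ mulNr -mulrN; congr (_ * _); rewrite /Q /pf_num c10 oppr0 scale0r.
  rewrite addr0 mul0r sub0r coefN coef_sum; congr (- _); apply: eq_big_seq => x xs.
  by rewrite coefZ coef_rem_roots // mulr1.
case: n sn sU1n coefU1 coefA coefAhi coefUhi Un0 coefXU => [|n] sn sU1n coefU1 coefA coefAhi coefUhi Un0 coefXU.
  move: coefXU; rewrite coefXM /= => /esym/eqP.
  by rewrite mulf_eq0 oppr_eq0 (negPf kap0) (gt_eqF S20).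
rewrite coefXM /= in coefXU.
have u0 : U1`_n != 0 by rewrite coefXU mulf_neq0 ?oppr_eq0 // lt0r_neq0.
have sU1' : size U1 = n.+1.
  apply/eqP; rewrite eqn_leq; apply/andP; split.
    apply/leq_sizeP => j; rewrite leq_eqVlt => /orP[/eqP<-//|]; exact: coefUhi.
  by rewrite ltnNge; apply: contra u0 => /leq_sizeP->.
pose v := T * T * rho / S2.
have vE : v * U1`_n = - (k * T).
  by rewrite coefXU /v /kap; field; rewrite Tn0 rhon0 lt0r_neq0.
have v0 : 0 < v by rewrite divr_gt0 // !mulr_gt0.
pose w := - (A`_n.+1 + v * ('X^2 * U1)`_n.+1) / U1`_n.
exists w, v; split; first exact: ltW.
  by right; rewrite lt0r_neq0.
rewrite sU1'; apply/leq_sizeP => j nj.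
rewrite coefD mulrDl -!scalerAl coefD !coefZ coefXM.
case: j nj => // j; rewrite ltnS /= leq_eqVlt => /orP[/eqP<-|].
  by rewrite /w divfK //; ring.
case: j => // j; rewrite ltnS coefXnM /= subn2 /= leq_eqVlt => /orP[/eqP<-|nj].
  by rewrite coefA Un0 mulr0 add0r vE addrN.
have Uhi i : (n < i)%N -> U1`_i = 0 by move=> ni; apply: nth_default; rewrite sU1'.
by rewrite coefAhi // (Uhi j.+1) ?(Uhi j) ?mulr0 ?addr0 // ltnW.
Qed.

End HerglotzZeros.
End Herglotz.

(** * Interlacing of zeros and poles, and distribution of the zeros *)

Module Interlacing.
Import all_boot all_order all_algebra complex ring lra zify.
Import Order.TTheory GRing.Theory Num.Theory.
Import Herglotz.
Local Open Scope ring_scope.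
Set Implicit Arguments.
Unset Strict Implicit.

Section Gaps.
Variable F : rcfType.
Implicit Types (s t V L : seq F) (P Q U A W : {poly F}).

(** A Herglotz function increases between poles, so it cannot vanish twice in between. *)
Lemma pf_num_gap b c (r : F -> F) s y z : uniq s -> {in s, forall x, 0 < r x} ->
  0 < b -> root (pf_num b c r s) y -> root (pf_num b c r s) z -> y < z ->
  exists x, x \in s /\ y < x < z.
Proof.
move=> us r0 b0 Qy Qz yz.
have ys := pf_num_root_notin us r0 Qy; have zs := pf_num_root_notin us r0 Qz.
case: (altP (@hasP _ (fun x => y < x < z) s)) => [[x xs H]|/hasPn none]; first by exists x.
exfalso; have ys' : y \notin map idfun s by rewrite map_id.
have zs' : z \notin map idfun s by rewrite map_id.
have map_idfun (Q : {poly F}) : map_poly idfun Q = Q by exact: map_poly_id.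
have h0 x : x \notin map idfun s -> root (pf_num b c r s) x ->
    b * x + c + \sum_(u <- s) r u / (u - x) = 0.
  move=> xs /rootP; rewrite -[pf_num _ _ _ _]map_idfun (pf_num_horner _ _ _ xs).
  move=> /eqP; rewrite mulf_eq0 => /orP[|/eqP//].
  by rewrite (negPf (map_roots_prod_neq0 xs)).
have := pf_diff (f := idfun) b c r ys' zs'; rewrite /= !h0 // subrr => /esym/eqP.
rewrite mulf_eq0 subr_eq0 (gt_eqF yz) /= => /eqP E.
suff : 0 < b + \sum_(u <- s) r u / ((u - z) * (u - y)) by rewrite E ltxx.
apply: (@pf_slope_gt0 F F idfun) => //; [exact: ltW | by left |].
move=> u us'; have := none u us'; rewrite negb_and -!leNgt.
have uy : u != y by apply: contraNneq ys => <-.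
have uz : u != z by apply: contraNneq zs => <-.
rewrite !le_eqVlt (negPf uy) [z == u]eq_sym (negPf uz) /= => /orP[u1|u1].
  by rewrite nmulr_rgt0 subr_lt0 // (lt_trans u1).
by rewrite mulr_gt0 // subr_gt0 // (lt_trans yz).
Qed.

Lemma size_pf_num b c (r : F -> F) s : b != 0 -> size (pf_num b c r s) = (size s).+2.
Proof.
move=> b0; have sb : size (b *: 'X + c%:P) = 2.
  by rewrite size_polyDl size_scale ?size_polyX // size_polyC; case: (c != 0).
have b1 : b *: 'X + c%:P != 0 by rewrite -size_poly_gt0 sb.
have sm : size ((b *: 'X + c%:P) * roots_prod s) = (size s).+2.
  by rewrite size_mul ?roots_prod_neq0 // sb size_roots_prod.
rewrite /pf_num size_polyDl // size_polyN sm.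
apply: (@leq_ltn_trans (size s)) => //; apply: size_rem_sum => x xs.
by apply: leq_trans (size_scale_leq _ _) _; rewrite size_rem_roots.
Qed.

(** The number of poles to the left grows at each zero of a sorted list of interlaced zeros. *)
Lemma last_count (s : seq F) y t : path <%R y t ->
  {in y :: t &, forall u v, u < v -> exists x, x \in s /\ u < x < v} ->
  (count (< y)%R s + size t <= count (< last y t)%R s)%N.
Proof.
elim: t y => [|z t IH] y; first by rewrite addn0.
case/andP=> yz pt H; rewrite /= addnS -addSn.
apply: leq_trans (IH z pt _); last first.
  by move=> u v ut vt; apply: H; rewrite inE ?ut ?vt orbT.
rewrite leq_add2r; have [||x [xs /andP[yx xz]]] := H y z _ _ yz.
- by rewrite mem_head.
- by rewrite !inE eqxx orbT.
rewrite -(size_filter (< y)%R) -(size_filter (< z)%R).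
rewrite -[(size _).+1]/(size (x :: [seq i <- s | i < y])).
have -> : [seq i <- s | i < y] = [seq i <- [seq i <- s | i < z] | i < y].
  rewrite -filter_predI; apply: eq_filter => u /=.
  by case: (ltP u y) => //= uy; rewrite (lt_trans uy yz).
have xz' : x \in [seq i <- s | i < z] by rewrite mem_filter xz.
rewrite /= size_filter -[X in (_ < X)%N](count_predC (< y)%R).
rewrite -addn1 leq_add2l -has_count; apply/hasP; exists x => //=.
by rewrite -leNgt ltW.
Qed.

(** With [b > 0] there is one zero more than there are poles, while each of the gaps cut out by the
poles has room for at most one; hence the two unbounded gaps contain a zero as well. *)
Lemma extreme_roots b c (r : F -> F) s : uniq s -> {in s, forall x, 0 < r x} -> 0 < b ->
  (exists2 z, root (pf_num b c r s) z & {in s, forall x, x < z}) /\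
  (exists2 y, root (pf_num b c r s) y & {in s, forall x, y < x}).
Proof.
move=> us r0 b0; set Q := pf_num b c r s.
have [t [ut Qt _]] := herglotz_zeros c us r0 (ltW b0) (or_introl b0).
rewrite -/Q in Qt.
have Q0 : lead_coef Q != 0.
  by rewrite lead_coef_eq0 -size_poly_gt0 size_pf_num ?lt0r_neq0.
have st : size t = (size s).+1.
  have : size Q = (size s).+2 by rewrite size_pf_num ?lt0r_neq0.
  by rewrite Qt size_scale // size_roots_prod => -[].
have rQ y : root Q y = (y \in t) by rewrite Qt rootZ // root_roots_prod.
have : perm_eq (sort <=%R t) t by rewrite perm_sort.
have : sorted <%R (sort <=%R t) by rewrite sort_lt_sorted.
case: (sort <=%R t) => [|y t'] /= pt pm; first by move: (perm_size pm); rewrite st.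
have mt u : (u \in y :: t') = (u \in t) by exact: perm_mem pm u.
have st' : size t' = size s by move: (perm_size pm); rewrite st => -[].
have := @last_count s y t' pt; rewrite st'.
have H : {in y :: t' &, forall u v, u < v -> exists x, x \in s /\ u < x < v}.
  move=> u v; rewrite !mt -!rQ => Qu Qv uv; exact: (pf_num_gap us r0 b0 Qu Qv uv).
move=> /(_ H) le1; have le2 := count_size (< last y t')%R s.
have c1 : count (< last y t')%R s = size s.
  by apply/eqP; rewrite eqn_leq le2 (leq_trans _ le1) ?leq_addl.
have c2 : count (< y)%R s = 0%N.
  by apply/eqP; rewrite -leqn0 -(leq_add2r (size s)) (leq_trans le1).
split.
  exists (last y t'); first by rewrite rQ -mt mem_last.
  by move=> x xs; move/eqP: c1; rewrite -all_count => /allP/(_ x xs).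
have Qy : root Q y by rewrite rQ -mt mem_head.
exists y => // x xs; rewrite lt_neqAle; apply/andP; split.
  by apply: contraNneq (pf_num_root_notin us r0 Qy) => ->.
rewrite leNgt; apply/negP => xy; move/eqP: c2; rewrite -leqn0 leqNgt -has_count.
by move/negP; apply; apply/hasP; exists x.
Qed.

Definition unit_prod s : {poly F} := \prod_(x <- s) (1 - x^-1 *: 'X).

Lemma unit_prod_cons x s : unit_prod (x :: s) = (1 - x^-1 *: 'X) * unit_prod s.
Proof. exact: big_cons. Qed.

Lemma unit_prod0 s : (unit_prod s).[0] = 1.
Proof. by rewrite horner_prod big1 // => x _; rewrite !hornerE /= ?mulr0 ?subr0. Qed.

Lemma unit_prodE s : 0 \notin s -> exists2 k, k != 0 & unit_prod s = k *: roots_prod s.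
Proof.
elim: s => [|x s IH]; first by exists 1; rewrite ?oner_eq0 // /unit_prod /roots_prod !big_nil scale1r.
rewrite inE negb_or eq_sym => /andP[x0 /IH[k k0 E]].
exists (- x^-1 * k); first by rewrite mulf_neq0 // oppr_eq0 invr_eq0.
rewrite roots_prod_cons /unit_prod big_cons -/(unit_prod s) E -!mul_polyC.
rewrite (_ : 1 - _ = (- x^-1)%:P * ('X - x%:P)); first by rewrite rmorphM /=; ring.
by rewrite mulrBr -polyCM mulNr mulVf // !polyCN mulNr opprK addrC.
Qed.

Lemma eq_unit_prod Q s k : Q = k *: roots_prod s -> Q.[0] = 1 -> Q = unit_prod s.
Proof.
move=> -> H; have s0 : 0 \notin s.
  apply: contra_eqN H => s0; rewrite hornerZ.
  have /rootP-> : root (roots_prod s) 0 by rewrite root_roots_prod.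
  by rewrite mulr0 eq_sym oner_eq0.
have [k' k'0 E] := unit_prodE s0; have := unit_prod0 s; rewrite E -H !hornerZ.
by move/mulIf => -> //; rewrite horner_roots_prod_neq0.
Qed.

Lemma size_unit_prod s : 0 \notin s -> size (unit_prod s) = (size s).+1.
Proof. by move=> /unit_prodE[k k0 ->]; rewrite size_scale // size_roots_prod. Qed.

Lemma root_unit_prod s x : 0 \notin s -> root (unit_prod s) x = (x \in s).
Proof. by move=> /unit_prodE[k k0 ->]; rewrite rootZ // root_roots_prod. Qed.

Lemma unit_prod_horner s x : (unit_prod s).[x] = \prod_(y <- s) (1 - x / y).
Proof. by rewrite horner_prod; apply: eq_bigr => y _; rewrite !hornerE mulrC. Qed.

(** Partial fractions of [X P / W].  [P] is the interpolation polynomial with the given values at the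
roots of [W] and value 1 at 0; the linear coefficient [al] is what this value at 0 leaves over, and
it is also the quotient of the leading coefficients. *)
Lemma pf_of_residues L W P (r : F -> F) : uniq L -> W = lead_coef W *: roots_prod L ->
  W.[0] = 1 -> P.[0] = 1 -> (size P <= size W)%N ->
  {in L, forall x, r x * W^`().[x] = - (x * P.[x])} ->
  let al := 1 - \sum_(x <- L) r x / (x * x) in
  'X * P = lead_coef W *: pf_num al (- \sum_(x <- L) r x / x) r L /\
  P`_(size L) = al * lead_coef W.
Proof.
move=> uL WE W0 P0 sPW res al; set k := lead_coef W in WE *.
have k0 : k != 0.
  by apply: contra_eq_neq W0 => k0; rewrite WE k0 scale0r horner0 eq_sym oner_eq0.
have L0 : 0 \notin L.
  apply: contra_eqN W0 => L0; rewrite WE hornerZ.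
  have /rootP-> : root (roots_prod L) 0 by rewrite root_roots_prod.
  by rewrite mulr0 eq_sym oner_eq0.
have nz x : x \in L -> x != 0 by apply: contraTneq => ->.
have sW : size W = (size L).+1 by rewrite WE size_scale // size_roots_prod.
have sN : (size (\sum_(x <- L) (r x / x) *: roots_prod (rem x L))%R <= size L)%N.
  apply: size_rem_sum => x xs; apply: leq_trans (size_scale_leq _ _) _.
  by rewrite size_rem_roots.
have PE : P = al *: W - k *: \sum_(x <- L) (r x / x) *: roots_prod (rem x L).
  apply: (@eq_poly_of_nodes _ _ _ (0 :: L)).
  - by rewrite /= L0.
  - by rewrite /= -sW.
  - apply: leq_trans (size_polyD _ _) _; rewrite geq_max; apply/andP; split.
      by apply: leq_trans (size_scale_leq _ _) _; rewrite sW.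
    rewrite size_polyN; apply: leq_trans (size_scale_leq _ _) _.
    exact: leq_trans sN _.
  move=> x; rewrite inE => /orP[/eqP->|xL].
    rewrite P0 hornerD hornerN !hornerZ W0 mulr1 horner_sum mulr_sumr.
    rewrite (eq_big_seq (fun x => - (r x / (x * x)))).
      by rewrite sumrN opprK /al subrK.
    move=> y yL; rewrite hornerZ; move: W0; rewrite WE hornerZ (roots_prod_rem yL).
    rewrite hornerM hornerXsubC sub0r => E.
    rewrite (_ : k * _ = (r y / (y * - y)) * (k * (- y * (roots_prod (rem y L)).[0]))).
      by rewrite E mulrN invrN mulrN mulr1.
    by field; rewrite nz.
  rewrite hornerD hornerN hornerZ; have /rootP-> : root W x.
    by rewrite WE rootZ // root_roots_prod.
  rewrite mulr0 add0r hornerZ horner_sum (bigD1_seq x) //= big1 ?addr0; last first.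
    by move=> y yx; rewrite hornerZ horner_rem_eq0 ?mulr0 // eq_sym.
  rewrite hornerZ; have := res x xL; rewrite WE derivZ hornerZ deriv_roots_prod // => E.
  apply: (mulfI (nz x xL)); apply: oppr_inj; rewrite -E.
  by field; rewrite nz.
split.
  rewrite PE /pf_num mulrBr; set S := \sum_(x <- L) r x / x.
  have E : 'X * \sum_(x <- L) (r x / x) *: roots_prod (rem x L) =
      S *: roots_prod L + \sum_(x <- L) r x *: roots_prod (rem x L).
    rewrite mulr_sumr /S scaler_suml -big_split /=; apply: eq_big_seq => x xL.
    rewrite [in RHS](roots_prod_rem xL) -!mul_polyC.
    rewrite {3}(_ : r x = r x / x * x); last by rewrite divfK ?nz.
    rewrite [(r x / x * x)%:P]rmorphM /=; ring.
  rewrite -!scalerAr E WE -!mul_polyC !rmorphN /=; ring.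
rewrite PE coefB !coefZ [X in _ - _ * X]nth_default // mulr0 subr0; congr (_ * _).
by rewrite /k /lead_coef sW.
Qed.

Definition outer L (y : F) := all (< y)%R L || all (> y)%R L.

(** Common factors of the two products occur squared. *)
Lemma unit_prod_filter_sign V (T T' : pred F) x : 0 \notin V -> x \notin V ->
  (0 < (unit_prod (filter T V)).[x] * (unit_prod (filter T' V)).[x]) =
  (0 < (unit_prod [seq y <- V | T y (+) T' y]).[x]).
Proof.
move=> V0 xV; have -> : (unit_prod (filter T V)).[x] * (unit_prod (filter T' V)).[x] =
   (unit_prod [seq y <- V | T y && T' y]).[x] ^+ 2 *
   (unit_prod [seq y <- V | T y (+) T' y]).[x].
  elim: V {V0 xV} => [|y V IH] /=; first by rewrite /unit_prod !big_nil !hornerC; ring.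
  have cons b s : (unit_prod (if b then y :: s else s)).[x] =
      (if b then 1 - x / y else 1) * (unit_prod s).[x].
    case: b => /=; last by rewrite mul1r.
    by rewrite unit_prod_cons hornerM !hornerE [y^-1 * x]mulrC.
  rewrite !cons mulrACA IH; case: (T y); case: (T' y) => /=; ring.
rewrite pmulr_rgt0 // exprn_even_gt0 //= -[_ == 0]/(root _ x) root_unit_prod.
  by rewrite mem_filter (negPf xV) andbF.
by rewrite mem_filter (negPf V0) andbF.
Qed.

Lemma seq_max s x0 : x0 \in s -> exists2 p, p \in s & {in s, forall x, x <= p}.
Proof.
elim: s x0 => // y [|z s] IH x0 _.
  by exists y; rewrite ?mem_head // => x; rewrite inE => /eqP->.
have [p ps pm] := IH z (mem_head _ _); have [py|yp] := leP p y.
  exists y; rewrite ?mem_head // => x; rewrite in_cons => /orP[/eqP->//|/pm xp].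
  exact: le_trans xp py.
exists p; first by rewrite inE ps orbT.
move=> x; rewrite in_cons => /orP[/eqP->|/pm//].
exact: ltW.
Qed.

Lemma seq_min s x0 : x0 \in s -> exists2 p, p \in s & {in s, forall x, p <= x}.
Proof.
move=> xs; have [|p] := @seq_max (map -%R s) (- x0); first exact: map_f.
move=> /mapP[q qs ->] H; exists q => // x xs'.
by rewrite -lerN2 H // map_f.
Qed.

Section Configuration.
Variables (L V : seq F) (W P : {poly F}) (al c k : F) (r : F -> F).
Hypotheses (uL : uniq L) (r0 : {in L, forall x, 0 < r x}) (al0 : 0 < al) (k0 : k != 0).
Hypotheses (WE : W = k *: roots_prod L) (XP : 'X * P = k *: pf_num al c r L).
Hypothesis (P0 : P.[0] = 1).

Let Q := pf_num al c r L.

(** The roots of [P] are the zeros of the Herglotz function [X P / W] other than 0. *)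
Lemma unit_roots : exists V, [/\ uniq V, 0 \notin V, P = unit_prod V, size V = size L &
  {in V, forall y, 0 < y * W.[y] * P^`().[y]}].
Proof.
have [t [ut Qt Pt]] := herglotz_zeros c uL r0 (ltW al0) (or_introl al0).
rewrite -/Q in Qt Pt; have XPQ : 'X * P = k *: Q by exact: XP.
have Q0 : lead_coef Q != 0.
  by rewrite lead_coef_eq0 -size_poly_gt0 size_pf_num ?lt0r_neq0.
have st : size t = (size L).+1.
  have : size Q = (size L).+2 by rewrite size_pf_num ?lt0r_neq0.
  by rewrite Qt size_scale // size_roots_prod => -[].
have t0 : 0 \in t.
  rewrite -root_roots_prod -(rootZ _ _ Q0) -Qt -(rootZ _ _ k0) -XPQ /root hornerM hornerX.
  by rewrite mul0r.
have PE : P = (k * lead_coef Q) *: roots_prod (rem 0 t).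
  apply: (@mulfI _ 'X); first by rewrite polyX_eq0.
  by rewrite XPQ Qt lead_coefZ (monicP (roots_prod_monic _)) mulr1 (roots_prod_rem t0) subr0 scalerA -!scalerAr.
exists (rem 0 t); split.
- exact: rem_uniq.
- by rewrite mem_rem_uniq // inE eqxx.
- exact: eq_unit_prod PE P0.
- by rewrite size_rem // st.
move=> y; rewrite mem_rem_uniq // inE => /andP[y0 yt].
have Py : P.[y] = 0.
  apply/rootP; rewrite PE rootZ ?mulf_neq0 // root_roots_prod mem_rem_uniq // inE.
  exact/andP.
have dQ : y * P^`().[y] = k * Q^`().[y].
  have := congr1 (fun P : {poly F} => P^`().[y]) XPQ.
  by rewrite derivM derivX derivZ !hornerE Py add0r.
have k2 : 0 < k ^+ 2 by rewrite exprn_even_gt0.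
rewrite mulrAC dQ WE hornerZ [X in 0 < X](_ : _ = k ^+ 2 * ((roots_prod L).[y] * Q^`().[y])).
  by apply: mulr_gt0 k2 (Pt y yt).
ring.
Qed.

Hypotheses (uV : uniq V) (V0 : 0 \notin V) (PV : P = unit_prod V).

Lemma root_Q y : root Q y = (y == 0) || (y \in V).
Proof.
rewrite -(rootZ _ _ k0) /Q -XP rootM rootX PV root_unit_prod //.
Qed.

Lemma gap y z : root Q y -> root Q z -> y < z -> exists x, x \in L /\ y < x < z.
Proof. exact: pf_num_gap. Qed.

Lemma V_notin_L y : y \in V -> y \notin L.
Proof. move=> yV; have Qy : root Q y by rewrite root_Q yV orbT.
exact: pf_num_root_notin uL r0 Qy. Qed.

Lemma top_unique y z : root Q y -> root Q z -> all (< y)%R L -> all (< z)%R L -> y = z.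
Proof.
move=> Qy Qz /allP ty /allP tz; case: (ltgtP y z) => // H.
  by have [x [/ty xy /andP[yx _]]] := gap Qy Qz H; rewrite /= ltNge (ltW yx) in xy.
by have [x [/tz xz /andP[zx _]]] := gap Qz Qy H; rewrite /= ltNge (ltW zx) in xz.
Qed.

Lemma bottom_unique y z : root Q y -> root Q z -> all (> y)%R L -> all (> z)%R L -> y = z.
Proof.
move=> Qy Qz /allP ty /allP tz; case: (ltgtP y z) => // H.
  by have [x [/tz xz /andP[_ zx]]] := gap Qy Qz H; rewrite /= ltNge (ltW zx) in xz.
by have [x [/ty xy /andP[_ yx]]] := gap Qz Qy H; rewrite /= ltNge (ltW yx) in xy.
Qed.

Lemma Q_root0 : root Q 0. Proof. by rewrite root_Q eqxx. Qed.
Lemma Q_rootV y : y \in V -> root Q y. Proof. by rewrite root_Q orbC => ->. Qed.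
Lemma V_neq0 y : y \in V -> y != 0. Proof. by apply: contraTneq => ->. Qed.

(** The zero 0 and [y] lie in different gaps, so [y] lies on the same side of 0 as the eigenvalue next
to it, and farther out. *)
Lemma outer_sign y x : y \in V -> outer L y -> x \in L -> 0 < 1 - x / y.
Proof.
move=> yV out xL; have y0 := V_neq0 yV.
have -> : 1 - x / y = (y - x) / y by rewrite mulrBl divff.
case/orP: out => out; have := allP out x xL => /= xy.
  have yp : 0 < y.
    rewrite lt_neqAle eq_sym y0 /= leNgt; apply: contra_neqN y0 => yn.
    apply: (top_unique (Q_rootV yV) Q_root0) => //.
    by apply/allP => u /(allP out) /= uy; apply: lt_trans yn.
  by rewrite divr_gt0 // subr_gt0.
have yp : y < 0.
  rewrite lt_neqAle y0 /= leNgt; apply: contra_neqN y0 => yn.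
  apply: (bottom_unique (Q_rootV yV) Q_root0) => //.
  by apply/allP => u /(allP out) /= uy; apply: lt_trans uy.
by rewrite nmulr_rgt0 ?invr_lt0 // subr_lt0.
Qed.

Lemma adjacent_poles y : y \in V -> ~~ outer L y ->
  exists p q, [/\ p \in L, q \in L, p < y < q & {in L, forall x, (x <= p) || (q <= x)}].
Proof.
move=> yV; rewrite negb_or => /andP[/allPn[q0 q0L /= q0y] /allPn[p0 p0L /= p0y]].
have yL := V_notin_L yV.
have cmp x : x \in L -> (x < y) || (y < x).
  by move=> xL; rewrite -neq_lt; apply: contraNneq yL => <-.
have := cmp _ q0L; rewrite (negPf q0y) /= => {}q0y.
have := cmp _ p0L; rewrite (negPf p0y) orbF => {}p0y.
have [p [pL py pmax]] : exists p, [/\ p \in L, p < y & {in L, forall x, x < y -> x <= p}].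
  have [|p] := @seq_max (filter (< y)%R L) p0; rewrite mem_filter ?p0L /= ?p0y //.
  move=> /andP[/= py pL] H; exists p; split=> // x xL xy.
  by rewrite H // mem_filter xL /= xy.
have [q [qL yq qmin]] : exists q, [/\ q \in L, y < q & {in L, forall x, y < x -> q <= x}].
  have [|q] := @seq_min (filter (> y)%R L) q0; rewrite mem_filter ?q0L /= ?q0y //.
  move=> /andP[/= qy qL] H; exists q; split=> // x xL xy.
  by rewrite H // mem_filter xL /= xy.
exists p, q; split=> //; first by rewrite py.
by move=> x xL; case/orP: (cmp x xL) => H; [rewrite pmax | rewrite qmin ?orbT].
Qed.

(** An inner root [y] is alone between two neighbouring eigenvalues [p] and [q]: in the product of the
values at [p] and [q] its factor is negative and all the others are positive. *)
Lemma outer_of_sign D : uniq D -> {subset D <= V} ->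
  {in L, forall x, 0 < (unit_prod D).[x]} -> {in D, forall y, outer L y}.
Proof.
move=> uD DV pos y yD; apply: contraT => out; have yV := DV y yD.
have [p [q [pL qL /andP[py yq] adj]]] := adjacent_poles yV out.
have := mulr_gt0 (pos p pL) (pos q qL).
rewrite !unit_prod_horner -big_split /= (bigD1_seq y) //=.
rewrite ltNge pmulr_lle0.
  rewrite (_ : _ * _ = (y - p) * (y - q) / y ^+ 2); last by field; exact: V_neq0.
  rewrite -oppr_ge0 -mulNr -mulrN divr_ge0 ?sqr_ge0 // mulr_ge0 //.
    by rewrite subr_ge0 ltW.
  by rewrite opprB subr_ge0 ltW.
rewrite big_seq_cond prodr_gt0 // => z /andP[zD zy]; have zV := DV z zD.
rewrite (_ : _ * _ = (z - p) * (z - q) / z ^+ 2); last by field; exact: V_neq0.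
have z2 : 0 < z ^+ 2 by rewrite exprn_even_gt0 // V_neq0.
apply: divr_gt0 z2.
have [x [xL xb]] : exists x, x \in L /\ ((z < x < y) || (y < x < z)).
  case: (ltgtP z y) zy => // H _.
    by have [x [xL H1]] := gap (Q_rootV zV) (Q_rootV yV) H; exists x; rewrite H1.
  by have [x [xL H1]] := gap (Q_rootV yV) (Q_rootV zV) H; exists x; rewrite H1 orbT.
case/orP: xb => /andP[H1 H2].
  have xp : x <= p by case/orP: (adj x xL) => // H; have := lt_trans H2 yq; rewrite ltNge H.
  have zp := lt_le_trans H1 xp.
  by rewrite nmulr_rgt0 subr_lt0 // (lt_trans zp) // (lt_trans py).
have xq : q <= x by case/orP: (adj x xL) => // H; have := lt_trans py H1; rewrite ltNge H.
have zq := le_lt_trans xq H2.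
by rewrite mulr_gt0 // subr_gt0 // (lt_trans _ zq) // (lt_trans py).
Qed.

(** The signs at the eigenvalues decide, for every inner root, to which factor it belongs, and they do
not see the outer roots. *)
Lemma sign_agree (T T' : pred F) :
  {in L, forall x, 0 < (unit_prod (filter T V)).[x] * (unit_prod (filter T' V)).[x]} <->
  {in V, forall y, ~~ outer L y -> T y = T' y}.
Proof.
have LV x : x \in L -> x \notin V by move=> xL; apply/negP => /V_notin_L; rewrite xL.
split=> H.
  move=> y yV; apply: contraNeq => TT; pose D := [seq y <- V | T y (+) T' y].
  apply: (@outer_of_sign D) => //; rewrite ?filter_uniq //.
  - by move=> u; rewrite mem_filter => /andP[].
  - by move=> x xL; have Hx := H x xL; rewrite (unit_prod_filter_sign T T' V0 (LV x xL)) in Hx.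
  by rewrite mem_filter yV andbT; move: TT; case: (T y) (T' y) => -[].
move=> x xL; rewrite (unit_prod_filter_sign T T' V0 (LV x xL)) unit_prod_horner big_seq prodr_gt0 //.
move=> y; rewrite mem_filter => /andP[TT yV]; apply: outer_sign => //.
by apply: contraTT TT => /(H y yV)->; rewrite addbb.
Qed.

(** One of the two unbounded gaps contains the zero 0, which is not a root of [P]. *)
Lemma outer_same_sign : L != [::] ->
  {in L, forall x, 0 < x} \/ {in L, forall x, x < 0} ->
  exists2 y, y \in V & {in V, forall z, outer L z = (z == y)}.
Proof.
move=> L0 H; have [[z Qz tz] [y Qy ty]] := extreme_roots c uL r0 al0.
rewrite -/Q in Qz Qy.
have tz' : all (< z)%R L by apply/allP.
have ty' : all (> y)%R L by apply/allP.
have [x0 x0L] : exists x, x \in L by case: (L) L0 => // x ? _; exists x; rewrite mem_head.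
case: H => H.
  have zV : z \in V.
    move: Qz; rewrite root_Q => /orP[/eqP E|//].
    by have := lt_trans (H _ x0L) (tz _ x0L); rewrite E ltxx.
  have b0 : all (> 0)%R L by apply/allP.
  exists z => // u uInV; apply/orP/eqP => [[tu|bu]|->]; [exact: top_unique (Q_rootV uInV) Qz tu tz' | | by left].
  by have := V_neq0 uInV; rewrite (bottom_unique (Q_rootV uInV) Q_root0 bu b0) eqxx.
have yV : y \in V.
  move: Qy; rewrite root_Q => /orP[/eqP E|//].
  by have := lt_trans (ty _ x0L) (H _ x0L); rewrite E ltxx.
have b0 : all (< 0)%R L by apply/allP.
exists y => // u uInV; apply/orP/eqP => [[tu|bu]|->]; [ | exact: bottom_unique (Q_rootV uInV) Qy bu ty' | by right].
by have := V_neq0 uInV; rewrite (top_unique (Q_rootV uInV) Q_root0 tu b0) eqxx.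
Qed.

Lemma outer_mixed x1 x2 : x1 \in L -> x2 \in L -> x1 < 0 < x2 ->
  exists y z, [/\ y \in V, z \in V, y != z &
    {in V, forall u, outer L u = (u == y) || (u == z)}].
Proof.
move=> x1L x2L /andP[x10 x20].
have [[z Qz tz] [y Qy ty]] := extreme_roots c uL r0 al0.
rewrite -/Q in Qz Qy.
have tz' : all (< z)%R L by apply/allP.
have ty' : all (> y)%R L by apply/allP.
have z0 : 0 < z := lt_trans x20 (tz _ x2L).
have y0 : y < 0 := lt_trans (ty _ x1L) x10.
exists y, z; split.
- by move: Qy; rewrite root_Q (lt_eqF y0).
- by move: Qz; rewrite root_Q (gt_eqF z0).
- by rewrite lt_eqF // (lt_trans y0).
move=> u uInV; apply/orP/orP => -[H|H].
- by right; apply/eqP; apply: top_unique (Q_rootV uInV) Qz H tz'.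
- by left; apply/eqP; apply: bottom_unique (Q_rootV uInV) Qy H ty'.
- by right; rewrite (eqP H).
by left; rewrite (eqP H).
Qed.

End Configuration.

(** [A] is prescribed by [A U2 = W] at the roots of the first factor; the sign condition on the product
then becomes that of [admissible], as the two differ by the square of [U2]. *)
Lemma admissible_interp (V1 : seq F) W U2 : uniq V1 -> 0 \notin V1 ->
  {in V1, forall y, U2.[y] != 0} ->
  {in V1, forall y, 0 < y * W.[y] * (unit_prod V1 * U2)^`().[y]} ->
  exists A, admissible (unit_prod V1) A /\ {in V1, forall y, A.[y] * U2.[y] = W.[y]}.
Proof.
move=> uV V0 n0 pos.
have u0 : uniq (0 :: V1) by rewrite /= V0.
have [A [sA eA]] := interpolation (fun y => if y == 0 then 1 else W.[y] / U2.[y]) u0.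
have eV y : y \in V1 -> A.[y] * U2.[y] = W.[y].
  move=> yV; have y0 : y != 0 by apply: contraTneq yV => ->.
  by rewrite eA ?inE ?yV ?orbT // (negPf y0) divfK ?n0.
exists A; split=> //; split.
- exact: unit_prod0.
- by rewrite eA ?mem_head // eqxx.
- by rewrite size_unit_prod.
exists V1; split=> //.
  have [k k0 E] := unit_prodE V0.
  by rewrite E lead_coefZ (monicP (roots_prod_monic _)) mulr1.
move=> y yV; have := pos y yV; rewrite derivM !hornerE.
have /rootP-> : root (unit_prod V1) y by rewrite root_unit_prod.
rewrite mul0r addr0 -eV // => H.
have u2 : 0 < U2.[y] ^+ 2 by rewrite exprn_even_gt0 ?n0.
rewrite -(pmulr_lgt0 _ u2); move: H; congr (0 < _); ring.
Qed.

Lemma admissible_unique (U A A' : {poly F}) : admissible U A -> admissible U A' ->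
  (forall y, root U y -> A.[y] = A'.[y]) -> A = A'.
Proof.
move=> [U0 A0 sA [s [us Us _]]] [_ A'0 sA' _] H.
have k0 : lead_coef U != 0.
  rewrite lead_coef_eq0; apply: contra_eq_neq U0 => ->.
  by rewrite horner0 eq_sym oner_eq0.
have rU y : root U y = (y \in s) by rewrite Us rootZ // root_roots_prod.
have sU : size U = (size s).+1 by rewrite Us size_scale // size_roots_prod.
apply: (@eq_poly_of_nodes _ _ _ (0 :: s)); rewrite /= -?sU //.
  by rewrite -rU /root U0 oner_eq0.
by move=> y; rewrite in_cons -rU => /orP[/eqP->|/H//]; rewrite A0 A'0.
Qed.

(** Every distribution of the roots of [P] to the two sides comes from a pair of half-lines: the sum of
partial fractions of [W / P] is distributed together with its poles. *)
Lemma factor_choice V W (T : pred F) : uniq V -> 0 \notin V -> W.[0] = 1 ->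
  (size W <= (size V).+1)%N ->
  {in V, forall y, 0 < y * W.[y] * (unit_prod V)^`().[y]} ->
  let U1 := unit_prod (filter T V) in let U2 := unit_prod (filter (predC T) V) in
  unit_prod V = U2 * U1 /\
  exists A1 A2, [/\ admissible U1 A1, admissible U2 A2 & W = A2 * U1 + A1 * U2 - U2 * U1].
Proof.
move=> uV V0 W0 sW pos U1 U2.
have fV0 (B : pred F) : 0 \notin filter B V by rewrite mem_filter (negPf V0) andbF.
have PE : unit_prod V = U2 * U1.
  rewrite /U1 /U2 mulrC /unit_prod !big_filter.
  by rewrite (bigID T).
split=> //.
have [||||A1 [ad1 E1]] := @admissible_interp (filter T V) W U2; rewrite ?filter_uniq ?fV0 //.
- move=> y; rewrite mem_filter => /andP[Ty yV].
  by rewrite -[_ == 0]/(root _ y) root_unit_prod ?fV0 // mem_filter /= Ty.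
- by move=> y; rewrite mem_filter => /andP[_ yV]; rewrite -/U1 (mulrC U1) -PE pos.
have [||||A2 [ad2 E2]] := @admissible_interp (filter (predC T) V) W U1; rewrite ?filter_uniq ?fV0 //.
- move=> y; rewrite mem_filter => /andP[/= Ty yV].
  by rewrite -[_ == 0]/(root _ y) root_unit_prod ?fV0 // mem_filter (negPf Ty).
- by move=> y; rewrite mem_filter => /andP[_ yV]; rewrite -PE pos.
exists A1, A2; split=> //.
have sU : (size U2 + size U1 = (size V).+2)%N.
  rewrite !size_unit_prod ?fV0 // !addSn addnS !size_filter.
  by rewrite addnC count_predC.
have sm (B C U U' : {poly F}) : (size B <= size U)%N -> (size C <= size U')%N ->
    (size U + size U' = (size V).+2)%N -> (size (B * C)%R <= (size V).+1)%N.
  move=> sB sC s2; apply: leq_trans (size_polyMleq _ _) _.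
  by rewrite -ltnS -[(size V).+2]s2; case: (_ + _)%N (leq_add sB sC) => //; lia.
apply: (@eq_poly_of_nodes _ _ _ (0 :: V)) => //=; first by rewrite V0.
  case: ad1 => _ _ sA1 _; case: ad2 => _ _ sA2 _.
  apply: leq_trans (size_polyD _ _) _; rewrite size_polyN geq_max; apply/andP; split.
    apply: leq_trans (size_polyD _ _) _; rewrite geq_max.
    by rewrite (sm _ _ U2 U1) // (sm _ _ U1 U2) // addnC.
  by rewrite (sm _ _ U2 U1).
move=> y; rewrite inE => /orP[/eqP->|yV].
  case: ad1 => a1 a2 _ _; case: ad2 => a3 a4 _ _.
  by rewrite W0 !hornerE a1 a2 a3 a4; ring.
rewrite !hornerE; have [Ty|Ty] := boolP (T y).
  have /rootP-> : root U1 y by rewrite root_unit_prod ?fV0 // mem_filter Ty.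
  by rewrite -E1 ?mem_filter ?Ty //; ring.
have /rootP-> : root U2 y by rewrite root_unit_prod ?fV0 // mem_filter /= Ty.
by rewrite -E2 ?mem_filter /= ?Ty //; ring.
Qed.

End Gaps.
End Interlacing.

(** * Solutions of the differential equation *)

Module Ode.
Import Reals Lra List Sorted Coquelicot ListNotations Defs.
Local Open Scope R_scope.

Local Notation is_cderive := (@is_derive R_AbsRing C_R_NormedModule).

Lemma is_cderive_fst (f : R -> C) x l :
  is_cderive f x l -> is_derive (fun t => fst (f t)) x (fst l).
Proof.
intros H.
exact (filterdiff_comp' f fst x (fun y => scal y l) fst H
  (filterdiff_linear _ is_linear_fst)).
Qed.

Lemma is_cderive_snd (f : R -> C) x l :
  is_cderive f x l -> is_derive (fun t => snd (f t)) x (snd l).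
Proof.
intros H.
exact (filterdiff_comp' f snd x (fun y => scal y l) snd H
  (filterdiff_linear _ is_linear_snd)).
Qed.

(** [(f' - f/2) e^(x/2)] and [(f' + f/2) e^(-x/2)] are constant. *)
Lemma real_general_solution (f f1 f2 : R -> R) (m : R) (M : Rbar) :
  (forall x : R, m < x -> Rbar_lt x M ->
     is_derive f x (f1 x) /\ is_derive f1 x (f2 x) /\ - f2 x + 1 / 4 * f x = 0) ->
  Rbar_lt m M ->
  exists A B, forall x : R, m < x -> Rbar_lt x M ->
    f x = A * exp (- x / 2) + B * exp (x / 2) /\
    f1 x = - A / 2 * exp (- x / 2) + B / 2 * exp (x / 2).
Proof.
intros H mM.
assert (exists x0, m < x0 /\ Rbar_lt x0 M) as [x0 [H0 H1]].
{ destruct M as [M| |]; simpl in mM; try easy.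
  - exists ((m + M) / 2); simpl; lra.
  - exists (m + 1); simpl; split; [lra|easy]. }
assert (between : forall x y z : R, m < x -> Rbar_lt y M -> x <= z <= y ->
   m < z /\ Rbar_lt z M).
{ intros x y z mx yM [xz zy]; split; [lra|].
  exact (Rbar_le_lt_trans z y M zy yM). }
assert (const : forall g : R -> R,
  (forall x : R, m < x -> Rbar_lt x M -> is_derive g x 0) ->
  forall x : R, m < x -> Rbar_lt x M -> g x = g x0).
{ intros g Hg x mx xM; destruct (Rtotal_order x x0) as [L|[->|L]]; auto.
  - apply (eq_is_derive g); auto; intros t Ht.
    destruct (between x x0 t) as [b1 b2]; auto; exact (Hg t b1 b2).
  - symmetry; apply (eq_is_derive g); auto; intros t Ht.
    destruct (between x0 x t) as [b1 b2]; auto; exact (Hg t b1 b2). }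
pose (g x := (f1 x - f x / 2) * exp (x / 2)).
pose (h x := (f1 x + f x / 2) * exp (- x / 2)).
assert (ee : forall x, exp (x / 2) * exp (- x / 2) = 1).
{ intros x; rewrite <- exp_plus; replace (x / 2 + - x / 2) with 0 by field.
  apply exp_0. }
assert (Hg : forall x : R, m < x -> Rbar_lt x M -> is_derive g x 0).
{ intros x mx xM; destruct (H x mx xM) as [D1 [D2 E]]; unfold g.
  auto_derive.
  - split; [exists (f2 x); exact D2|split; [exists (f1 x); exact D1|auto]].
  - replace (Derive (fun x1 => f x1) x) with (f1 x) by (symmetry; apply is_derive_unique; exact D1).
    replace (Derive (fun x1 => f1 x1) x) with (f2 x) by (symmetry; apply is_derive_unique; exact D2).
    replace (f2 x) with (1 / 4 * f x) by lra; field. }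
assert (Hh : forall x : R, m < x -> Rbar_lt x M -> is_derive h x 0).
{ intros x mx xM; destruct (H x mx xM) as [D1 [D2 E]]; unfold h.
  auto_derive.
  - split; [exists (f2 x); exact D2|split; [exists (f1 x); exact D1|auto]].
  - replace (Derive (fun x1 => f x1) x) with (f1 x) by (symmetry; apply is_derive_unique; exact D1).
    replace (Derive (fun x1 => f1 x1) x) with (f2 x) by (symmetry; apply is_derive_unique; exact D2).
    replace (f2 x) with (1 / 4 * f x) by lra; field. }
exists (- g x0), (h x0); intros x mx xM.
rewrite <- (const g Hg x mx xM), <- (const h Hh x mx xM); unfold g, h.
specialize (ee x); split.
- replace (f x) with (f x * (exp (x / 2) * exp (- x / 2))) at 1 by (rewrite ee; ring).
  field.
- replace (f1 x) with (f1 x * (exp (x / 2) * exp (- x / 2))) at 1 by (rewrite ee; ring).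
  field.
Qed.

Local Open Scope C_scope.

Definition wave (A B : C) (x : R) : C := A * RtoC (exp (- x / 2)) + B * RtoC (exp (x / 2)).
Definition dwave (A B : C) (x : R) : C :=
  - (A / RtoC 2) * RtoC (exp (- x / 2)) + B / RtoC 2 * RtoC (exp (x / 2)).

Lemma general_solution (f f1 f2 : R -> C) (m : R) (M : Rbar) :
  (forall x : R, (m < x)%R -> Rbar_lt x M ->
     is_cderive f x (f1 x) /\ is_cderive f1 x (f2 x) /\
     - f2 x + RtoC (1 / 4) * f x = 0) ->
  Rbar_lt m M ->
  exists A B : C, forall x : R, (m < x)%R -> Rbar_lt x M ->
    f x = wave A B x /\ f1 x = dwave A B x.
Proof.
intros H mM.
destruct (real_general_solution (fun t => fst (f t)) (fun t => fst (f1 t))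
  (fun t => fst (f2 t)) m M) as [A1 [B1 E1]]; auto.
{ intros x mx xM; destruct (H x mx xM) as [D1 [D2 E]]; split; [|split].
  - apply is_cderive_fst, D1.
  - apply is_cderive_fst, D2.
  - apply (f_equal fst) in E; simpl in E; lra. }
destruct (real_general_solution (fun t => snd (f t)) (fun t => snd (f1 t))
  (fun t => snd (f2 t)) m M) as [A2 [B2 E2]]; auto.
{ intros x mx xM; destruct (H x mx xM) as [D1 [D2 E]]; split; [|split].
  - apply is_cderive_snd, D1.
  - apply is_cderive_snd, D2.
  - apply (f_equal snd) in E; simpl in E; lra. }
exists (A1, A2), (B1, B2); intros x mx xM.
destruct (E1 x mx xM) as [F1 G1], (E2 x mx xM) as [F2 G2].
split; apply injective_projections; simpl; rewrite ?F1, ?F2, ?G1, ?G2; field.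
Qed.

Lemma wave_decaying (A : C) x : wave A 0 x = A * RtoC (exp (- x / 2)).
Proof. unfold wave; ring. Qed.

Lemma is_cderive_wave (A B : C) x : is_cderive (wave A B) x (dwave A B x).
Proof.
unfold wave, dwave.
apply (is_derive_ext (fun t => @plus C_R_NormedModule
   (@scal R_AbsRing C_R_NormedModule (exp (- t / 2))%R A)
   (@scal R_AbsRing C_R_NormedModule (exp (t / 2))%R B))).
{ intros t; apply injective_projections; simpl; unfold plus, scal, mult; simpl; unfold mult; simpl; ring. }
replace (- (A / RtoC 2) * RtoC (exp (- x / 2)) + B / RtoC 2 * RtoC (exp (x / 2))) with
 (@plus C_R_NormedModule
   (@scal R_AbsRing C_R_NormedModule (- / 2 * exp (- x / 2))%R A)
   (@scal R_AbsRing C_R_NormedModule (/ 2 * exp (x / 2))%R B)).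
2:{ apply injective_projections; simpl; unfold plus, scal, mult; simpl; unfold mult; simpl; field. }
apply (is_derive_plus (V := C_R_NormedModule)); apply (is_derive_scal_l (V := C_R_NormedModule)).
- auto_derive; auto; change (- (1) * / 2 * exp (- x / 2) = - / 2 * exp (- x / 2))%R; field.
- auto_derive; auto; change (1 * / 2 * exp (x / 2) = / 2 * exp (x / 2))%R; field.
Qed.

Lemma is_cderive_dwave (A B : C) x : is_cderive (dwave A B) x (RtoC (1 / 4) * wave A B x).
Proof.
replace (RtoC (1 / 4) * wave A B x) with (dwave (- (A / RtoC 2)) (B / RtoC 2) x).
- apply is_cderive_wave.
- unfold dwave, wave; apply injective_projections; simpl; field.
Qed.

Lemma continuous_wave (A B : C) x : continuous (wave A B) x.
Proof.
apply (ex_derive_continuous (V := C_R_NormedModule)).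
exists (dwave A B x); apply is_cderive_wave.
Qed.

Lemma continuous_dwave (A B : C) x : continuous (dwave A B) x.
Proof. exact (continuous_wave (- (A / RtoC 2)) (B / RtoC 2) x). Qed.


Lemma expC_inv x : RtoC (exp (- x / 2)) * RtoC (exp (x / 2)) = 1.
Proof.
rewrite <- RtoC_mult, <- exp_plus; replace (- x / 2 + x / 2)%R with 0%R by field.
now rewrite exp_0.
Qed.

Lemma expC_double x : RtoC (exp x) = RtoC (exp (x / 2)) * RtoC (exp (x / 2)).
Proof. rewrite <- RtoC_mult, <- exp_plus; do 2 f_equal; field. Qed.

Lemma expC_doubleN x : RtoC (exp (- x)) = RtoC (exp (- x / 2)) * RtoC (exp (- x / 2)).
Proof. rewrite <- RtoC_mult, <- exp_plus; do 2 f_equal; field. Qed.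

Lemma RtoC2_neq0 : RtoC 2 <> RtoC 0.
Proof. intros E; apply (f_equal fst) in E; simpl in E; lra. Qed.

Definition jumpC (z : C) (s : atom) : C := z * RtoC (w_omega s) + z * z * RtoC (w_v s).

(** Coefficients of [e^(-x/2)] and [e^(x/2)] of phi_+ to the left of the configuration [p]. *)
Fixpoint coefC (z : C) (p : config) : C * C :=
  match p with
  | nil => (RtoC 1, RtoC 0)
  | s :: p' =>
      let AB := coefC z p' in
      let U := fst AB + RtoC (exp (pos s)) * snd AB in
      (fst AB - jumpC z s * U, snd AB + RtoC (exp (- pos s)) * (jumpC z s * U))
  end.

Definition waveC (AB : C * C) := wave (fst AB) (snd AB).
Definition dwaveC (AB : C * C) := dwave (fst AB) (snd AB).

Fixpoint phi (z : C) (p : config) (x : R) : C :=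
  match p with
  | nil => waveC (coefC z nil) x
  | s :: p' => if Rlt_dec x (pos s) then waveC (coefC z (s :: p')) x else phi z p' x
  end.

Fixpoint dphi (z : C) (p : config) (x : R) : C :=
  match p with
  | nil => dwaveC (coefC z nil) x
  | s :: p' => if Rlt_dec x (pos s) then dwaveC (coefC z (s :: p')) x else dphi z p' x
  end.

(** Continuity and the jump of the derivative determine the coefficients on one side of an atom by those
on the other side. *)
Lemma match_iff (A B A' B' q : C) (x : R) :
  (wave A B x = wave A' B' x /\
   dwave A B x = dwave A' B' x + q * wave A' B' x) <->
  (A = A' - q * (A' + RtoC (exp x) * B') /\
   B = B' + RtoC (exp (- x)) * (q * (A' + RtoC (exp x) * B'))).
Proof.
unfold wave, dwave; rewrite (expC_double x), (expC_doubleN x).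
generalize (expC_inv x).
set (u := RtoC (exp (- x / 2))); set (w := RtoC (exp (x / 2))); intros uw.
assert (n2 := RtoC2_neq0).
split.
- intros [E1 E2].
  assert (EA : A * u = A' * u - q * (A' * u + B' * w)).
  { replace (A * u) with ((A * u + B * w) / RtoC 2 - (- (A / RtoC 2) * u + B / RtoC 2 * w)) by (field; exact n2).
    rewrite E1, E2; field; exact n2. }
  assert (EB : B * w = B' * w + q * (A' * u + B' * w)).
  { replace (B * w) with ((A * u + B * w) / RtoC 2 + (- (A / RtoC 2) * u + B / RtoC 2 * w)) by (field; exact n2).
    rewrite E1, E2; field; exact n2. }
  split.
  + replace A with (A * u * w) by (rewrite <- Cmult_assoc, uw; ring).
    rewrite EA; transitivity (A' * (u * w) - q * (A' * (u * w) + w * w * B')); [ring|rewrite uw; ring].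
  + replace B with (B * w * u) by (rewrite <- Cmult_assoc, (Cmult_comm w u), uw; ring).
    rewrite EB; transitivity (B' * (u * w) + q * (A' * (u * u) + B' * (u * w))); [ring|].
    transitivity (B' + q * (A' * (u * u) + B' * (u * w) * (u * w))); [rewrite uw; ring|ring].
- intros [-> ->].
  set (U := A' + w * w * B').
  assert (EU : u * U = A' * u + B' * w).
  { unfold U; transitivity (A' * u + B' * w * (u * w)); [ring|rewrite uw; ring]. }
  split.
  + transitivity (A' * u + B' * w - q * (u * U) + u * (u * w) * (q * U)); [ring|rewrite uw; ring].
  + rewrite <- EU.
    transitivity (- (A' / RtoC 2) * u + B' / RtoC 2 * w + q * (u * U) / RtoC 2 + (u * w) * (u * (q * U)) / RtoC 2); [field; exact n2|].
    rewrite uw; field; exact n2.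
Qed.

Lemma wave_cons z s p : waveC (coefC z (s :: p)) (pos s) = waveC (coefC z p) (pos s).
Proof.
exact (proj1 (proj2 (match_iff _ _ (fst (coefC z p)) (snd (coefC z p)) (jumpC z s) (pos s)) (conj eq_refl eq_refl))).
Qed.

Lemma dwave_cons z s p : dwaveC (coefC z (s :: p)) (pos s) =
  dwaveC (coefC z p) (pos s) + jumpC z s * waveC (coefC z p) (pos s).
Proof.
exact (proj2 (proj2 (match_iff _ _ (fst (coefC z p)) (snd (coefC z p)) (jumpC z s) (pos s)) (conj eq_refl eq_refl))).
Qed.

Definition ordered (p : config) := StronglySorted (fun s t => (pos s < pos t)%R) p.

Lemma phi_left z p x : (forall s, In s p -> (x < pos s)%R) -> phi z p x = waveC (coefC z p) x.
Proof.
destruct p as [|s p]; intros H; [reflexivity|]; simpl.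
destruct (Rlt_dec x (pos s)) as [|n]; [reflexivity|].
destruct n; apply H; now left.
Qed.

Lemma dphi_left z p x : (forall s, In s p -> (x < pos s)%R) -> dphi z p x = dwaveC (coefC z p) x.
Proof.
destruct p as [|s p]; intros H; [reflexivity|]; simpl.
destruct (Rlt_dec x (pos s)) as [|n]; [reflexivity|].
destruct n; apply H; now left.
Qed.

Lemma ordered_inv s p : ordered (s :: p) ->
  ordered p /\ forall t, In t p -> (pos s < pos t)%R.
Proof.
intros H; inversion H; subst; split; auto.
now apply Forall_forall.
Qed.

Lemma ordered_gap (p : config) (x : R) : ordered p -> (forall t, In t p -> (x < pos t)%R) ->
  exists y, (x < y)%R /\ forall t, In t p -> (y <= pos t)%R.
Proof.
destruct p as [|s p]; intros S H.
- exists (x + 1)%R; split; [lra|intros t []].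
- exists (pos s); split; [apply H; now left|].
  intros t [->|Ht]; [lra|].
  apply ordered_inv in S; left; now apply S.
Qed.

Lemma locally_between (x a b : R) : (a < x < b)%R -> locally x (fun y => (a < y < b)%R).
Proof.
intros H; apply (locally_interval _ x (Finite a) (Finite b)); simpl; try lra.
intros y; simpl; lra.
Qed.

Lemma filterlim_left (g h : R -> C) (x a : R) : (a < x)%R ->
  (forall y, (a < y < x)%R -> g y = h y) -> continuous h x ->
  filterlim g (at_left x) (locally (h x)).
Proof.
intros ax E H.
apply (filterlim_ext_loc h).
- unfold at_left, within.
  generalize (locally_between x a (x + 1) ltac:(lra)); apply filter_imp.
  intros y Hy yx; symmetry; apply E; lra.
- eapply filterlim_filter_le_1; [|exact H].
  apply filter_le_within.
Qed.

Lemma filterlim_right (g h : R -> C) (x b : R) : (x < b)%R ->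
  (forall y, (x < y < b)%R -> g y = h y) -> continuous h x ->
  filterlim g (at_right x) (locally (h x)).
Proof.
intros ax E H.
apply (filterlim_ext_loc h).
- unfold at_right, within.
  generalize (locally_between x (x - 1) b ltac:(lra)); apply filter_imp.
  intros y Hy yx; symmetry; apply E; lra.
- eapply filterlim_filter_le_1; [|exact H].
  apply filter_le_within.
Qed.

Lemma continuous_glue (g h1 h2 : R -> C) (x a b : R) : (a < x < b)%R ->
  (forall y, (a < y < b)%R -> g y = h1 y \/ g y = h2 y) ->
  g x = h1 x -> g x = h2 x -> continuous h1 x -> continuous h2 x -> continuous g x.
Proof.
intros axb E E1 E2 C1 C2.
apply filterlim_locally; intros eps.
assert (L1 := proj1 (filterlim_locally h1 (h1 x)) C1 eps).
assert (L2 := proj1 (filterlim_locally h2 (h2 x)) C2 eps).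
generalize (filter_and _ _ (locally_between x a b axb) (filter_and _ _ L1 L2)).
apply filter_imp; intros y [Hy [B1 B2]].
destruct (E y Hy) as [->| ->]; [rewrite E1; exact B1|rewrite E2; exact B2].
Qed.

Lemma phi_solves z p : ordered p ->
  (forall x, continuous (phi z p) x) /\
  (forall x, ~ In x (map pos p) ->
     is_cderive (phi z p) x (dphi z p x) /\
     is_cderive (dphi z p) x (RtoC (1 / 4) * phi z p x)) /\
  (forall s, In s p -> exists dl dr : C,
     filterlim (dphi z p) (at_left (pos s)) (locally dl) /\
     filterlim (dphi z p) (at_right (pos s)) (locally dr) /\
     dl = dr + jumpC z s * phi z p (pos s)).
Proof.
induction p as [|s p IH]; intros S.
- split; [|split].
  + intros x; apply continuous_wave.
  + intros x _; split; [apply is_cderive_wave|apply is_cderive_dwave].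
  + intros s [].
- destruct (ordered_inv _ _ S) as [S' H]; destruct (IH S') as [Cont [Der Jump]].
  destruct (ordered_gap p (pos s) S' H) as [y [sy yp]].
  assert (lt_eq : forall x, (x < pos s)%R -> phi z (s :: p) x = waveC (coefC z (s :: p)) x /\
     dphi z (s :: p) x = dwaveC (coefC z (s :: p)) x).
  { intros x Hx; simpl; destruct (Rlt_dec x (pos s)); [easy|lra]. }
  assert (ge_eq : forall x, (pos s <= x)%R -> phi z (s :: p) x = phi z p x /\
     dphi z (s :: p) x = dphi z p x).
  { intros x Hx; simpl; destruct (Rlt_dec x (pos s)); [lra|easy]. }
  assert (mid : forall x, (x < y)%R -> phi z p x = waveC (coefC z p) x /\
     dphi z p x = dwaveC (coefC z p) x).
  { intros x Hx; split; [apply phi_left|apply dphi_left]; intros t Ht;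
    generalize (yp t Ht); lra. }
  split; [|split].
  + intros x; destruct (Rtotal_order x (pos s)) as [L|[E|G]].
    * apply (continuous_ext_loc _ (waveC (coefC z (s :: p)))); [|apply continuous_wave].
      generalize (locally_between x (x - 1) (pos s) ltac:(lra)); apply filter_imp.
      intros t Ht; symmetry; apply lt_eq; lra.
    * subst x; apply (continuous_glue _ (waveC (coefC z (s :: p))) (phi z p) _ (pos s - 1) (pos s + 1)).
      -- lra.
      -- intros t _; destruct (Rlt_dec t (pos s)); [left; apply lt_eq; auto|right; apply ge_eq; lra].
      -- rewrite (proj1 (ge_eq (pos s) ltac:(lra))), (proj1 (mid (pos s) sy)).
         symmetry; apply wave_cons.
      -- apply ge_eq; lra.
      -- apply continuous_wave.
      -- apply Cont.
    * apply (continuous_ext_loc _ (phi z p)); [|apply Cont].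
      generalize (locally_between x (pos s) (x + 1) ltac:(lra)); apply filter_imp.
      intros t Ht; symmetry; apply ge_eq; lra.
  + intros x Hx.
    destruct (Rtotal_order x (pos s)) as [L|[E|G]]; [|destruct Hx; now left|].
    * rewrite (proj1 (lt_eq x L)), (proj2 (lt_eq x L)); split.
      -- apply (is_derive_ext_loc (V := C_R_NormedModule) (waveC (coefC z (s :: p)))); [|apply is_cderive_wave].
         generalize (locally_between x (x - 1) (pos s) ltac:(lra)); apply filter_imp.
         intros t Ht; symmetry; apply lt_eq; lra.
      -- apply (is_derive_ext_loc (V := C_R_NormedModule) (dwaveC (coefC z (s :: p)))); [|apply is_cderive_dwave].
         generalize (locally_between x (x - 1) (pos s) ltac:(lra)); apply filter_imp.
         intros t Ht; symmetry; apply lt_eq; lra.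
    * assert (G' : (pos s <= x)%R) by lra.
      rewrite (proj1 (ge_eq x G')), (proj2 (ge_eq x G')).
      destruct (Der x) as [D1 D2]; [intros K; apply Hx; now right|]; split.
      -- apply (is_derive_ext_loc (V := C_R_NormedModule) (phi z p)); [|exact D1].
         generalize (locally_between x (pos s) (x + 1) ltac:(lra)); apply filter_imp.
         intros t Ht; symmetry; apply ge_eq; lra.
      -- apply (is_derive_ext_loc (V := C_R_NormedModule) (dphi z p)); [|exact D2].
         generalize (locally_between x (pos s) (x + 1) ltac:(lra)); apply filter_imp.
         intros t Ht; symmetry; apply ge_eq; lra.
  + intros t [<-|Ht].
    * exists (dwaveC (coefC z (s :: p)) (pos s)), (dwaveC (coefC z p) (pos s)).
      split; [|split].
      -- apply (filterlim_left _ (dwaveC (coefC z (s :: p))) _ (pos s - 1)); [lra| |apply continuous_dwave].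
         intros x Hx; apply lt_eq; lra.
      -- apply (filterlim_right _ (dwaveC (coefC z p)) _ y); [lra| |apply continuous_dwave].
         intros x Hx; rewrite (proj2 (ge_eq x ltac:(lra))); apply mid; lra.
      -- rewrite (proj1 (ge_eq (pos s) ltac:(lra))), (proj1 (mid (pos s) sy)).
         apply dwave_cons.
    * destruct (Jump t Ht) as [dl [dr [Hl [Hr E]]]]; exists dl, dr.
      assert (st := H t Ht); split; [|split].
      -- apply (filterlim_ext_loc (dphi z p)); [|exact Hl].
         unfold at_left, within.
         generalize (locally_between (pos t) (pos s) (pos t + 1) ltac:(lra)); apply filter_imp.
         intros x Hx _; symmetry; apply ge_eq; lra.
      -- apply (filterlim_ext_loc (dphi z p)); [|exact Hr].
         unfold at_right, within.
         generalize (locally_between (pos t) (pos s) (pos t + 1) ltac:(lra)); apply filter_imp.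
         intros x Hx _; symmetry; apply ge_eq; lra.
      -- rewrite (proj1 (ge_eq (pos t) ltac:(lra))); exact E.
Qed.

Lemma upper_bound (p : config) : exists M, forall s, In s p -> (pos s <= M)%R.
Proof.
induction p as [|s p [M H]]; [exists 0%R; intros s []|].
exists (Rmax (pos s) M); intros t [<-|Ht]; [apply Rmax_l|].
apply Rle_trans with M; [now apply H|apply Rmax_r].
Qed.

Lemma lower_bound (p : config) (x : R) : exists m, (m < x)%R /\ forall s, In s p -> (m < pos s)%R.
Proof.
induction p as [|s p [m [mx H]]]; [exists (x - 1)%R; split; [lra|intros s []]|].
exists (Rmin m (pos s - 1)); split; [apply Rle_lt_trans with m; [apply Rmin_l|exact mx]|].
intros t [<-|Ht].
- apply Rle_lt_trans with (pos s - 1)%R; [apply Rmin_r|lra].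
- apply Rle_lt_trans with m; [apply Rmin_l|now apply H].
Qed.

Lemma phi_far z p x : (forall s, In s p -> (pos s <= x)%R) -> phi z p x = RtoC (exp (- x / 2)).
Proof.
induction p as [|s p IH]; intros H.
- simpl; unfold waveC, wave; simpl; ring.
- simpl; destruct (Rlt_dec x (pos s)) as [L|_].
  + generalize (H s (or_introl eq_refl)); lra.
  + apply IH; intros t Ht; apply H; now right.
Qed.

Lemma phi_is_phi_plus z p : ordered p -> is_phi_plus p z (phi z p).
Proof.
intros S; destruct (phi_solves z p S) as [Cont [Der Jump]]; split; [split|].
- exact Cont.
- exists (dphi z p), (fun x => RtoC (1 / 4) * phi z p x); split.
  + intros x Hx; destruct (Der x Hx) as [D1 D2]; split; [exact D1|split; [exact D2|ring]].
  + intros s Hs; destruct (Jump s Hs) as [dl [dr [Hl [Hr E]]]]; exists dl, dr.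
    split; [exact Hl|split; [exact Hr|]].
    rewrite E; unfold jumpC; ring.
- destruct (upper_bound p) as [M HM]; exists M; intros x Hx.
  apply phi_far; intros s Hs; generalize (HM s Hs); lra.
Qed.

Lemma wave_right_inj (A B A' B' : C) (x y : R) : (x < y)%R ->
  (forall t, (x < t < y)%R -> wave A B t = wave A' B' t /\ dwave A B t = dwave A' B' t) ->
  A = A' /\ B = B'.
Proof.
intros xy H; pose (t := ((x + y) / 2)%R).
destruct (H t ltac:(unfold t; lra)) as [E1 E2].
destruct (proj1 (match_iff A B A' B' 0 t)) as [EA EB].
- split; [exact E1|rewrite E2; ring].
- split; [rewrite EA; ring|rewrite EB; ring].
Qed.

Lemma limit_unique (g : R -> C) (F : (R -> Prop) -> Prop) {FF : ProperFilter F} (a b : C) :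
  filterlim g F (locally a) -> filterlim g F (locally b) -> a = b.
Proof.
intros Ha Hb.
exact (filterlim_locally_unique (V := C_R_NormedModule) (F := F) g a b Ha Hb).
Qed.

(** The solution is determined from right to left: by [general_solution] on the interval between two
atoms, and by [match_iff] across an atom. *)
Lemma solution_unique z (q : config) (f f1 f2 : R -> C) (m : R) (al : C) :
  ordered q -> (forall s, In s q -> (m < pos s)%R) ->
  (forall x : R, continuous f x) ->
  (forall x, (m < x)%R -> ~ In x (map pos q) ->
     is_cderive f x (f1 x) /\ is_cderive f1 x (f2 x) /\ - f2 x + RtoC (1 / 4) * f x = 0) ->
  (forall s, In s q -> exists dl dr : C,
     filterlim f1 (at_left (pos s)) (locally dl) /\
     filterlim f1 (at_right (pos s)) (locally dr) /\
     dl = dr + jumpC z s * f (pos s)) ->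
  (exists M, forall x, (M < x)%R -> f x = al * RtoC (exp (- x / 2))) ->
  forall x, (m < x)%R -> f x = al * phi z q x /\
    (~ In x (map pos q) -> f1 x = al * dphi z q x).
Proof.
revert m; induction q as [|s q IH]; intros m S Hm Cont Der Jump Far.
- destruct (general_solution f f1 f2 m p_infty) as [A [B H]]; [|exact I|].
  { intros x mx _; apply Der; auto. }
  destruct Far as [M HM].
  (* [f1] is only known to be the derivative of [f], so [f1] too must be compared with [wave al 0]. *)
  assert (A = al /\ B = 0) as [-> ->].
  { pose (y := Rmax m M).
    assert (my : (m <= y)%R) by apply Rmax_l; assert (My : (M <= y)%R) by apply Rmax_r.
    destruct (general_solution f (dwave al 0) (wave (al / RtoC 4) 0) y p_infty) as [A' [B' H']]; [|exact I|].
    { intros x yx _; split; [|split].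
      - apply (is_derive_ext_loc (V := C_R_NormedModule) (wave al 0)); [|apply is_cderive_wave].
        generalize (locally_between x y (x + 1) ltac:(lra)); apply filter_imp.
        intros t Ht; rewrite HM by lra; apply wave_decaying.
      - assert (E : RtoC (1 / 4) * wave al 0 x = wave (al / RtoC 4) 0 x).
        { unfold wave; apply injective_projections; simpl; field. }
        rewrite <- E; apply is_cderive_dwave.
      - rewrite HM by lra; unfold wave; apply injective_projections; simpl; field. }
    apply (wave_right_inj A B al 0 y (y + 1)); [lra|].
    intros t Ht; destruct (H t ltac:(lra) I) as [E1 E2].
    assert (E3 : f t = wave al 0 t) by (rewrite HM by lra; unfold wave; ring).
    rewrite <- E1, <- E2; split; [exact E3|].
    destruct (Der t ltac:(lra) ltac:(auto)) as [D1 _].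
    assert (D1' : is_cderive f t (dwave al 0 t)).
    { apply (is_derive_ext_loc (V := C_R_NormedModule) (wave al 0)); [|apply is_cderive_wave].
      generalize (locally_between t y (t + 1) ltac:(lra)); apply filter_imp.
      intros u Hu; rewrite HM by lra; apply wave_decaying. }
    apply injective_projections.
    - rewrite <- (is_derive_unique _ _ _ (is_cderive_fst _ _ _ D1)).
      exact (is_derive_unique _ _ _ (is_cderive_fst _ _ _ D1')).
    - rewrite <- (is_derive_unique _ _ _ (is_cderive_snd _ _ _ D1)).
      exact (is_derive_unique _ _ _ (is_cderive_snd _ _ _ D1')). }
  intros x mx; destruct (H x mx I) as [E1 E2]; split; [rewrite E1|intros _; rewrite E2];
  simpl; unfold waveC, dwaveC, wave, dwave; simpl; apply injective_projections; simpl; field.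
- destruct (ordered_inv _ _ S) as [S' H].
  assert (IH' : forall x, (pos s < x)%R -> f x = al * phi z q x /\
    (~ In x (map pos q) -> f1 x = al * dphi z q x)).
  { assert (ms := Hm s (or_introl eq_refl)).
    apply IH; auto.
    - intros x sx Hx; apply Der; [lra|]; simpl; intros [E|E]; [lra|auto].
    - intros t Ht; apply Jump; now right. }
  destruct (ordered_gap q (pos s) S' H) as [y [sy yq]].
  set (A' := al * fst (coefC z q)); set (B' := al * snd (coefC z q)).
  assert (right : forall x, (pos s < x < y)%R -> f x = wave A' B' x /\ f1 x = dwave A' B' x).
  { intros x Hx; destruct (IH' x ltac:(lra)) as [E1 E2].
    assert (Hq : forall t, In t q -> (x < pos t)%R) by (intros t Ht; generalize (yq t Ht); lra).
    rewrite E1, E2, (phi_left z q x Hq), (dphi_left z q x Hq).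
    - unfold waveC, dwaveC, wave, dwave, A', B'; split; apply injective_projections; simpl; field.
    - intros K; apply in_map_iff in K; destruct K as [t [Et Ht]]; generalize (Hq t Ht); lra. }
  assert (ms := Hm s (or_introl eq_refl)).
  destruct (general_solution f f1 f2 m (pos s)) as [A [B HAB]]; [|exact ms|].
  { intros x mx xs; simpl in xs; apply Der; auto; simpl; intros [E|E]; [lra|].
    apply in_map_iff in E; destruct E as [t [Et Ht]]; generalize (H t Ht); lra. }
  destruct (Jump s (or_introl eq_refl)) as [dl [dr [Hl [Hr E]]]].
  assert (fl : f (pos s) = wave A B (pos s)).
  { apply (limit_unique f (at_left (pos s))).
    - eapply filterlim_filter_le_1; [|exact (Cont (pos s))]; apply filter_le_within.
    - apply (filterlim_left f (wave A B) (pos s) m ms); [|apply continuous_wave].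
      intros t Ht; apply HAB; simpl; lra. }
  assert (fr : f (pos s) = wave A' B' (pos s)).
  { apply (limit_unique f (at_right (pos s))).
    - eapply filterlim_filter_le_1; [|exact (Cont (pos s))]; apply filter_le_within.
    - apply (filterlim_right f (wave A' B') (pos s) y sy); [|apply continuous_wave].
      intros t Ht; apply right; lra. }
  assert (El : dl = dwave A B (pos s)).
  { apply (limit_unique f1 (at_left (pos s))); [exact Hl|].
    apply (filterlim_left f1 (dwave A B) (pos s) m ms); [|apply continuous_dwave].
    intros t Ht; apply HAB; simpl; lra. }
  assert (Er : dr = dwave A' B' (pos s)).
  { apply (limit_unique f1 (at_right (pos s))); [exact Hr|].
    apply (filterlim_right f1 (dwave A' B') (pos s) y sy); [|apply continuous_dwave].
    intros t Ht; apply right; lra. }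
  destruct (proj1 (match_iff A B A' B' (jumpC z s) (pos s))) as [EA EB].
  { split; [now rewrite <- fl|]. rewrite <- El, <- Er, <- fr; exact E. }
  intros x mx; simpl; destruct (Rlt_dec x (pos s)) as [L|n].
  + destruct (HAB x mx L) as [E1 E2]; split; [rewrite E1|intros _; rewrite E2];
    rewrite EA, EB; unfold A', B', waveC, dwaveC, wave, dwave; simpl fst; simpl snd;
    field; exact RtoC2_neq0.
  + destruct (Rle_lt_or_eq_dec (pos s) x ltac:(lra)) as [G|G].
    * destruct (IH' x G) as [E1 E2]; split; [exact E1|].
      intros K; apply E2; intros K'; apply K; now right.
    * split; [|intros K; exfalso; apply K; now left].
      subst x; rewrite fr, (phi_left z q (pos s)) by exact H.
      unfold A', B', waveC, wave; ring.
Qed.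

Lemma solution_is_multiple p z f al : ordered p -> is_solution p z f ->
  (exists M, forall x, (M < x)%R -> f x = al * RtoC (exp (- x / 2))) ->
  forall x, f x = al * phi z p x.
Proof.
intros S [Cont [f1 [f2 [Der Jump]]]] Far x.
destruct (lower_bound p x) as [m [mx Hm]].
refine (proj1 (solution_unique z p f f1 f2 m al S Hm Cont _ _ Far x mx)).
- intros y _ Hy; apply Der, Hy.
- intros s Hs; destruct (Jump s Hs) as [dl [dr [Hl [Hr E]]]]; exists dl, dr.
  split; [exact Hl|split; [exact Hr|]].
  rewrite E; unfold jumpC; ring.
Qed.

Lemma phi_plus_unique p z f : ordered p -> is_phi_plus p z f -> forall x, f x = phi z p x.
Proof.
intros S [Sol [M HM]] x.
rewrite (solution_is_multiple p z f 1 S Sol); [ring|].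
exists M; intros y Hy; rewrite HM by exact Hy; ring.
Qed.

Lemma exp_half_unbounded (K M m : R) : (0 <= K)%R ->
  (forall x, (m < x)%R -> (K * exp (x / 2) <= M)%R) -> K = 0%R.
Proof.
intros K0 H; destruct K0 as [K0|]; [exfalso|auto].
pose (x := (2 * (Rabs m + Rabs M / K + 1))%R).
assert (a1 := Rabs_pos m); assert (a2 := Rabs_pos M); assert (a3 := Rle_abs m); assert (a4 := Rle_abs M).
assert (0 <= Rabs M / K)%R by (apply Rmult_le_pos; [auto|left; now apply Rinv_0_lt_compat]).
assert (mx : (m < x)%R) by (unfold x; lra).
specialize (H x mx).
assert (E : (x / 2 = Rabs m + Rabs M / K + 1)%R) by (unfold x; field; lra).
assert (e := exp_ineq1_le (x / 2)).
assert (K * (1 + x / 2) <= M)%R by (eapply Rle_trans; [|exact H]; apply Rmult_le_compat_l; lra).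
assert (K * (Rabs M / K) = Rabs M)%R by (field; lra).
nra.
Qed.

Lemma Cmod_expmul (A : C) (x : R) : Cmod (A * RtoC (exp x)) = (Cmod A * exp x)%R.
Proof.
rewrite Cmod_mult, Cmod_R, Rabs_pos_eq; [reflexivity|left; apply exp_pos].
Qed.

Lemma bounded_right_wave (A B : C) (m M : R) :
  (forall x, (m < x)%R -> (Cmod (wave A B x) <= M)%R) -> B = 0.
Proof.
intros H; apply Cmod_eq_0.
apply (exp_half_unbounded _ (M + Cmod A) (Rmax m 0)); [apply Cmod_ge_0|].
intros x Hx.
assert (mx : (m < x)%R) by (eapply Rle_lt_trans; [apply Rmax_l|exact Hx]).
assert (x0 : (0 < x)%R) by (eapply Rle_lt_trans; [apply Rmax_r|exact Hx]).
rewrite <- Cmod_expmul.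
replace (B * RtoC (exp (x / 2))) with (wave A B x + - (A * RtoC (exp (- x / 2)))) by (unfold wave; ring).
eapply Rle_trans; [apply Cmod_triangle|].
apply Rplus_le_compat; [now apply H|].
rewrite Cmod_opp, Cmod_expmul.
rewrite <- (Rmult_1_r (Cmod A)) at 2; apply Rmult_le_compat_l; [apply Cmod_ge_0|].
rewrite <- exp_0; left; apply exp_increasing; lra.
Qed.

Lemma wave_flip (A B : C) x : wave A B (- x) = wave B A x.
Proof. unfold wave; rewrite Ropp_involutive; ring. Qed.

Lemma bounded_left_wave (A B : C) (m M : R) :
  (forall x, (x < m)%R -> (Cmod (wave A B x) <= M)%R) -> A = 0.
Proof.
intros H; apply (bounded_right_wave B A (- m) M).
intros x Hx; rewrite <- wave_flip; apply H; lra.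
Qed.

Lemma Cmod_wave_le (A B : C) (m M x : R) : (m <= x <= M)%R ->
  (Cmod (wave A B x) <= Cmod A * exp (- m / 2) + Cmod B * exp (M / 2))%R.
Proof.
intros H; unfold wave; eapply Rle_trans; [apply Cmod_triangle|].
rewrite !Cmod_expmul.
apply Rplus_le_compat; apply Rmult_le_compat_l; try apply Cmod_ge_0.
- destruct (Rle_lt_or_eq_dec m x ltac:(lra)) as [L| ->]; [|lra].
  left; apply exp_increasing; lra.
- destruct (Rle_lt_or_eq_dec x M ltac:(lra)) as [L| ->]; [|lra].
  left; apply exp_increasing; lra.
Qed.

Lemma phi_bounded_right z p m : exists M, forall x, (m <= x)%R -> (Cmod (phi z p x) <= M)%R.
Proof.
induction p as [|s p [M IH]].
- exists (exp (- m / 2)); intros x Hx.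
  rewrite phi_far by (intros s []).
  rewrite Cmod_R, Rabs_pos_eq by (left; apply exp_pos).
  destruct (Rle_lt_or_eq_dec m x Hx) as [L| ->]; [|lra].
  left; apply exp_increasing; lra.
- set (K := (Cmod (fst (coefC z (s :: p))) * exp (- m / 2) + Cmod (snd (coefC z (s :: p))) * exp (pos s / 2))%R).
  exists (Rmax M K); intros x Hx; simpl; destruct (Rlt_dec x (pos s)).
  + eapply Rle_trans; [|apply Rmax_r]; apply Cmod_wave_le; lra.
  + eapply Rle_trans; [|apply Rmax_l]; now apply IH.
Qed.

(** A bounded solution is a multiple of phi_+, whose coefficient at the growing exponential must vanish
near minus infinity. *)
Lemma eigenvalue_iff p z : ordered p -> is_eigenvalue p z <-> fst (coefC z p) = 0.
Proof.
intros S; split.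
- intros [f [Sol [[x0 nz] [M HM]]]].
  destruct (upper_bound p) as [u Hu].
  assert (exists al, exists M, forall x, (M < x)%R -> f x = al * RtoC (exp (- x / 2))) as [al Far].
  { destruct Sol as [Cont [f1 [f2 [Der Jump]]]].
    destruct (general_solution f f1 f2 u p_infty) as [A [B H]]; [|exact I|].
    { intros x ux _; apply Der; intros K; apply in_map_iff in K.
      destruct K as [t [Et Ht]]; generalize (Hu t Ht); lra. }
    assert (B = 0) as ->.
    { apply (bounded_right_wave A B u M); intros x ux.
      rewrite <- (proj1 (H x ux I)); apply HM. }
    exists A, u; intros x ux; rewrite (proj1 (H x ux I)); unfold wave; ring. }
  assert (E := solution_is_multiple p z f al S Sol Far).
  destruct (lower_bound p 0) as [m [_ Hm]].
  assert (al0 : al <> 0) by (intros ->; apply nz; rewrite E; ring).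
  destruct (Ceq_dec (fst (coefC z p)) 0) as [|n]; [auto|].
  exfalso; apply (Cmult_neq_0 _ _ al0 n).
  apply (bounded_left_wave _ (al * snd (coefC z p)) m M).
  intros x xm.
  replace (wave (al * fst (coefC z p)) (al * snd (coefC z p)) x) with (f x); [apply HM|].
  rewrite E, phi_left.
  + unfold waveC, wave; ring.
  + intros s Hs; generalize (Hm s Hs); lra.
- intros A0; exists (phi z p).
  destruct (phi_is_phi_plus z p S) as [Sol [u Hu]].
  split; [exact Sol|split].
  + exists (u + 1)%R; rewrite Hu by lra; intros K; apply RtoC_inj in K.
    generalize (exp_pos (- (u + 1) / 2)); lra.
  + destruct (lower_bound p 0) as [m [_ Hm]].
    destruct (phi_bounded_right z p m) as [M HM].
    exists (Rmax M (Cmod (snd (coefC z p)) * exp (m / 2))); intros x.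
    destruct (Rle_dec m x) as [L|n].
    * eapply Rle_trans; [|apply Rmax_l]; now apply HM.
    * eapply Rle_trans; [|apply Rmax_r].
      rewrite phi_left by (intros s Hs; generalize (Hm s Hs); lra).
      unfold waveC; rewrite A0.
      eapply Rle_trans; [apply (Cmod_wave_le _ _ x m); lra|].
      rewrite Cmod_0; lra.
Qed.

(** In the division by zero occurring for [E <= 0] the quotient is 0, which [c <> 0] excludes. *)
Lemma normalization_iff (v c E : R) : c <> 0%R ->
  RtoC c = RtoC v / RtoC (sqrt E) <-> (0 < E /\ c * c * E = v * v /\ 0 < c * v)%R.
Proof.
intros c0; split.
- intros H; destruct (Rle_lt_dec E 0) as [L|L].
  + exfalso; apply c0; rewrite (sqrt_neg_0 E L) in H.
    apply (f_equal fst) in H; simpl in H; rewrite H; unfold Rdiv; ring.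
  + assert (d0 := sqrt_lt_R0 E L); assert (dE := sqrt_sqrt E (Rlt_le _ _ L)).
    rewrite <- RtoC_div in H by lra; apply RtoC_inj in H.
    assert (Hv : v = (c * sqrt E)%R) by (rewrite H; field; lra).
    split; [exact L|split].
    * rewrite <- dE, Hv; ring.
    * rewrite Hv; assert (0 < c * c)%R by nra; nra.
- intros [L [H1 H2]].
  assert (d0 := sqrt_lt_R0 E L); assert (dE := sqrt_sqrt E (Rlt_le _ _ L)).
  rewrite <- RtoC_div by lra; f_equal.
  assert (Hv : v = (c * sqrt E)%R).
  { assert (K : ((v - c * sqrt E) * (v + c * sqrt E) = 0)%R).
    { transitivity (v * v - c * c * (sqrt E * sqrt E))%R; [ring|rewrite dE, H1; ring]. }
    destruct (Rmult_integral _ _ K) as [K1|K1]; [lra|exfalso].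
    assert (v = - (c * sqrt E))%R by lra; subst v.
    assert (0 < c * c)%R by nra; nra. }
  rewrite Hv; field; lra.
Qed.

End Ode.

(** * Coefficient polynomials of a configuration *)

Module Configurations.
Import Reals Lra List Sorted.
Import all_boot all_order all_algebra Rstruct complex ring lra zify.
Import Order.TTheory GRing.Theory Num.Theory.
Import Herglotz Defs.
Local Open Scope ring_scope.
Set Implicit Arguments.
Unset Strict Implicit.

(* arguments of [exp] are read with the field operations of the algebraic hierarchy *)
Local Arguments exp x%_ring_scope.
Local Arguments ln x%_ring_scope.
Local Arguments Atom (pos w_omega w_v)%_ring_scope.

Implicit Types (p l r : config) (s : atom) (a x y : R).

Definition jump s : {poly R} := w_omega s *: 'X + w_v s *: 'X^2.

(** The real polynomials in the spectral parameter [z] with values [coefC z p]. *)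
Fixpoint coef p : {poly R} * {poly R} :=
  match p with
  | nil => (1, 0)
  | s :: p' =>
      let AB := coef p' in
      let U := AB.1 + (exp (pos s))%:P * AB.2 in
      (AB.1 - jump s * U, AB.2 + (exp (- pos s))%:P * (jump s * U))
  end.

(** [e^(a/2)] times the value at [a] of phi_+, for a point [a] to the left of [p]. *)
Definition value a p : {poly R} := (coef p).1 + (exp a)%:P * (coef p).2.

Definition genuine s := 0 <= w_v s /\ (w_omega s != 0 \/ w_v s != 0).

Fixpoint beyond a p : Prop :=
  match p with
  | nil => True
  | s :: p' => a < pos s /\ genuine s /\ beyond (pos s) p'
  end.

Lemma expRD x y : exp (x + y) = exp x * exp y.
Proof. exact: exp_plus. Qed.

Lemma expR0 : exp 0 = 1.
Proof. exact: exp_0. Qed.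

Lemma expR_gt0 x : 0 < exp x.
Proof. apply/RltP; exact: exp_pos. Qed.

Lemma expRN_mulC x : ((exp (- x))%:P * (exp x)%:P : {poly R}) = 1.
Proof. by rewrite -polyCM -expRD addNr expR0. Qed.

Lemma value_at_atom s p : value (pos s) (s :: p) = value (pos s) p.
Proof.
rewrite /value /=; have := expRN_mulC (pos s).
set u := (exp (- _))%:P; set v := (exp _)%:P => uv.
by rewrite [v * ((coef p).2 + _)]mulrDr [v * (u * _)]mulrA (mulrC v u) uv mul1r; ring.
Qed.

Lemma value_shift a x p :
  value a p = exp (a - x) *: value x p + (1 - exp (a - x)) *: (coef p).1.
Proof.
rewrite /value -!mul_polyC rmorphB rmorph1 /=.
rewrite {1}(_ : exp a = exp (a - x) * exp x); last by rewrite -expRD subrK.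
rewrite rmorphM /=; ring.
Qed.

Lemma value_cons a s p : value a (s :: p) =
  exp (a - pos s) *: value (pos s) p + (1 - exp (a - pos s)) *: (coef (s :: p)).1.
Proof. by rewrite (value_shift a (pos s)) value_at_atom. Qed.

Lemma coef1_cons s p : (coef (s :: p)).1 = (coef p).1 - jump s * value (pos s) p.
Proof. by []. Qed.

Lemma ratio_bounds a x : a < x -> 0 < exp (a - x) < 1.
Proof.
move=> ax; rewrite expR_gt0 /= -expR0; apply/RltP; apply: exp_increasing.
by apply/RltP; rewrite subr_lt0.
Qed.

Lemma coef_admissible a p : beyond a p -> admissible (value a p) (coef p).1.
Proof.
elim: p a => [|s p IH] a /=.
  move=> _; rewrite /value /= mulr0 addr0; split; rewrite ?hornerC //.
  by exists [::]; split=> //; rewrite lead_coef1 scale1r /roots_prod big_nil.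
case=> ax [[v0 wv] /IH adm]; rewrite value_cons coef1_cons.
exact: admissible_step adm (ratio_bounds ax) v0 wv.
Qed.

Lemma size_coef_cons a s p : beyond a (s :: p) ->
  (size (value (pos s) p) < size (coef (s :: p)).1)%N.
Proof.
case=> ax [[v0 wv] /coef_admissible adm]; rewrite coef1_cons.
by apply: size_cross => //; [exact: admissible_neq0 adm | case: adm].
Qed.

Lemma size_lead_value_cons a s p : beyond a (s :: p) ->
  size (value a (s :: p)) = size (coef (s :: p)).1 /\
  lead_coef (value a (s :: p)) = (1 - exp (a - pos s)) * lead_coef (coef (s :: p)).1.
Proof.
move=> b; have sz := size_coef_cons b; case: (b) => ax _.
have /andP[r0 r1] := ratio_bounds ax; rewrite value_cons.
have n0 : 1 - exp (a - pos s) != 0 by rewrite subr_eq0 gt_eqF.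
have sl : (size (exp (a - pos s) *: value (pos s) p)%R <
           size ((1 - exp (a - pos s)) *: (coef (s :: p)).1)%R)%N.
  by rewrite (size_scale _ n0) (size_scale _ (lt0r_neq0 r0)).
by rewrite addrC size_polyDl // lead_coefDl // lead_coefZ (size_scale _ n0).
Qed.

(** The distance from [a] to the first atom is read off from the leading coefficients, and its weights
are unique because changing them would raise the degree of the coefficient behind the atom above that of the
value at the atom. *)
Lemma coef_inj a p p' : beyond a p -> beyond a p' ->
  (coef p).1 = (coef p').1 -> value a p = value a p' -> p = p'.
Proof.
have nil_cons s q b : beyond b (s :: q) -> (coef (s :: q)).1 != 1.
  move=> bq; apply: contraTneq (size_coef_cons bq) => ->.
  rewrite size_poly1 ltnS leqn0 size_poly_eq0.
  by case: bq => _ [_ /coef_admissible/admissible_neq0].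
elim: p a p' => [|s p IH] a [|s' p'] //.
- by move=> _ b' /esym E; have := nil_cons _ _ _ b'; rewrite E eqxx.
- by move=> b _ E; have := nil_cons _ _ _ b; rewrite E eqxx.
move=> b b' EA EU.
have E2 : (coef (s :: p)).2 = (coef (s' :: p')).2.
  move: EU; rewrite /value EA => /addrI /(congr1 (fun P => (exp (- a))%:P * P)).
  by rewrite !mulrA !expRN_mulC !mul1r.
have EV x : value x (s :: p) = value x (s' :: p') by rewrite /value EA E2.
have Epos : pos s = pos s'.
  have [_] := size_lead_value_cons b; have [_] := size_lead_value_cons b'.
  rewrite EV EA => -> /mulIf; have : lead_coef (coef (s' :: p')).1 != 0.
    rewrite lead_coef_eq0; apply: contraTneq (size_coef_cons b') => ->.
    by rewrite size_poly0 ltn0.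
  move=> n0 /(_ n0) /addrI /oppr_inj /exp_inv E.
  by have /addrI/oppr_inj := E.
have EV1 : value (pos s) p = value (pos s) p'.
  by rewrite -value_at_atom EV Epos value_at_atom.
case: b b' => ax [gs bp] [ax' [gs' bp']]; rewrite -Epos in bp'.
have adm := coef_admissible bp; have adm' := coef_admissible bp'.
have EA1 : (coef p).1 = (coef p').1 -
   ((w_omega s' - w_omega s) *: 'X + (w_v s' - w_v s) *: 'X^2) * value (pos s) p.
  move: EA; rewrite !coef1_cons -Epos -EV1 => /eqP; rewrite subr_eq => /eqP->.
  rewrite /jump -!mul_polyC !rmorphB /=; ring.
have [dw dv] : w_omega s' - w_omega s = 0 /\ w_v s' - w_v s = 0.
  have [dw|dw] := eqVneq (w_omega s' - w_omega s) 0; last first.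
    have := @size_cross _ (value (pos s) p) (coef p').1 _ (w_v s' - w_v s)
      (admissible_neq0 adm) _ (or_introl dw).
    rewrite -EA1 => H; exfalso; move: H; rewrite {1}EV1.
    case: adm' => _ _ -> _ /(_ isT); case: adm => _ _ sz _.
    by rewrite ltnNge sz.
  have [dv|dv] := eqVneq (w_v s' - w_v s) 0; first by [].
  have := @size_cross _ (value (pos s) p) (coef p').1 (w_omega s' - w_omega s) _
      (admissible_neq0 adm) _ (or_intror dv).
  rewrite -EA1 => H; exfalso; move: H; rewrite {1}EV1.
  case: adm' => _ _ -> _ /(_ isT); case: adm => _ _ sz _.
  by rewrite ltnNge sz.
have -> : p = p'.
  apply: (IH (pos s)) => //.
  by rewrite EA1 dw dv !scale0r addr0 mul0r subr0.
move/eqP: dw; rewrite subr_eq0 => /eqP dw; move/eqP: dv; rewrite subr_eq0 => /eqP dv.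
by congr cons; case: s s' Epos dw dv {EA EU E2 EV EV1 ax gs bp ax' gs' bp' adm adm' EA1} => ? ? ? [? ? ?] /= -> -> ->.
Qed.

(** The continued fraction terminates since each step lowers the degree. *)
Lemma coef_surj U A a : admissible U A ->
  exists p, [/\ beyond a p, (coef p).1 = A & value a p = U].
Proof.
have [n] := ubnP (size U); elim: n U A a => // n IH U A a /ltnSE sU adm.
have [sU1|sU1] := leqP (size U) 1.
  have [U0 A0 sA _] := adm; exists [::].
  have EU : U = 1 by rewrite (size1_polyC sU1) -horner_coef0 U0.
  have EA : A = 1 by rewrite (size1_polyC (leq_trans sA sU1)) -horner_coef0 A0.
  by rewrite EU EA /value /= mulr0 addr0.
have [rho [w [v [U1 [[/andP[r0 r1] v0 wv] sUU UE adm1]]]]] := admissible_peel adm sU1.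
pose x := a - ln rho.
have Erho : exp (a - x) = rho.
  by rewrite /x opprB addrC subrK; apply: exp_ln; apply/RltP.
have [p [bp E1 EV]] := IH _ _ x (leq_trans sUU sU) adm1.
exists (Atom x w v :: p).
have EA : (coef (Atom x w v :: p)).1 = A.
  by rewrite coef1_cons E1 EV /jump /= addrK.
split=> //.
  split; [|by []].
  rewrite /= /x ltrDl oppr_gt0; apply/RltP.
  have /RltP r0' := r0; have /RltP r1' := r1.
  by have := ln_increasing _ _ r0' r1'; rewrite ln_1.
by rewrite value_cons EA /= EV Erho.
Qed.

Definition mirror s := Atom (- pos s) (w_omega s) (w_v s).
(** Under [x -> - x] the solution decaying at minus infinity becomes phi_+, so that one theory of
half-lines serves both sides of [a]. *)
Definition mirrored p := List.rev (List.map mirror p).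

(** The Wronskian of phi_+ and phi_- is constant between the atoms. *)
Lemma coef_app l r : (coef (l ++ r)%list).1 =
  (coef (mirrored l)).1 * (coef r).1 - (coef (mirrored l)).2 * (coef r).2.
Proof.
elim/rev_ind: l r => [|s l IH] r; first by rewrite /= mul1r mul0r subr0.
rewrite -app_assoc IH /mirrored map_app rev_app_distr /= -/(mirrored l).
rewrite opprK.
have -> : jump (mirror s) = jump s by [].
ring.
Qed.

(** As a function of the eigenvalue this is [gamma2], see [gamma2_energy]. *)
Fixpoint energy p : {poly R} :=
  match p with
  | nil => 0
  | s :: p' => energy p' + (exp (- pos s))%:P * ((jump s)^`() * value (pos s) p' ^+ 2)
  end.

(** Lagrange identity: the Wronskian of phi_+ and its derivative in the spectral parameter jumps at each
atom. *)
Lemma wronskian_energy p :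
  (coef p).1^`() * (coef p).2 - (coef p).1 * (coef p).2^`() = - energy p.
Proof.
elim: p => [|s p IH]; first by rewrite /= mulr0 deriv0 mulr0 subrr oppr0.
rewrite /= -/(value (pos s) p); move: (jump s) => q; rewrite opprD -IH !derivB !derivD !derivM !derivC mul0r add0r.
have dU : (value (pos s) p)^`() = (coef p).1^`() + (exp (pos s))%:P * (coef p).2^`().
  by rewrite /value derivD derivM derivC mul0r add0r.
set U' := (value _ _)^`() in dU *.
have EU : value (pos s) p = (coef p).1 + (exp (pos s))%:P * (coef p).2 by [].
set U := value _ _ in EU *.
have := expRN_mulC (pos s).
move: dU EU; set u := (exp (- _))%:P; set v := (exp _)%:P.
set A := (coef p).1; set B := (coef p).2; set A' := A^`(); set B' := B^`().
move=> EU' EU uv.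
have EB : B = u * (U - A) by rewrite EU addrC addKr mulrA uv mul1r.
have EB' : B' = u * (U' - A') by rewrite EU' addrC addKr mulrA uv mul1r.
rewrite EB' EB; ring.
Qed.

(** At an eigenvalue phi_+ is a multiple of phi_-, the factor being the coefficient of [e^(x/2)] near
minus infinity. *)
Lemma coef_at_root l r x : root (coef (l ++ r)%list).1 x ->
  (coef r).1.[x] = (coef (l ++ r)%list).2.[x] * (coef (mirrored l)).2.[x] /\
  (coef r).2.[x] = (coef (l ++ r)%list).2.[x] * (coef (mirrored l)).1.[x].
Proof.
move=> Wx; elim/rev_ind: l r Wx => [|s l IH] r.
  by move=> /rootP /= ->; rewrite hornerC mulr0 hornerC mulr1.
rewrite -app_assoc => /IH /= [E1 E2].
rewrite /mirrored map_app rev_app_distr /= -/(mirrored l).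
have -> : jump (mirror s) = jump s by []. 
set K := (coef (l ++ s :: r)%list).2.[x] in E1 E2 *.
move: E1 E2; rewrite opprK; move: (jump s) => j.
rewrite !(hornerD, hornerN, hornerM, hornerC).
have := congr1 (fun P : {poly R} => P.[x]) (expRN_mulC (pos s)); rewrite hornerM !hornerC.
set u := exp (- _); set v := exp _ => uv.
set A := (coef r).1.[x]; set B := (coef r).2.[x]; set q := j.[x].
set C := (coef (mirrored l)).1.[x]; set D := (coef (mirrored l)).2.[x].
move=> E1 E2.
have EU : A + v * B = K * D + v * (K * C).
  rewrite -E1 -E2.
  have -> : v * (B + u * (q * (A + v * B))) = v * B + (u * v) * (q * (A + v * B)) by ring.
  rewrite uv; ring.
have EA : A = K * D + q * (K * D + v * (K * C)) by rewrite -EU -E1; ring.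
have EB : B = K * C - u * (q * (K * D + v * (K * C))) by rewrite -EU -E2; ring.
split; [rewrite EA|rewrite EB].
  transitivity (K * (D + q * (v * C + (u * v) * D))); last by ring.
  rewrite uv; ring.
transitivity (K * C - q * (K * (u * D) + (u * v) * (K * C))); first ring.
rewrite uv; ring.
Qed.

Lemma value_at_root l r a x : root (coef (l ++ r)%list).1 x ->
  (value a r).[x] = exp a * ((coef (l ++ r)%list).2.[x] * (value (- a) (mirrored l)).[x]).
Proof.
move=> /coef_at_root[E1 E2]; rewrite /value !(hornerD, hornerM, hornerC) E1 E2.
have := congr1 (fun P : {poly R} => P.[x]) (expRN_mulC a); rewrite hornerM !hornerC => uv.
set K := (coef (l ++ r)%list).2.[x]; set D := (coef (mirrored l)).2.[x].
rewrite -[K * D]mul1r -uv; ring.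
Qed.

Lemma coef_app_value l r a : (coef (l ++ r)%list).1 =
  (coef (mirrored l)).1 * value a r + (coef r).1 * value (- a) (mirrored l)
  - value (- a) (mirrored l) * value a r.
Proof.
rewrite coef_app /value.
have := expRN_mulC a; set u := (exp (- _))%:P; set v := (exp _)%:P => uv.
set A := (coef _).1; set B := (coef _).2; set A' := (coef _).1; set B' := (coef _).2.
have -> : B * B' = (u * v) * (B * B') by rewrite uv mul1r.
ring.
Qed.

Definition lt_pos s s' : Prop := Rlt (pos s) (pos s').

Lemma sorted_app p r : StronglySorted lt_pos (p ++ r)%list <->
  [/\ StronglySorted lt_pos p, StronglySorted lt_pos r &
      forall s s', In s p -> In s' r -> lt_pos s s'].
Proof.
elim: p => [|s p IH] /=.
  split=> [H|[]//]; split=> //; exact: SSorted_nil.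
split.
  move=> H; inversion H as [|? ? H1 H2]; subst; move/IH: H1 => [S1 S2 S3].
  move/Forall_forall: H2 => H2; split=> //.
    apply: SSorted_cons => //; apply/Forall_forall => t tp; apply: H2.
    by apply: in_or_app; left.
  move=> t t' [<-|tp] t'r; last exact: S3.
  by apply: H2; apply: in_or_app; right.
case=> H S2 S3; inversion H as [|? ? H1 H2]; subst; apply: SSorted_cons.
  by apply/IH; split=> // t t' tp; apply: S3; right.
apply/Forall_forall => t tt; case: (in_app_or _ _ _ tt) => [tp|tr].
  by move/Forall_forall: H2; apply.
by apply: S3 => //; left.
Qed.

Lemma beyond_iff a p : beyond a p <->
  [/\ StronglySorted lt_pos p, forall s, In s p -> genuine s & forall s, In s p -> a < pos s].
Proof.
elim: p a => [|s p IH] a /=.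
  split=> // _; split=> //; exact: SSorted_nil.
split.
  case=> as_ [gs /IH[S G P]]; split.
  - apply: SSorted_cons; first exact: S.
    by apply/Forall_forall => t tp; apply/RltP; exact: P.
  - by move=> t [<-|/G].
  - by move=> t [<-//|/P]; apply: lt_trans.
case=> S G P; inversion S as [|? ? S1 S2]; subst.
split; first by apply: P; left.
split; first by apply: G; left.
apply/IH; split=> // [t tp|t tp]; first by apply: G; right.
by apply/RltP; move/Forall_forall: S2; apply.
Qed.

Lemma mirrorK s : mirror (mirror s) = s.
Proof. by case: s => x w v; rewrite /mirror /= opprK. Qed.

Lemma mirroredK p : mirrored (mirrored p) = p.
Proof.
rewrite /mirrored List.map_rev List.rev_involutive List.map_map -[RHS]List.map_id.
by apply: List.map_ext => s; rewrite mirrorK.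
Qed.

Lemma In_mirrored s p : In s (mirrored p) <-> In (mirror s) p.
Proof.
rewrite /mirrored -List.in_rev List.in_map_iff; split=> [[t [<- tp]]|sp]; first by rewrite mirrorK.
by exists (mirror s); rewrite mirrorK.
Qed.

Lemma sorted_mirrored p : StronglySorted lt_pos p -> StronglySorted lt_pos (mirrored p).
Proof.
elim: p => [|s p IH] /=; first by move=> _; exact: SSorted_nil.
move=> H; inversion H as [|? ? S1 S2]; subst.
rewrite /mirrored /= -/(mirrored p); apply/sorted_app; split; first exact: IH.
  by apply: SSorted_cons; [exact: SSorted_nil | exact: Forall_nil].
move=> t t' /In_mirrored tp [<-|//]; move/Forall_forall: S2 => /(_ _ tp) /RltP /=.
by rewrite /lt_pos => H1; apply/RltP; rewrite /= ltrNr.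
Qed.

Lemma genuineP s : (Rle 0 (w_v s) /\ Rlt 0 (Rplus (Rabs (w_omega s)) (w_v s))) <-> genuine s.
Proof.
have abs0 := Rabs_pos (w_omega s); split=> -[v0 wv]; split; try exact/RleP.
  have [w0|] := eqVneq (w_omega s) 0; last by left.
  right; apply/eqP => v1; move: wv; rewrite w0 v1 RabsE normr0.
  by move/RltP; rewrite RplusE addr0 ltxx.
move/RleP: v0 => v0; case: wv => [w0|v1].
  by apply: Rplus_lt_le_0_compat => //; apply: Rabs_pos_lt; apply/eqP.
apply: Rplus_le_lt_0_compat => //; apply/RltP.
by rewrite lt_neqAle eq_sym v1; apply/RleP.
Qed.

Lemma is_pairP p : is_pair p <->
  [/\ p <> nil, StronglySorted lt_pos p & forall s, In s p -> genuine s].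
Proof.
split.
  case=> ln [S H]; split=> //; first by move=> E; rewrite E in ln; inversion ln.
  by move=> s /H/genuineP.
case=> n S H; split; last by split=> // s /H/genuineP.
by case: p n {S H} => //= s p _; apply: le_n_S; apply: le_0_n.
Qed.

Lemma beyond_mirrored a p : beyond (- a) (mirrored p) <->
  [/\ StronglySorted lt_pos p, forall s, In s p -> genuine s & forall s, In s p -> pos s < a].
Proof.
rewrite beyond_iff; split=> -[S G P]; split.
- by rewrite -(mirroredK p); apply: sorted_mirrored.
- move=> s sp; have : genuine (mirror s) by apply: G; rewrite In_mirrored mirrorK.
  by [].
- move=> s sp; have /= : - a < pos (mirror s) by apply: P; rewrite In_mirrored mirrorK.
  by rewrite ltrN2.
- exact: sorted_mirrored.
- by move=> s /In_mirrored /G.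
- by move=> s /In_mirrored /P /=; rewrite ltrNl.
Qed.

(** The middle part [m] is an atom at [a] itself, if there is one. *)
Lemma split_at a p : is_pair p -> exists l m r,
  [/\ p = (l ++ m ++ r)%list, beyond (- a) (mirrored l), beyond a r &
      m = nil \/ exists s, [/\ m = [:: s], pos s = a & genuine s]].
Proof.
move=> /is_pairP[_ S G].
elim: p S G => [|s p IH] S G.
  by exists nil, nil, nil; split=> //; left.
inversion S as [|? ? S1 S2]; subst; move/Forall_forall: S2 => S2.
have G1 t : In t p -> genuine t by move=> tp; apply: G; right.
have Gs : genuine s by apply: G; left.
have S2' t : In t p -> pos s < pos t by move=> /S2/RltP.
case: (ltgtP (pos s) a) => sa.
- have [l [m [r [E bl br M]]]] := IH S1 G1.
  exists (s :: l), m, r; split=> //; first by rewrite E.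
  have lp t : In t l -> In t p by rewrite E => tl; apply: in_or_app; left.
  move/beyond_mirrored: bl => [Sl Gl Pl]; apply/beyond_mirrored; split.
  + by apply: SSorted_cons => //; apply/Forall_forall => t /lp /S2.
  + by move=> t [<-//|/Gl].
  + by move=> t [<-//|/Pl].
- exists nil, nil, (s :: p); split=> //; last by left.
  by split=> //; split=> //; apply/beyond_iff.
exists nil, [:: s], p; split=> //; last by right; exists s.
by rewrite -sa; apply/beyond_iff.
Qed.

End Configurations.

(** * Spectral data in terms of polynomials *)

Module Evaluation.
Import Reals Lra List Sorted.
Import all_boot all_order all_algebra Rstruct complex.
Import Order.TTheory GRing.Theory Num.Theory.
Import Herglotz Configurations Ode Defs.
Local Open Scope ring_scope.
Set Implicit Arguments.
Unset Strict Implicit.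
Local Notation CC := Coquelicot.Complex.C.
Local Arguments exp x%_ring_scope.

Lemma half_add (y : R) : Rplus (Rdiv y 2) (Rdiv y 2) = y.
Proof. by field. Qed.

Definition toC (z : R[i]) : CC := (complex.Re z, complex.Im z).
Definition ofC (z : CC) : R[i] := (fst z +i* snd z)%C.

Definition eval_complex (P : {poly R}) (z : CC) : CC := toC (map_poly (real_complex R) P).[ofC z].

Lemma toC_D u v : toC (u + v) = Cplus (toC u) (toC v).
Proof. by case: u v => a b [c d]. Qed.

Lemma toC_M u v : toC (u * v) = Cmult (toC u) (toC v).
Proof. by case: u v => a b [c d]. Qed.

Lemma toC_N u : toC (- u) = Copp (toC u).
Proof. by case: u => a b. Qed.

Lemma eval_complex_D P Q z : eval_complex (P + Q) z = Cplus (eval_complex P z) (eval_complex Q z).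
Proof. by rewrite /eval_complex rmorphD hornerD toC_D. Qed.

Lemma eval_complex_M P Q z : eval_complex (P * Q) z = Cmult (eval_complex P z) (eval_complex Q z).
Proof. by rewrite /eval_complex rmorphM hornerM toC_M. Qed.

Lemma eval_complex_N P z : eval_complex (- P) z = Copp (eval_complex P z).
Proof. by rewrite /eval_complex rmorphN hornerN toC_N. Qed.

Lemma eval_complex_C c z : eval_complex c%:P z = RtoC c.
Proof. by rewrite /eval_complex map_polyC hornerC. Qed.

Lemma eval_complex_X z : eval_complex 'X z = z.
Proof. by rewrite /eval_complex map_polyX hornerX /toC /=; case: z. Qed.

Lemma eval_complex_real P x : eval_complex P (RtoC x) = RtoC P.[x].
Proof. by rewrite /eval_complex -[ofC _]/(real_complex R x) horner_map. Qed.

Lemma eval_complex_jump s z : eval_complex (jump s) z = jumpC z s.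
Proof.
rewrite /jump /jumpC -!mul_polyC expr2 eval_complex_D !eval_complex_M !eval_complex_C !eval_complex_X.
ring.
Qed.

Lemma coefC_eval_complex z p : coefC z p = (eval_complex (coef p).1 z, eval_complex (coef p).2 z).
Proof.
elim: p => [|s p IH] /=; first by rewrite -polyC1 -polyC0 !eval_complex_C.
rewrite IH /=; set A := (coef p).1; set B := (coef p).2.
move: (jump s) (eval_complex_jump s z) => j <-.
by rewrite !(eval_complex_D, eval_complex_N, eval_complex_M, eval_complex_C).
Qed.

Lemma eval_complex_eq0 P z : eval_complex P z = RtoC 0 <-> root (map_poly (real_complex R) P) (ofC z).
Proof.
rewrite /eval_complex /root; set u := _.[_]; split=> [E|/eqP-> //].
by apply/eqP; case: u E => a b [-> ->].
Qed.

Lemma eigenvalue_root p z : ordered p ->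
  is_eigenvalue p z <-> root (map_poly (real_complex R) (coef p).1) (ofC z).
Proof. by move=> op; rewrite eigenvalue_iff // coefC_eval_complex eval_complex_eq0. Qed.

Lemma wave_value p x y :
  waveC (coefC (RtoC x) p) y = RtoC (exp (Rdiv (- y) 2) * (value y p).[x]).
Proof.
rewrite coefC_eval_complex /waveC /wave /= !eval_complex_real /value hornerD hornerM hornerC.
have -> : exp y = exp (Rdiv y 2) * exp (Rdiv y 2).
  by rewrite -expRD; rewrite -RplusE half_add.
have := expC_inv y; rewrite -RtoC_mult => /RtoC_inj E.
rewrite -!RtoC_mult -RtoC_plus; congr RtoC.
set u := exp (Rdiv (- y) 2) in E *; set v := exp (Rdiv y 2) in E *.
set A := _.[x]; set B := _.[x].
transitivity (Rplus (Rmult A u) (Rmult (Rmult (Rmult u v) v) B)).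
  rewrite E; ring.
rewrite -!RmultE -!RplusE; ring.
Qed.

Lemma phi_at_value p l r x a : p = (l ++ r)%list -> 
  (forall s, In s l -> pos s <= a) -> (forall s, In s r -> a < pos s) ->
  phi (RtoC x) p a = RtoC (exp (Rdiv (- a) 2) * (value a r).[x]).
Proof.
move=> -> + H2; elim: l => [|s l IH] H1.
  by rewrite /= phi_left ?wave_value // => s /H2/RltP.
rewrite [phi _ _ _]/=; case: Rlt_dec => [/RltP sa|_].
  by have := H1 s (or_introl erefl); rewrite leNgt sa.
by apply: IH => t tl; apply: H1; right.
Qed.

Lemma gamma2_cons s p x f : gamma2 (s :: p) x f =
  Rplus (Rmult (Rplus (w_omega s) (Rmult (Rmult 2 x) (w_v s))) (pow (Cmod (f (pos s))) 2))
   (gamma2 p x f).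
Proof. rewrite /gamma2 /int_omega /int_v /integral /=; ring. Qed.

Lemma gamma2_ext p x f g : (forall s, In s p -> f (pos s) = g (pos s)) ->
  gamma2 p x f = gamma2 p x g.
Proof.
elim: p => [|s p IH] H //; rewrite !gamma2_cons (H s (or_introl erefl)) IH //.
by move=> t tp; apply: H; right.
Qed.

Lemma deriv_jump_horner s x :
  (jump s)^`().[x] = Rplus (w_omega s) (Rmult (Rmult 2 x) (w_v s)).
Proof.
rewrite /jump derivD !derivZ derivX derivXn !hornerE /= -!RmultE -!RplusE.
ring.
Qed.

Lemma gamma2_energy p x : ordered p -> gamma2 p x (phi (RtoC x) p) = (energy p).[x].
Proof.
elim: p => [|s p IH] op.
  by rewrite /= horner0 /gamma2 /int_omega /int_v /integral /= Rmult_0_r Rplus_0_r.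
have [op' H] := ordered_inv s p op.
rewrite gamma2_cons [energy _]/= hornerD -IH //.
rewrite (@gamma2_ext p x _ (phi (RtoC x) p)); last first.
  move=> t tp; rewrite [LHS]/=; case: Rlt_dec => // ts.
  by have := Rlt_asym _ _ ts (H t tp).
rewrite [phi _ _ _]/=; case: Rlt_dec => [ss|_]; first by case: (Rlt_irrefl _ ss).
rewrite phi_left // wave_value Cmod_R !hornerM hornerC deriv_jump_horner.
set a := _.[x]; rewrite -RmultE.
have -> : exp (- pos s) = Rmult (exp (Rdiv (- pos s) 2)) (exp (Rdiv (- pos s) 2)).
  by rewrite RmultE -expRD; rewrite -RplusE half_add.
rewrite pow2_abs -!RmultE -!RplusE; ring.
Qed.
End Evaluation.

Module Spectrum.
Import Reals Lra List Sorted.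
Import all_boot all_order all_algebra Rstruct complex ring lra zify.
Import Order.TTheory GRing.Theory Num.Theory.
Import Herglotz Interlacing Configurations Ode Evaluation Defs.
Local Open Scope ring_scope.
Set Implicit Arguments.
Unset Strict Implicit.
Local Arguments exp x%_ring_scope.

(** The characteristic function has simple real roots by [admissible_cross] with [sigma = 0]; the sign
there says that [lambda gamma_lambda^2 > 0]. *)
Lemma full_spectrum p : is_pair p -> exists t, [/\ uniq t,
  (coef p).1 = lead_coef (coef p).1 *: roots_prod t &
  {in t, forall y, 0 < y * (energy p).[y]}].
Proof.
move=> /is_pairP[n S G]; case: p n S G => // s p _ S G.
have : beyond (pos s - 1) (s :: p).
  apply/beyond_iff; split=> // t [<-|tp]; first by rewrite ltrBlDr ltrDl.
  inversion S as [|? ? S1 S2]; subst; move/Forall_forall: S2 => /(_ _ tp) /RltP st.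
  by apply: lt_trans st; rewrite ltrBlDr ltrDl.
case=> _ [[v0 wv] /coef_admissible adm].
have [t [ut Et Pt]] := @admissible_cross _ _ _ 0 (w_omega s) (w_v s) adm (lexx 0) v0.
have EW : (coef (s :: p)).1 = 0 *: value (pos s) p + (coef p).1 -
   (w_omega s *: 'X + w_v s *: 'X^2) * value (pos s) p.
  by rewrite coef1_cons scale0r add0r.
rewrite -EW in Et Pt.
exists t; split=> // y yt; have := Pt y yt.
have Wy : (coef (s :: p)).1.[y] = 0.
  apply/rootP; rewrite Et rootZ ?root_roots_prod //.
  rewrite lead_coef_eq0; apply: contraTneq (Pt y yt) => ->.
  by rewrite derivC horner0 mulr0 ltxx.
rewrite -value_at_atom /value hornerD hornerM hornerC Wy add0r.
have := congr1 (fun P : {poly R} => P.[y]) (wronskian_energy (s :: p)).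
rewrite hornerD !hornerN !hornerM Wy mul0r subr0.
set W' := (_^`()).[y]; set B := (coef _).2.[y] => /esym/eqP.
rewrite eqr_oppLR => /eqP-> H.
have e0 := expR_gt0 (pos s).
rewrite -(pmulr_rgt0 _ e0) -oppr_lt0; move: H; congr (_ < 0); ring.
Qed.

Definition eigen_seq N (lam : nat -> R) := [seq lam i | i <- iota 1 N].

Lemma eigen_seqP N lam x : reflect (exists i, (1 <= i <= N)%N /\ x = lam i) (x \in eigen_seq N lam).
Proof.
apply: (iffP mapP) => [ [j]|[j [iN ->]]].
  by rewrite mem_iota add1n ltnS => iN ->; exists j.
by exists j => //; rewrite mem_iota add1n ltnS.
Qed.

Definition increasing N (lam : nat -> R) :=
  forall i j : nat, (1 <= i)%N -> (i < j)%N -> (j <= N)%N -> lam i < lam j.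

Lemma eigen_seq_uniq N lam : increasing N lam -> uniq (eigen_seq N lam).
Proof.
move=> inc; rewrite map_inj_in_uniq ?iota_uniq // => i j.
rewrite !mem_iota !add1n !ltnS => /andP[i1 iN] /andP[j1 jN] E.
by case: (ltngtP i j) => // ij; [have := inc i j i1 ij jN | have := inc j i j1 ij iN];
   rewrite E ltxx.
Qed.

Section Criterion.
Variables (a : R) (N : nat) (lam c : nat -> R).
Hypothesis c0 : forall i, (1 <= i <= N)%N -> c i != 0.

(** The data in terms of the polynomial [UL * UR].  At an eigenvalue [x] one has
[gamma2 = - W' B] and [UR = e^a B UL] with [B = (coef p).2], so that squaring the normalization
of the eigenfunction gives [UL UR = - x c^2 W']; what the square forgets is the sign of [c]. *)
Lemma data_criterion l r : is_pair (l ++ r)%list ->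
  (forall s, In s l -> pos s <= a) -> (forall s, In s r -> a < pos s) ->
  let W := (coef (l ++ r)%list).1 in
  let UR := value a r in let UL := value (- a) (mirrored l) in
  interior_spectral_data (l ++ r)%list a N lam c <->
  [/\ increasing N lam, 0 \notin eigen_seq N lam, W = unit_prod (eigen_seq N lam) &
      forall i, (1 <= i <= N)%N ->
        (UL * UR).[lam i] = - (lam i * c i ^+ 2 * W^`().[lam i]) /\ 0 < c i * UR.[lam i]].
Proof.
move=> pp Hl Hr W UR UL.
have op : ordered (l ++ r)%list by case: (pp) => _ [].
have [t [ut Wt Et]] := full_spectrum pp; rewrite -/W in Wt.
have W0 : W.[0] = 1.
  have [_ S G] := proj1 (is_pairP _) pp.
  have [m [_ Hm]] := lower_bound (l ++ r)%list 0.
  have /coef_admissible[] // : beyond m (l ++ r)%list.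
  by apply/beyond_iff; split=> // s /Hm /RltP.
have k0 : lead_coef W != 0.
  rewrite lead_coef_eq0; apply: contra_eq_neq W0 => ->.
  by rewrite horner0 eq_sym oner_eq0.
have t0 : 0 \notin t.
  by rewrite -root_roots_prod -(rootZ _ _ k0) -Wt /root W0 oner_eq0.
have WE : W = unit_prod t := eq_unit_prod Wt W0.
have eig z : is_eigenvalue (l ++ r)%list z <-> exists2 y, y \in t & z = RtoC y.
  rewrite eigenvalue_root // -/W Wt linearZ /= rootZ ?fmorph_eq0 //.
  have -> : root (map_poly (real_complex R) (roots_prod t)) (ofC z) =
     (ofC z \in map (real_complex R) t).
    rewrite -root_prod_XsubC big_map /roots_prod rmorph_prod /=; congr (root _ _).
    by apply: eq_bigr => y _; rewrite rmorphB /= map_polyX map_polyC.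
  split=> [/mapP[y yt E]|[y yt ->]]; last by apply/mapP; exists y.
  by exists y => //; case: z E => u v [-> ->].
have eqv i : (1 <= i <= N)%N -> lam i \in t ->
   (exists f, is_phi_plus (l ++ r)%list (RtoC (lam i)) f /\
     RtoC (c i) = Cdiv (f a) (RtoC (sqrt (Rmult (lam i) (gamma2 (l ++ r)%list (lam i) f))))) <->
   ((UL * UR).[lam i] = - (lam i * c i ^+ 2 * W^`().[lam i]) /\ 0 < c i * UR.[lam i]).
  move=> iN it; set x := lam i in it *; set p := (l ++ r)%list in pp op W W0 k0 Wt WE Et eig *.
  have fa : phi (RtoC x) p a = RtoC (exp (Rdiv (- a) 2) * UR.[x]) := phi_at_value x erefl Hl Hr.
  have ga : gamma2 p x (phi (RtoC x) p) = (energy p).[x] := gamma2_energy x op.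
  have Wx : root W x by rewrite Wt rootZ // root_roots_prod.
  have BU : UR.[x] = exp a * ((coef p).2.[x] * UL.[x]) := value_at_root a Wx.
  have en : (energy p).[x] = - (W^`().[x] * (coef p).2.[x]).
    have := congr1 (fun P : {poly R} => P.[x]) (wronskian_energy p).
    rewrite hornerD !hornerN !hornerM -/W (rootP Wx) mul0r subr0 => ->.
    by rewrite opprK.
  have e0 := Et x it.
  have B0 : (coef p).2.[x] != 0.
    by apply: contraTneq e0 => B0; rewrite en B0 mulr0 oppr0 mulr0 ltxx.
  set v := exp (Rdiv (- a) 2) * UR.[x].
  have ci0 : c i <> 0 by apply/eqP; exact: c0.
  have h0 : 0 < exp (Rdiv (- a) 2) by exact: expR_gt0.
  have hh : exp (Rdiv (- a) 2) * exp (Rdiv (- a) 2) * exp a = 1.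
    by rewrite -expRD -RplusE half_add -expRD -RplusE Rplus_opp_l expR0.
  have crit : RtoC (c i) = Cdiv (RtoC v) (RtoC (sqrt (Rmult x (energy p).[x]))) <->
     ((UL * UR).[x] = - (x * c i ^+ 2 * W^`().[x]) /\ 0 < c i * UR.[x]).
    rewrite normalization_iff //.
    have sg : (0 < c i * v) = (0 < c i * UR.[x]) by rewrite /v mulrCA pmulr_rgt0.
    have vv : v * v = (coef p).2.[x] * (UL * UR).[x].
      rewrite /v hornerM {1}BU.
      transitivity (exp (Rdiv (- a) 2) * exp (Rdiv (- a) 2) * exp a *
         ((coef p).2.[x] * UL.[x] * UR.[x])); first by ring.
      by rewrite hh; ring.
    have cc : c i * c i * (x * (energy p).[x]) =
        (coef p).2.[x] * - (x * c i ^+ 2 * W^`().[x]) by rewrite en; ring.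
    split.
      case=> _ []; rewrite !RmultE cc vv => /(mulfI B0) <- /RltP; by rewrite sg.
    case=> E1 E2; split; first by apply/RltP.
    split; first by rewrite !RmultE cc vv E1.
    by apply/RltP; rewrite sg.
  rewrite -crit; split.
    case=> f [fp]; have ff := phi_plus_unique _ _ _ op fp.
    rewrite ff fa (@gamma2_ext p x f (phi (RtoC x) p)) ?ga //.
  move=> E; exists (phi (RtoC x) p); split; first exact: phi_is_phi_plus.
  by rewrite fa ga.
split.
  case=> inc [sp dat].
  have inc' : increasing N lam.
    by move=> i j i1 ij jN; apply/RltP; apply: inc; exact/ssrnat.leP.
  have iN i : (1 <= i)%coq_nat /\ (i <= N)%coq_nat <-> (1 <= i <= N)%N.
    by split=> [ [/ssrnat.leP-> /ssrnat.leP->]|/andP[/ssrnat.leP ? /ssrnat.leP]].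
  have mem : t =i eigen_seq N lam.
    move=> y; apply/idP/eigen_seqP.
      move=> yt; have /sp[i [/iN ii /RtoC_inj E]] : is_eigenvalue (l ++ r)%list (RtoC y).
        by apply/eig; exists y.
      by exists i.
    case=> i [/iN ii ->]; have /eig[u ut' /RtoC_inj->] // : is_eigenvalue (l ++ r)%list (RtoC (lam i)).
    by apply/sp; exists i.
  have pm : perm_eq t (eigen_seq N lam) by apply: uniq_perm => //; exact: eigen_seq_uniq.
  split=> //.
  - by rewrite -mem.
  - by rewrite WE /unit_prod (perm_big _ pm).
  move=> i ii; apply/eqv => //; first by rewrite mem; apply/eigen_seqP; exists i.
  by apply: dat; apply/iN.
case=> inc L0 WL dat.
have mem : t =i eigen_seq N lam.
  by move=> y; rewrite -(root_unit_prod y t0) -WE WL root_unit_prod.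
have iN i : (1 <= i)%coq_nat /\ (i <= N)%coq_nat <-> (1 <= i <= N)%N.
  by split=> [ [/ssrnat.leP-> /ssrnat.leP->]|/andP[/ssrnat.leP ? /ssrnat.leP]].
split; first by move=> i j /ssrnat.leP i1 /ssrnat.leP ij /ssrnat.leP jN; apply/RltP; exact: inc.
split.
  move=> z; rewrite eig; split=> [ [y]|[i [/iN ii ->]]].
    by rewrite mem => /eigen_seqP[i [/iN ii ->]] ->; exists i.
  by exists (lam i) => //; rewrite mem; apply/eigen_seqP; exists i.
move=> i /iN ii; apply/eqv => //; last exact: dat.
by rewrite mem; apply/eigen_seqP; exists i.
Qed.

End Criterion.
End Spectrum.

(** * Counting the pairs *)

Module Counting.
Import Reals Lra List Sorted.
Import all_boot all_order all_algebra Rstruct complex ring lra zify.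
Import Order.TTheory GRing.Theory Num.Theory.
Import Herglotz Interlacing Configurations Evaluation Spectrum Defs.
Local Open Scope ring_scope.
Set Implicit Arguments.
Unset Strict Implicit.
Local Arguments exp x%_ring_scope.

Lemma lead_value a p : beyond a p -> size (coef p).1 = size (value a p) /\
  exists2 T, 1 <= T & lead_coef (coef p).1 = T * lead_coef (value a p).
Proof.
case: p => [_|s p b].
  by rewrite /value /= mulr0 addr0; split=> //; exists 1; rewrite ?mul1r.
have [sz ld] := size_lead_value_cons b; split=> //.
have /andP[r0 r1] := ratio_bounds (proj1 b).
have r2 : 0 < 1 - exp (a - pos s) by rewrite subr_gt0.
exists (1 - exp (a - pos s))^-1; last by rewrite ld mulKf ?lt0r_neq0.
by rewrite invf_ge1 // lerBlDr lerDl ltW.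
Qed.

Lemma alphaE N (c : nat -> R) : alpha N c = 1 - \sum_(i <- iota 1 N) c i ^+ 2.
Proof.
rewrite /alpha RminusE; congr (_ - _).
elim: N => [|N IH]; first by rewrite big_nil sum_n_m_zero.
rewrite sum_n_Sm; last exact/ssrnat.leP.
have -> : iota 1 N.+1 = iota 1 N ++ [:: N.+1] by rewrite -[X in iota 1 X]addn1 iotaD add1n.
rewrite big_cat /= big_seq1 -IH.
congr (_ + _).
by rewrite -[LHS]/(pow (Rabs (c N.+1)) 2) RpowE RabsE real_normK // num_real.
Qed.

Section Product.
Variables (AL UL AR UR : {poly R}).
Hypotheses (UL0 : UL != 0) (UR0 : UR != 0).

(** An atom at [a], counted on the left side, makes [AL] the dominant factor. *)
Lemma size_with_atom : (size UL < size AL)%N -> (size AR <= size UR)%N ->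
  (size (UL * UR)%R < size (AL * UR + AR * UL - UL * UR)%R)%N.
Proof.
move=> sL sR; have AL0 : AL != 0 by rewrite -size_poly_gt0; apply: leq_trans sL.
have sA : size (AL * UR) = (size AL + size UR).-1 by rewrite size_mul.
have sP : size (UL * UR) = (size UL + size UR).-1 by rewrite size_mul.
have U1 : (0 < size UR)%N by rewrite size_poly_gt0.
have lt1 : (size (UL * UR)%R < size (AL * UR)%R)%N by rewrite sA sP; lia.
have lt2 : (size (AR * UL - UL * UR)%R < size (AL * UR)%R)%N.
  apply: leq_ltn_trans (size_polyD _ _) _; rewrite size_polyN gtn_max lt1 andbT.
  apply: leq_ltn_trans (size_polyMleq _ _) _; rewrite sA.
  case: (size UR) U1 sR => // u _ sR; lia.
by rewrite -addrA size_polyDl.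
Qed.

(** The factor [TL + TR - 1] is positive, so the leading terms do not cancel. *)
Lemma lead_without_atom TL TR : size AL = size UL -> size AR = size UR ->
  1 <= TL -> 1 <= TR ->
  lead_coef AL = TL * lead_coef UL -> lead_coef AR = TR * lead_coef UR ->
  let W := AL * UR + AR * UL - UL * UR in
  size W = size (UL * UR) /\ lead_coef W = (TL + TR - 1) * lead_coef (UL * UR).
Proof.
move=> sL sR TL1 TR1 lL lR W.
have AL0 : AL != 0 by rewrite -size_poly_gt0 sL size_poly_gt0.
have AR0 : AR != 0 by rewrite -size_poly_gt0 sR size_poly_gt0.
have s1 : size (AL * UR) = size (UL * UR) by rewrite !size_mul // sL.
have s2 : size (AR * UL) = size (UL * UR) by rewrite mulrC !size_mul // sR.
set n := (size (UL * UR)).-1.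
have c1 : (AL * UR)`_n = TL * lead_coef (UL * UR).
  by rewrite /n -s1 -lead_coefE !lead_coefM lL mulrA.
have c2 : (AR * UL)`_n = TR * lead_coef (UL * UR).
  by rewrite /n -s2 -lead_coefE !lead_coefM lR -mulrA [_ * lead_coef UL]mulrC.
have cW : W`_n = (TL + TR - 1) * lead_coef (UL * UR).
  have c3 : (UL * UR)`_n = lead_coef (UL * UR) by [].
  rewrite /W coefB coefD c1 c2 c3; ring.
have n0 : W`_n != 0.
  rewrite cW mulf_neq0 ?lead_coef_eq0 ?mulf_neq0 // lt0r_neq0 //; lra.
have sz : size W = size (UL * UR).
  apply/eqP; rewrite eqn_leq; apply/andP; split.
    apply: leq_trans (size_polyD _ _) _; rewrite size_polyN geq_max leqnn andbT.
    by apply: leq_trans (size_polyD _ _) _; rewrite s1 s2 maxnn.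
  have : (n < size W)%N by rewrite ltnNge; apply: contra n0 => /leq_sizeP->.
  by rewrite /n; case: (size _).
by split=> //; rewrite lead_coefE sz.
Qed.
End Product.

Definition right_part a p : config := List.filter (fun s => a < pos s) p.

Lemma right_part_app a l r : beyond (- a) (mirrored l) -> beyond a r ->
  right_part a (l ++ r)%list = r.
Proof.
move=> /beyond_mirrored[_ _ Hl] /beyond_iff[_ _ Hr].
have all_in (q : config) (f : atom -> bool) : (forall s, In s q -> f s) -> List.filter f q = q.
  elim: q => //= s q IH H; rewrite (H s (or_introl erefl)) IH // => t tq.
  by apply: H; right.
have none_in (q : config) (f : atom -> bool) : (forall s, In s q -> ~~ f s) -> List.filter f q = nil.
  elim: q => //= s q IH H; rewrite (negPf (H s (or_introl erefl))) IH // => t tq.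
  by apply: H; right.
rewrite /right_part List.filter_app.
by rewrite none_in ?all_in // => s /Hl; rewrite -leNgt => /ltW.
Qed.

Section Data.
Variables (a : R) (N : nat) (lam c : nat -> R).
Hypothesis c0 : forall i, (1 <= i <= N)%N -> c i != 0.
Hypothesis al0 : alpha N c != 0.

Local Notation L := (eigen_seq N lam).
Local Notation W := (unit_prod L).

Definition good p := is_pair p /\ interior_spectral_data p a N lam c.

Definition residues P := forall i, (1 <= i <= N)%N ->
  P.[lam i] = - (lam i * c i ^+ 2 * W^`().[lam i]).

(** With the values at the eigenvalues given by the data, the linear coefficient in [pf_of_residues] is
[alpha]. *)
Lemma residues_pf P : increasing N lam -> 0 \notin L -> P.[0] = 1 ->
  (size P <= N.+1)%N -> residues P -> exists r b,
  [/\ {in L, forall x, 0 < r x}, 'X * P = lead_coef W *: pf_num (alpha N c) b r L &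
     P`_N = alpha N c * lead_coef W].
Proof.
move=> inc L0 P0 sP res; have uL := eigen_seq_uniq inc.
have sL : size L = N by rewrite size_map size_iota.
have [k k0 Wk] := unit_prodE L0.
have WE : W = lead_coef W *: roots_prod L.
  by rewrite {2}Wk lead_coefZ (monicP (roots_prod_monic _)) mulr1.
have dW x : x \in L -> W^`().[x] != 0.
  by move=> xL; rewrite Wk derivZ hornerZ deriv_roots_prod // mulf_neq0 ?horner_rem_neq0.
pose r x := - (x * P.[x]) / W^`().[x].
have rl i : (1 <= i <= N)%N -> r (lam i) = lam i ^+ 2 * c i ^+ 2.
  move=> iN; have iL : lam i \in L by apply/eigen_seqP; exists i.
  by rewrite /r res //; field; exact: dW.
have nz x : x \in L -> x != 0 by apply: contraTneq => ->.
have al_sum : 1 - \sum_(x <- L) r x / (x * x) = alpha N c.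
  rewrite alphaE big_map; congr (_ - _); apply: eq_big_seq => i.
  rewrite mem_iota add1n ltnS => iN; rewrite rl //.
  have iL : lam i \in L by apply/eigen_seqP; exists i.
  by field; exact: nz.
have [||E1 E2] := pf_of_residues (r := r) uL WE (unit_prod0 _) P0.
- by rewrite size_unit_prod // sL.
- by move=> x xL; rewrite /r divfK // dW.
rewrite al_sum sL in E1 E2.
exists r; eexists; split; [|exact: E1|exact: E2].
move=> x /eigen_seqP[i [iN ->]]; have iL : lam i \in L by apply/eigen_seqP; exists i.
rewrite rl // -exprMn exprn_even_gt0 //.
by apply: mulf_neq0; [exact: nz | exact: c0].
Qed.

(** The pairs sought, cut at [a] into [l] and [r], in the form given by [data_criterion]. *)
Record factored l r : Prop := Factored {
  f_left : beyond (- a) (mirrored l);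
  f_right : beyond a r;
  f_W : (coef (l ++ r)%list).1 = W;
  f_res : residues (value (- a) (mirrored l) * value a r);
  f_size : (size (value (- a) (mirrored l) * value a r)%R <= N.+1)%N;
  f_sign : forall i, (1 <= i <= N)%N -> 0 < c i * (value a r).[lam i] }.

Lemma value0 b p : beyond b p -> (value b p).[0] = 1.
Proof. by move=> /coef_admissible[]. Qed.

Lemma value_neq0 b p : beyond b p -> value b p != 0.
Proof. by move=> /coef_admissible/admissible_neq0. Qed.

(** [P = UL * UR] has leading coefficient [alpha] times that of [W].  Thus [alpha <> 0] excludes an atom
at [a] by [size_with_atom], and then [alpha > 0] by [lead_without_atom]. *)
Lemma good_factored p : good p ->
  [/\ increasing N lam, 0 \notin L, 0 < alpha N c, (0 < N)%N &
   exists l r, p = (l ++ r)%list /\ factored l r].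
Proof.
case=> pp dat; have [l [m [r [E bl br M]]]] := split_at a pp.
have [Sl Gl Pl] := proj1 (beyond_mirrored _ _) bl.
have [Sr Gr Pr] := proj1 (beyond_iff _ _) br.
have Hlm s : In s (l ++ m)%list -> pos s <= a.
  move=> ss; case: (in_app_or _ _ _ ss) => [/Pl/ltW //|sm].
  by case: M sm => [->|[s' [-> <- _]]] // [->|//].
have Ep : p = ((l ++ m) ++ r)%list by rewrite E app_assoc.
rewrite Ep in pp dat; move/(data_criterion lam c0 pp Hlm Pr): dat => [inc L0 WE dat].
have sW : size W = N.+1 by rewrite size_unit_prod // size_map size_iota.
have ULE : value (- a) (mirrored (l ++ m)%list) = value (- a) (mirrored l).
  case: M => [->|[s [-> sa _]]]; first by rewrite app_nil_r.
  rewrite /mirrored List.map_app List.rev_app_distr /= -/(mirrored l) -sa.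
  exact: (value_at_atom (mirror s)).
have UL0 := value_neq0 bl; have UR0 := value_neq0 br.
have WF := coef_app_value (l ++ m)%list r a; rewrite WE ULE in WF.
rewrite ULE in dat.
have res : residues (value (- a) (mirrored l) * value a r) by move=> i iN; case: (dat i iN); rewrite WE.
have P0 : (value (- a) (mirrored l) * value a r).[0] = 1.
  by rewrite hornerM !value0 // mulr1.
have [szR [TR TR1 ldR]] := lead_value br.
have N0 : (0 < N)%N.
  have ne : ((l ++ m) ++ r)%list <> nil by case: (proj1 (is_pairP _) pp).
  rewrite -ltnS -sW -WE; case: ((l ++ m) ++ r)%list ne pp => // s q _ pq.
  have [b [_ Hb]] := Ode.lower_bound (s :: q) 0.
  have bq : beyond b (s :: q).
    have [_ S G] := proj1 (is_pairP _) pq.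
    by apply/beyond_iff; split=> // t /Hb /RltP.
  apply: leq_trans (size_coef_cons bq); rewrite ltnS size_poly_gt0.
  by case: bq => _ [_ /value_neq0].
have lW0 : lead_coef W != 0 by rewrite lead_coef_eq0 -size_poly_gt0 sW.
case: M => [m0|[s [m1 sa gs]]].
  rewrite m0 app_nil_r in pp WE WF Ep.
  have [szL [TL TL1 ldL]] := lead_value bl.
  have [sz ld] := lead_without_atom UL0 UR0 szL szR TL1 TR1 ldL ldR.
  rewrite -WF sW in sz; rewrite -WF in ld.
  have [|rr [b [_ _ PN]]] := residues_pf inc L0 P0 _ res; first by rewrite -sz.
  have al_pos : 0 < alpha N c.
    have lP : lead_coef (value (- a) (mirrored l) * value a r) != 0.
      by rewrite lead_coef_eq0 mulf_neq0.
    have : alpha N c * (TL + TR - 1) = 1.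
      apply: (mulIf lP); rewrite mul1r -mulrA -ld -PN lead_coefE.
      by rewrite -sz.
    move=> E1; have T0 : 0 < TL + TR - 1 by lra.
    by rewrite -(pmulr_lgt0 _ T0) E1.
  split=> //; exists l, r; split=> //; split=> //.
  - by rewrite -sz.
  - by move=> i iN; case: (dat i iN).
exfalso; have sL : (size (value (- a) (mirrored l)) < size (coef (mirrored (l ++ m)%list)).1)%N.
  rewrite m1 /mirrored List.map_app List.rev_app_distr /= -/(mirrored l).
  rewrite -sa -[- pos s]/(pos (mirror s)).
  have bs : beyond (- a - 1) (mirror s :: mirrored l).
    by rewrite /= sa; split=> //; rewrite ltrBlDr ltrDl.
  exact: (size_coef_cons bs).
have szR' : (size (coef r).1 <= size (value a r))%N by rewrite szR.
have := size_with_atom UL0 UR0 sL szR'; rewrite -WF sW => sP.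
have [|rr [b [_ _ PN]]] := residues_pf inc L0 P0 _ res; first exact: ltnW.
have : alpha N c * lead_coef W != 0 by rewrite mulf_neq0.
by rewrite -PN nth_default ?eqxx.
Qed.

Lemma factored_good l r : increasing N lam -> 0 \notin L -> (0 < N)%N ->
  factored l r -> good (l ++ r)%list.
Proof.
move=> inc L0 N0 [bl br WE res sz sg].
have [Sl Gl Pl] := proj1 (beyond_mirrored _ _) bl.
have [Sr Gr Pr] := proj1 (beyond_iff _ _) br.
have pp : is_pair (l ++ r)%list.
  apply/is_pairP; split.
  - move=> E; move: WE; rewrite E /= => /(congr1 (fun P : {poly R} => size P)).
    by rewrite size_unit_prod // size_poly1 size_map size_iota => -[N1]; rewrite -N1 in N0.
  - apply/sorted_app; split=> // s s' /Pl H1 /Pr H2; apply/RltP; exact: lt_trans H2.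
  by move=> s ss; case: (in_app_or _ _ _ ss) => [/Gl|/Gr].
split=> //; apply/(data_criterion lam c0 pp) => //; first by move=> s /Pl/ltW.
by split=> // i iN; split; [rewrite WE; exact: res | exact: sg].
Qed.


Section Choices.
Hypotheses (inc : increasing N lam) (L0 : 0 \notin L) (alp : 0 < alpha N c) (N0 : (0 < N)%N).
Variables (l0 r0 : config) (f0 : factored l0 r0).

Local Notation P := (value (- a) (mirrored l0) * value a r0).

Let P0 : P.[0] = 1.
Proof. by rewrite hornerM !value0 ?mulr1 //; [exact: f_right f0 | exact: f_left f0]. Qed.

Lemma product_unique l r : factored l r -> value (- a) (mirrored l) * value a r = P.
Proof.
move=> f; have sL : size L = N by rewrite size_map size_iota.
apply: (@eq_poly_of_nodes _ _ _ (0 :: L)); rewrite /= ?sL.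
- by rewrite L0 eigen_seq_uniq.
- exact: f_size f.
- exact: f_size f0.
move=> x; rewrite in_cons => /orP[/eqP->|/eigen_seqP[i [iN ->]]].
  by rewrite P0 hornerM !value0 ?mulr1 //; [exact: f_right f | exact: f_left f].
by rewrite (f_res f) // (f_res f0).
Qed.

(** The common polynomial [P] of all the pairs, with its roots [V]: a pair is a choice of roots for [UR],
constrained exactly at the inner roots, and there are one or two outer roots. *)
Lemma roots_of_product : exists V, [/\ uniq V, 0 \notin V, P = unit_prod V &
  [/\ (forall T, (forall y, y \in V -> ~~ outer L y -> T y = root (value a r0) y) ->
      exists l r, factored l r /\ value a r = unit_prod (filter T V)),
   (forall l r, factored l r ->
      value a r = unit_prod (filter (root (value a r)) V) /\
      forall y, y \in V -> ~~ outer L y -> root (value a r) y = root (value a r0) y),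
   ({in L, forall x, 0 < x} \/ {in L, forall x, x < 0} ->
      exists2 y, y \in V & {in V, forall z, outer L z = (z == y)}) &
   (forall x1 x2, x1 \in L -> x2 \in L -> x1 < 0 < x2 ->
      exists y z, [/\ y \in V, z \in V, y != z &
        {in V, forall u, outer L u = (u == y) || (u == z)}])]].
Proof.
have [rr [b [rr0 XP _]]] := residues_pf inc L0 P0 (f_size f0) (f_res f0).
have uL := eigen_seq_uniq inc.
have sL : size L = N by rewrite size_map size_iota.
have [k k0' Wk] := unit_prodE L0.
have kW : lead_coef W = k by rewrite Wk lead_coefZ (monicP (roots_prod_monic _)) mulr1.
rewrite kW in XP.
have [V [uV V0 PV sV pos]] := unit_roots uL rr0 alp k0' Wk XP P0.
have factor l r : factored l r -> value a r = unit_prod (filter (root (value a r)) V).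
  move=> f; have [UR0 _ _ [s [us Us _]]] := coef_admissible (f_right f).
  have US := eq_unit_prod Us UR0.
  have k0 : lead_coef (value a r) != 0 by rewrite lead_coef_eq0; exact: value_neq0 (f_right f).
  have rs y : root (value a r) y = (y \in s) by rewrite Us rootZ // root_roots_prod.
  rewrite {1}US /unit_prod; apply: perm_big; apply: uniq_perm; rewrite ?filter_uniq //.
  move=> y; rewrite mem_filter rs andb_idr // -rs => Uy.
  by rewrite -(root_unit_prod y V0) -PV -(product_unique f) rootM Uy orbT.
have signs l r : factored l r -> {in L, forall x, 0 < (value a r).[x] * (value a r0).[x]}.
  move=> f x /eigen_seqP[i [iN ->]].
  have := mulr_gt0 (f_sign f iN) (f_sign f0 iN).
  have c2 : 0 < c i ^+ 2 by rewrite exprn_even_gt0 //= c0.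
  move=> H; rewrite -(pmulr_rgt0 (_ * _) c2); move: H; congr (0 < _); ring.
have agree := sign_agree uL rr0 alp k0' XP uV V0 PV.
exists V; split=> //; split.
- move=> T /agree TT.
  have [||PT [A1 [A2 [ad1 ad2 WA]]]] := factor_choice T uV V0 (unit_prod0 L) _ _.
  + by rewrite size_unit_prod // sL sV sL.
  + by move=> y yV; rewrite -PV; exact: pos.
  have [r [br E1 EU1]] := coef_surj a ad1.
  have [l [bl E2 EU2]] := coef_surj (- a) ad2.
  exists (mirrored l), r; split=> //.
  have EP : value (- a) (mirrored (mirrored l)) * value a r = P.
    by rewrite mirroredK EU1 EU2 -PT.
  split; rewrite ?EP //.
  + by rewrite mirroredK.
  + by rewrite (coef_app_value _ _ a) mirroredK E1 E2 EU1 EU2 WA.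
  + exact: f_res f0.
  + exact: f_size f0.
  move=> i iN; have iL : lam i \in L by apply/eigen_seqP; exists i.
  have := TT _ iL; rewrite -(factor _ _ f0) -EU1 => H.
  have H1 := mulr_gt0 (f_sign f0 iN) H.
  have u2 : 0 < (value a r0).[lam i] ^+ 2.
    rewrite exprn_even_gt0 //=; apply: contraTneq (f_sign f0 iN) => ->.
    by rewrite mulr0 ltxx.
  rewrite -(pmulr_lgt0 (c i * _) u2); move: H1; congr (0 < _); ring.
- move=> l r f; split; first exact: factor f.
  by apply/agree => x xL; rewrite -(factor _ _ f) -(factor _ _ f0) (signs _ _ f).
- move=> H; apply: (outer_same_sign uL rr0 alp k0' XP V0 PV) => //.
  by rewrite -size_eq0 sL -lt0n.
move=> x1 x2 H1 H2 H; exact: (outer_mixed uL rr0 alp k0' XP V0 PV H1 H2 H).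
Qed.

(** [UR] determines [UL] through [P], and then [AL] and [AR] at the roots of [UL] and [UR] through [W]. *)
Lemma factored_inj l r l' r' : factored l r -> factored l' r' ->
  value a r = value a r' -> l = l' /\ r = r'.
Proof.
move=> f f' E.
have EL : value (- a) (mirrored l) = value (- a) (mirrored l').
  have := product_unique f; rewrite -(product_unique f') E => /mulIf; apply.
  exact: value_neq0 (f_right f').
have [V [uV V0 PV [_ H _ _]]] := roots_of_product.
have disj l1 r1 y : factored l1 r1 -> root (value a r1) y ->
    ~~ root (value (- a) (mirrored l1)) y.
  move=> f1 Ry; have [R1 _] := H _ _ f1; have := product_unique f1.
  have fV0 (B : pred R) : 0 \notin filter B V by rewrite mem_filter (negPf V0) andbF.
  have PE : unit_prod V = unit_prod (filter (predC (root (value a r1))) V) * value a r1.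
    by rewrite {2}R1 mulrC /unit_prod !big_filter (bigID (root (value a r1))).
  rewrite PV PE => /mulIf -> //; last exact: value_neq0 (f_right f1).
  by rewrite root_unit_prod // mem_filter /= Ry.
have cross (A A' B B' U U' : {poly R}) y :
    A * U + B * U' - U' * U = A' * U + B' * U' - U' * U ->
    root U y -> ~~ root U' y -> B.[y] = B'.[y].
  move=> /(congr1 (fun P : {poly R} => P.[y])).
  rewrite /= !(hornerD, hornerN, hornerM) => E1 /rootP U0 U'0; move: E1.
  by rewrite U0 !mulr0 !subr0 !add0r => /mulIf; apply.
have adR := coef_admissible (f_right f); have adR' := coef_admissible (f_right f').
have adL := coef_admissible (f_left f); have adL' := coef_admissible (f_left f').
have WE := f_W f; rewrite (coef_app_value _ _ a) in WE.
have WE' := f_W f'; rewrite (coef_app_value _ _ a) -EL -E in WE'.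
have ER : (coef r).1 = (coef r').1.
  rewrite E in adR; apply: (admissible_unique adR adR') => y Ry.
  rewrite -E in Ry; have Ly := disj _ _ _ f Ry.
  exact: cross (etrans WE (esym WE')) Ry Ly.
have EL1 : (coef (mirrored l)).1 = (coef (mirrored l')).1.
  rewrite EL in adL; apply: (admissible_unique adL adL') => y Ly.
  rewrite -EL in Ly.
  have Ry : ~~ root (value a r) y by apply: contraL Ly => Ry; apply: disj f Ry.
  apply: (cross (coef r).1 (coef r').1 _ _ (value (- a) (mirrored l)) (value a r) y) => //.
  by rewrite ![_.1 * value (- a) _ + _]addrC ![value a r * _]mulrC WE WE'.
split; last exact: coef_inj (f_right f) (f_right f') ER E.
rewrite -(mirroredK l) -(mirroredK l'); congr mirrored.
exact: coef_inj (f_left f) (f_left f') EL1 EL.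
Qed.

End Choices.

(** A pair is encoded by the set [B] of those outer roots that are roots of [UR]. *)
Lemma good_count p0 : good p0 ->
  ({in L, forall x, 0 < x} \/ {in L, forall x, x < 0} -> exactly 2 good) /\
  (forall x1 x2, x1 \in L -> x2 \in L -> x1 < 0 < x2 -> exactly 4 good).
Proof.
move=> g0; have [inc L0 alp N0 [l0 [r0 [_ f0]]]] := good_factored g0.
have [V [uV V0 PV [ex fac same mixed]]] := roots_of_product inc L0 alp N0 f0.
pose T (B : seq R) y := if outer L y then y \in B else root (value a r0) y.
pose enc p B := good p /\ value a (right_part a p) = unit_prod (filter (T B) V).
have fV0 (B : pred R) : 0 \notin filter B V by rewrite mem_filter (negPf V0) andbF.
have enc_ex B : exists p, enc p B.
  have [|l [r [f EU]]] := ex (T B); first by move=> y yV /negPf out; rewrite /T out.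
  exists (l ++ r)%list; split; first exact: factored_good f.
  by rewrite (right_part_app (f_left f) (f_right f)).
have enc_sep p B B' : enc p B -> enc p B' ->
    {in V, forall y, outer L y -> (y \in B) = (y \in B')}.
  move=> [_ E1] [_ E2] y yV out; have := root_unit_prod y (fV0 (T B)).
  by rewrite -E1 E2 root_unit_prod // !mem_filter yV !andbT /T out => ->.
have enc_inj p p' B : enc p B -> enc p' B -> p = p'.
  move=> [gp E1] [gp' E2].
  have [_ _ _ _ [l [r [Ep f]]]] := good_factored gp.
  have [_ _ _ _ [l' [r' [Ep' f']]]] := good_factored gp'.
  move: E1 E2; rewrite Ep Ep' (right_part_app (f_left f) (f_right f)).
  rewrite (right_part_app (f_left f') (f_right f')).
  move=> E1 E2; by have [-> ->] := factored_inj inc L0 alp N0 f0 f f' (etrans E1 (esym E2)).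
have enc_good p B : good p -> {in V, forall y, outer L y ->
    (y \in B) = root (value a (right_part a p)) y} -> enc p B.
  move=> gp HB; split=> //; have [_ _ _ _ [l [r [Ep f]]]] := good_factored gp.
  move: HB; rewrite Ep (right_part_app (f_left f) (f_right f)) => HB.
  have [E1 E2] := fac _ _ f; rewrite {1}E1; congr unit_prod.
  apply: eq_in_filter => y yV; rewrite /T; case: ifP => out; first by rewrite HB.
  by rewrite E2 // out.
split.
  move=> /same[y yV out].
  have [p1 e1] := enc_ex [::]; have [p2 e2] := enc_ex [:: y].
  exists [:: p1; p2]; split; [|split=> //].
    apply: NoDup_cons; last by apply: NoDup_cons => //; exact: NoDup_nil.
    case=> // E; rewrite E in e2; have := enc_sep _ _ _ e1 e2 y yV.
    by rewrite out // eqxx mem_head => /(_ isT).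
  move=> p; split; first by case=> [<-|[<-|//]]; [case: e1 | case: e2].
  move=> gp; case: (boolP (root (value a (right_part a p)) y)) => Ry.
    right; left; apply: enc_inj e2 _; apply: enc_good => // z zV.
    by rewrite out // => /eqP->; rewrite mem_head Ry.
  left; apply: enc_inj e1 _; apply: enc_good => // z zV.
  by rewrite out // => /eqP->; rewrite (negPf Ry).
move=> x1 x2 H1 H2 H; have [y [z [yV zV yz out]]] := mixed x1 x2 H1 H2 H.
have [p1 e1] := enc_ex [::]; have [p2 e2] := enc_ex [:: y].
have [p3 e3] := enc_ex [:: z]; have [p4 e4] := enc_ex [:: y; z].
have oy : outer L y by rewrite out // eqxx.
have oz : outer L z by rewrite out // eqxx orbT.
have sep p B B' : enc p B -> enc p B' ->
    ((y \in B) = (y \in B')) /\ ((z \in B) = (z \in B')).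
  by move=> e e'; rewrite !(enc_sep _ _ _ e e').
have zy := yz; rewrite eq_sym in zy.
have mems : ((y \in [:: y; z]) = true) * ((z \in [:: y; z]) = true) *
    ((y \in [:: y]) = true) * ((z \in [:: y]) = false) *
    ((y \in [:: z]) = false) * ((z \in [:: z]) = true).
  by rewrite !inE !eqxx (negPf yz) (negPf zy) orbT.
have ne p q B B' : enc p B -> enc q B' ->
    ((y \in B) != (y \in B')) || ((z \in B) != (z \in B')) -> p <> q.
  by move=> e e' + E; rewrite E in e; have [-> ->] := sep _ _ _ e e'; rewrite !eqxx.
exists [:: p1; p2; p3; p4]; split; [|split=> //].
  apply: NoDup_cons.
    case=> [E|[E|[E|//]]]; [apply: (ne _ _ _ _ e1 e2 _ (esym E)) |
      apply: (ne _ _ _ _ e1 e3 _ (esym E)) | apply: (ne _ _ _ _ e1 e4 _ (esym E))];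
      by rewrite mems in_nil ?orbT // mems.
  apply: NoDup_cons.
    case=> [E|[E|//]]; [apply: (ne _ _ _ _ e2 e3 _ (esym E)) |
      apply: (ne _ _ _ _ e2 e4 _ (esym E))]; by rewrite !mems.
  apply: NoDup_cons; last by apply: NoDup_cons => //; exact: NoDup_nil.
  by case=> [E|//]; apply: (ne _ _ _ _ e3 e4 _ (esym E)); rewrite !mems.
move=> p; split.
  by case=> [<-|[<-|[<-|[<-|//]]]]; [case: e1 | case: e2 | case: e3 | case: e4].
move=> gp.
case: (boolP (root (value a (right_part a p)) y)) => Ry;
  case: (boolP (root (value a (right_part a p)) z)) => Rz.
- right; right; right; left; apply: enc_inj e4 _; apply: enc_good => // u uV'.
  by rewrite out // => /orP[]/eqP->; rewrite mems ?Ry ?Rz.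
- right; left; apply: enc_inj e2 _; apply: enc_good => // u uV'.
  by rewrite out // => /orP[]/eqP->; rewrite mems ?Ry ?(negPf Rz).
- right; right; left; apply: enc_inj e3 _; apply: enc_good => // u uV'.
  by rewrite out // => /orP[]/eqP->; rewrite mems ?Rz ?(negPf Ry).
left; apply: enc_inj e1 _; apply: enc_good => // u uV'.
by rewrite out // => /orP[]/eqP->; rewrite ?(negPf Ry) ?(negPf Rz).
Qed.


End Data.

Lemma interior_spectral_count (a : R) (N : nat) (lam c : nat -> R) :
  (exists p, good a N lam c p) -> alpha N c <> 0 ->
  (forall i, (1 <= i)%coq_nat /\ (i <= N)%coq_nat -> c i <> 0) ->
  (Rlt 0 (lam 1%N) \/ Rlt (lam N) 0 -> exactly 2 (good a N lam c)) /\
  ((exists j, ((1 <= j)%coq_nat /\ (j <= Nat.sub N 1)%coq_nat) /\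
      Rlt (lam j) 0 /\ Rlt 0 (lam j.+1)) -> exactly 4 (good a N lam c)).
Proof.
move=> [p gp] /eqP al0 Hc.
have c0 i : (1 <= i <= N)%N -> c i != 0.
  by case/andP=> /ssrnat.leP i1 /ssrnat.leP iN; apply/eqP; exact: Hc.
have [inc _ _ N0 _] := good_factored c0 al0 gp.
have [two four] := good_count c0 al0 gp.
split=> [ends|[j [[/ssrnat.leP j1 /ssrnat.leP jN] [/RltP lj /RltP lj1]]]].
  apply: two; case: ends => /RltP H; [left|right] => x /eigen_seqP[i [/andP[i1 iN] ->]].
    by move: i1; rewrite leq_eqVlt => /orP[/eqP<-//|i1]; apply: lt_trans H _; exact: inc.
  by move: iN; rewrite leq_eqVlt => /orP[/eqP->//|iN]; apply: lt_trans H; exact: inc.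
rewrite -[Nat.sub N 1]/(N - 1)%N in jN.
apply: (four (lam j) (lam j.+1)); last by rewrite lj.
  by apply/eigen_seqP; exists j; split=> //; rewrite j1; lia.
by apply/eigen_seqP; exists j.+1; split=> //; lia.
Qed.

End Counting.

Theorem theorem3p6 (a : R) (N : nat) (lam c : nat -> R)
  (Hdata : exists p : config,
     is_pair p /\ interior_spectral_data p a N lam c)
  (Halpha : alpha N c <> 0)
  (Hc : forall i : nat, (1 <= i <= N)%nat -> c i <> 0) :
  ((0 < lam 1%nat \/ lam N < 0) ->
     exactly 2 (fun p => is_pair p /\ interior_spectral_data p a N lam c))
  /\
  ((exists j0 : nat, (1 <= j0 <= N - 1)%nat /\
      lam j0 < 0 /\ 0 < lam (S j0)) ->
     exactly 4 (fun p => is_pair p /\ interior_spectral_data p a N lam c)).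
Proof.
exact (Counting.interior_spectral_count Hdata Halpha Hc).
Qed.
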